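(* Let $F=K\cup\bigcup_{i=1}^nP_i$ be a Nyikos decomposition of an orientable $\omega$-bounded surface $F$, and let $\mathcal{M}(F)$, $\mathcal{M}(K)$, $\mathcal{M}(P_i)$ and $\mathcal{N}(F)$ be as defined below. Then: (1) $\mathcal{N}(F)$ is a normal subgroup of $\mathcal{M}(F)$; (2) the map $\theta:\mathcal{M}(K)\times\mathcal{M}(P_1)\times\cdots\times\mathcal{M}(P_n)\to\mathcal{N}(F)$, defined by sending $([h_0],[h_1],\dots,[h_n])$ to the class $[h]$ of the homeomorphism $h:F\to F$ with $h|_K=h_0$ and $h|_{P_i}=h_i$ for each $i$, is a well-defined group epimorphism.
   Context: A surface is a connected Hausdorff space locally homeomorphic to $\mathbb{R}^2$ (possibly with boundary where indicated). A space is $\omega$-bounded if every countable subset has compact closure. A (closed) long pipe is a surface $P$ with boundary homeomorphic to $\mathbb{S}^1$ such that $P=\bigcup_{\alpha<\omega_1}U_\alpha$, where each $U_\alpha$ is an open subset of $P$ containing $\partial P$ and homeomorphic to $\mathbb{S}^1\times[0,\infty)$, and whenever $\alpha<\beta$ we have $\overline{U_\alpha}\subset U_\beta$ and the boundary of $U_\alpha$ in $U_\beta$ is homeomorphic to $\mathbb{S}^1$. A Nyikos decomposition of an $\omega$-bounded surface $F$ is an expression $F=K\cup\bigcup_{i=1}^nP_i$ where $K$ is a compact surface with $n$ boundary circles, $P_1,\dots,P_n$ are pairwise disjoint closed long pipes, and each $P_i$ meets $K$ exactly in $\partial P_i$, which is a boundary component of $K$ (distinct pipes attached along distinct boundary components).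 All homeomorphisms are orientation-preserving. $\mathcal{M}(F)$ is the group of isotopy classes $[h]$ of homeomorphisms $h:F\to F$. $\mathcal{M}(K)$ is the group of classes of homeomorphisms $h:K\to K$ with $h|_{\partial K}=\mathrm{id}$, modulo isotopies fixing $\partial K$ pointwise; $\mathcal{M}(P_i)$ is likewise the group of classes of homeomorphisms $h:P_i\to P_i$ with $h|_{\partial P_i}=\mathrm{id}$, modulo isotopies fixing $\partial P_i$ pointwise. $\mathcal{N}(F)=\{[h]\in\mathcal{M}(F): h(K)=K\text{ and } h(P_i)=P_i\text{ for each } i\}$, i.e. the classes containing a representative leaving $K$ and each $P_i$ invariant. *)

(* Defs.v *)
From HB Require Import structures.
From mathcomp Require Import all_boot all_order all_algebra.
From mathcomp Require Import all_classical all_reals all_analysis.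

Set Implicit Arguments.
Unset Strict Implicit.
Unset Printing Implicit Defensive.

Import Order.TTheory GRing.Theory Num.Theory.
Import numFieldNormedType.Exports.
Local Open Scope classical_set_scope.
Local Open Scope ring_scope.

Section Surfaces.
Variable R : realType.

Definition closed_disk (p : R * R) (r : R) : set (R * R) :=
  [set z | (z.1 - p.1) ^+ 2 + (z.2 - p.2) ^+ 2 <= r ^+ 2].

Definition circle_loop (p : R * R) (r : R) (t : R) : R * R :=
  (p.1 + r * cos (2 * pi * t), p.2 + r * sin (2 * pi * t)).

Definition winds_once (g : R -> R * R) (q : R * R) : Prop :=
  exists th : R -> R,
    {within [set t : R | 0 <= t <= 1], continuous th} /\
    (forall t : R, 0 <= t <= 1 ->
       let d := Num.sqrt (((g t).1 - q.1) ^+ 2 + ((g t).2 - q.2) ^+ 2) in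
       0 < d /\ (g t).1 - q.1 = d * cos (th t) /\ (g t).2 - q.2 = d * sin (th t)) /\
    th 1 - th 0 = 2 * pi.

(** f (a map defined at least on D) is a local homeomorphism preserving
    orientation at p: on some closed disk around p inside D, f is continuous
    and injective, and the image of the positively oriented boundary circle
    winds once positively around f p (local degree +1). *)
Definition loc_orient_pres (D : set (R * R)) (f : R * R -> R * R) (p : R * R)
  : Prop :=
  exists r : R, 0 < r /\ closed_disk p r `<=` D /\
    {within closed_disk p r, continuous f} /\
    (forall a b, closed_disk p r a -> closed_disk p r b -> f a = f b -> a = b) /\
    winds_once (f \o circle_loop p r) (f p).

Definition upper_half_plane : set (R * R) := [set z | 0 <= z.2].
Definition unit_circle : set (R * R) := [set z | z.1 ^+ 2 + z.2 ^+ 2 = 1].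
Definition half_cylinder : set ((R * R) * R) :=
  [set z | unit_circle z.1 /\ 0 <= z.2].

Variable X : topologicalType.

Definition homeo_pair {T U : topologicalType} (A : set T) (B : set U)
  (f : T -> U) (g : U -> T) : Prop :=
  [/\ {within A, continuous f}, {within B, continuous g},
      f @` A `<=` B, g @` B `<=` A &
      (forall a, A a -> g (f a) = a) /\ (forall b, B b -> f (g b) = b)].

Definition homeomorphic {T U : topologicalType} (A : set T) (B : set U) : Prop :=
  exists f g, homeo_pair A B f g.

Definition self_homeo (A : set X) (f : X -> X) : Prop :=
  exists g, homeo_pair A A f g.

Record chart := Chart { cdom : set X; cmap : X -> R * R; cinv : R * R -> X }.

Definition is_chart (c : chart) : Prop :=
  [/\ open (cdom c), open (cmap c @` cdom c) &
      homeo_pair (cdom c) (cmap c @` cdom c) (cmap c) (cinv c)].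

Definition bchart (S : set X) (c : chart) : Prop :=
  [/\ open (cdom c),
      (exists W, open W /\ cmap c @` (cdom c `&` S) = W `&` upper_half_plane) &
      homeo_pair (cdom c `&` S) (cmap c @` (cdom c `&` S)) (cmap c) (cinv c)].

Definition surface : Prop :=
  [/\ hausdorff_space X, connected [set: X] &
      forall x : X, exists c, is_chart c /\ cdom c x].

(** S ⊆ X is a surface, possibly with boundary (X is Hausdorff) *)
Definition bsurface (S : set X) : Prop :=
  connected S /\ forall x, S x -> exists c, bchart S c /\ cdom c x.

Definition sbd (S : set X) : set X :=
  [set x | S x /\ exists c, [/\ bchart S c, cdom c x & (cmap c x).2 = 0]].

Definition omega_bounded : Prop :=
  forall C : set X, countable C -> compact (closure C).

Definition is_orientation (O : set chart) : Prop :=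
  [/\ forall c, O c -> is_chart c,
      forall x, exists c, O c /\ cdom c x &
      forall c d, O c -> O d -> forall p, (cmap c @` (cdom c `&` cdom d)) p ->
        loc_orient_pres (cmap c @` (cdom c `&` cdom d)) (cmap d \o cinv c) p].

(** h is orientation preserving (with respect to O) at all points of A,
    where A is an open subset of X on which h is defined *)
Definition orient_pres_on (O : set chart) (A : set X) (h : X -> X) : Prop :=
  forall c d x, O c -> O d -> A x -> cdom c x -> cdom d (h x) ->
    loc_orient_pres (cmap c @` (cdom c `&` A `&` h @^-1` cdom d))
      (cmap d \o h \o cinv c) (cmap c x).

Definition omega1_like (I : Type) (lt : I -> I -> Prop) : Prop :=
  [/\ (forall a, ~ lt a a) /\ (forall a b c, lt a b -> lt b c -> lt a c),
      (forall a b, [\/ lt a b, a = b | lt b a]), well_founded lt,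
      ~ countable [set: I] & forall a, countable [set b | lt b a]].

Definition long_pipe (P : set X) : Prop :=
  [/\ bsurface P, homeomorphic (sbd P) unit_circle &
    exists (I : Type) (lt : I -> I -> Prop) (U : I -> set X),
      [/\ omega1_like lt,
          P = \bigcup_a U a,
          forall a, (exists V, open V /\ U a = V `&` P) /\ sbd P `<=` U a
                    /\ homeomorphic (U a) half_cylinder &
          forall a b, lt a b ->
            closure (U a) `&` P `<=` U b /\
            (* boundary of U a in U b (U a is open in U b) *)
            homeomorphic ((closure (U a) `&` U b) `\` U a) unit_circle]].

Definition is_component (A C : set X) : Prop :=
  exists x, A x /\ C = connected_component A x.

Definition nyikos_decomposition (K : set X) (n : nat) (P : 'I_n -> set X)
  : Prop :=
  [/\ compact K /\ bsurface K,
      (forall i, long_pipe (P i)) /\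
      (forall i j, i != j -> P i `&` P j = set0),
      K `|` \bigcup_i P i = [set: X],
      (forall i, K `&` P i = sbd (P i)) &
      (forall i, is_component (sbd K) (sbd (P i))) /\
      (forall C, is_component (sbd K) C -> exists i, C = sbd (P i))].

Definition MF_rep (O : set chart) (h : X -> X) : Prop :=
  self_homeo [set: X] h /\ orient_pres_on O [set: X] h.

Definition MS_rep (O : set chart) (S : set X) (h : X -> X) : Prop :=
  [/\ self_homeo S h, (forall x, sbd S x -> h x = x) &
      orient_pres_on O (S `\` sbd S) h].

Definition isotopic_rel (S B : set X) (h h' : X -> X) : Prop :=
  exists H : R -> X -> X,
    [/\ {within [set p : R * X | 0 <= p.1 <= 1 /\ S p.2],
          continuous (fun p : R * X => H p.1 p.2)},
        (forall t, 0 <= t <= 1 -> self_homeo S (H t)),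
        (forall t x, 0 <= t <= 1 -> B x -> H t x = x),
        (forall x, S x -> H 0 x = h x) &
        (forall x, S x -> H 1 x = h' x)].

Definition isotopic (h h' : X -> X) : Prop := isotopic_rel [set: X] set0 h h'.

Definition preserves (K : set X) (n : nat) (P : 'I_n -> set X) (h : X -> X)
  : Prop := h @` K = K /\ forall i, h @` P i = P i.

Definition in_N (O : set chart) (K : set X) (n : nat) (P : 'I_n -> set X)
  (h : X -> X) : Prop :=
  exists h', [/\ MF_rep O h', preserves K P h' & isotopic h h'].

Definition glued (K : set X) (n : nat) (P : 'I_n -> set X)
  (h0 : X -> X) (hs : 'I_n -> X -> X) (h : X -> X) : Prop :=
  (forall x, K x -> h x = h0 x) /\ (forall i x, P i x -> h x = hs i x).

End Surfaces.

(* Main.v *)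
Require Import Defs.
From HB Require Import structures.
From mathcomp Require Import all_boot all_order all_algebra.
From mathcomp Require Import all_classical all_reals all_analysis.
From mathcomp Require Import ring lra zify.
Set Implicit Arguments.
Unset Strict Implicit.
Unset Printing Implicit Defensive.
Import Order.TTheory GRing.Theory Num.Theory.
Import numFieldNormedType.Exports.
Local Open Scope classical_set_scope.
Local Open Scope ring_scope.

(** Plane topology comes from winding numbers.  A loop around the origin has a
    continuous angle, and Borsuk's antipodal trick shows that an injective map of
    a disk has odd local degree.  This gives invariance of domain, and a local
    degree of homeomorphisms that is multiplicative, locally constant and
    unchanged along isotopies, so that preservation of orientation can be tested
    at a nearby point or at another time of an isotopy.

    The circles bounding the pipes are collared on the side of [K] by pushing
    them outwards along finitely many boundary charts.  A homeomorphism that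
    preserves [K] and the pipes acts on each circle by a map of degree [1]: in
    degree [-1] there would be a fixed point at which the local degree is [-1].
    Hence it can be untwisted along the collars until it fixes the circles
    pointwise, which gives surjectivity of [theta].

    For normality, let [T'] be isotopic to the identity and push the circles off
    [g K], so that [g^-1 T'] maps each of them into the interior of a pipe.
    Conjugating the part of [h] that lives on the pipes by a second push makes
    [h] the identity on a neighbourhood of these images.  Then
    [T'^-1 g h g^-1 T'] is the identity near every bounding circle and therefore
    preserves every component of the complement.  Neither the annulus theorem nor
    the Schoenflies theorem is needed. *)

(** * Angles of plane vectors *)

(** A compact subset of a long pipe lies in a single one of its cylinders, and every auxiliary
    motion is composed of pieces with compact support in collar coordinates; no coordinate on a
    whole pipe is ever required. The two sides of a bounding circle are unequal: the pipe comes with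
    product coordinates, while [K] offers only local boundary charts. The collar inside [K] is
    therefore manufactured from the pipe, as the image of the part of its cylinder below some
    positive height function under a homeomorphism of the surface that brings this height down to
    the circle. Oddness is all that is used of the degree of an unknown embedding: it excludes
    degree zero in invariance of domain, and it allows the degree of a coordinate change to be
    cancelled. In the normality argument the curves [g (sbd (P i))] may meet the circles in an
    arbitrarily complicated set. Pushing across a whole compact set makes their mutual position
    irrelevant. *)

Section Continuity.
Variables (R : realType) (T : topologicalType).
Implicit Types (f g : T -> R) (U V : topologicalType).

Lemma continuous_add f g :
  continuous f -> continuous g -> continuous (fun x => f x + g x).
Proof. by move=> cf cg x; exact: (@cvgD _ R^o _ _ _ f g _ _ (cf x) (cg x)). Qed.

Lemma continuous_opp f : continuous f -> continuous (fun x => - f x).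
Proof. by move=> cf x; exact: (@cvgN _ R^o _ _ _ f _ (cf x)). Qed.

Lemma continuous_mul f g :
  continuous f -> continuous g -> continuous (fun x => f x * g x).
Proof. by move=> cf cg x; exact: (@cvgM _ _ _ _ f g _ _ (cf x) (cg x)). Qed.

Lemma continuous_exp f n : continuous f -> continuous (fun x => f x ^+ n).
Proof.
move=> cf; elim: n => [|n IHn].
  by have -> : (fun x => f x ^+ 0) = cst 1; [exact/funext|exact: cst_continuous].
have -> : (fun x => f x ^+ n.+1) = (fun x => f x * f x ^+ n).
  by apply/funext => x; rewrite exprS.
exact: continuous_mul.
Qed.

Lemma continuous_inv f :
  (forall x, f x != 0) -> continuous f -> continuous (fun x => (f x)^-1).
Proof. by move=> f0 cf x; apply: cvgV => //; exact: cf. Qed.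

Lemma continuous_pair U V (f : T -> U) (g : T -> V) :
  continuous f -> continuous g -> continuous (fun x => (f x, g x)).
Proof. by move=> cf cg x; apply: cvg_pair; [exact: cf|exact: cg]. Qed.

Lemma continuous_compose U V (f : T -> U) (g : U -> V) :
  continuous g -> continuous f -> continuous (fun x => g (f x)).
Proof. by move=> cg cf x; apply: continuous_comp; [exact: cf|exact: cg]. Qed.

Lemma continuous_maxr f g :
  continuous f -> continuous g -> continuous (fun x => Num.max (f x) (g x)).
Proof.
move=> cf cg; exact: (continuous_compose (@max_continuous _ R) (continuous_pair cf cg)).
Qed.

Lemma continuous_minr f g :
  continuous f -> continuous g -> continuous (fun x => Num.min (f x) (g x)).
Proof.
move=> cf cg; exact: (continuous_compose (@min_continuous _ R) (continuous_pair cf cg)).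
Qed.

Lemma continuous_normr f : continuous f -> continuous (fun x => `|f x|).
Proof. by move=> cf x; exact: (@cvg_norm _ R^o _ _ _ f _ (cf x)). Qed.

(** Trades continuity on a subset for continuity of a total function. This is why parameters are
    clamped into their domain throughout. *)
Lemma within_comp_continuous U V (D : set U) (g : U -> V) (f : T -> U) :
  {within D, continuous g} -> continuous f -> (forall x, D (f x)) ->
  continuous (fun x => g (f x)).
Proof.
move=> /subspace_continuousP cg cf Df x N Ng.
have := cf x _ (cg _ (Df x) _ Ng); apply: (@filterS _ (nbhs x)) => y /=.
exact.
Qed.

End Continuity.

Lemma continuous_fst1 (U V : topologicalType) : continuous (fun x : U * V => x.1).
Proof. by move=> x; exact: cvg_fst. Qed.
Lemma continuous_snd1 (U V : topologicalType) : continuous (fun x : U * V => x.2).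
Proof. by move=> x; exact: cvg_snd. Qed.

Lemma continuous_atan1 (R : realType) : continuous (@atan R).
Proof. by move=> x; apply: continuous_atan. Qed.
Lemma continuous_expR1 (R : realType) : continuous (@expR R).
Proof. by move=> x; apply: continuous_expR. Qed.

(** Decomposes a continuity goal along its formula. The branch on partial applications serves goals
    that lost their binder by eta-reduction; nonvanishing of denominators is left to the caller. *)
Ltac ct :=
  repeat match goal with
  | H : continuous ?f |- continuous ?f => exact H
  | H : continuous ?f |- continuous (fun x => ?f x) => exact H
  | |- continuous (fun x => x) => by move=> ?; exact: cvg_id
  | |- continuous (fun=> ?c) => exact: cst_continuous
  | |- continuous -%R => apply: continuous_opp
  | |- continuous ?f => match f with
      | @Order.min _ _ ?a => refine (@continuous_minr _ _ (fun=> a) (fun x => x) _ _)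
      | @Num.norm _ _ => refine (@continuous_normr _ _ (fun x => x) _)
      | pair ?a => refine (@continuous_pair _ _ _ (fun=> a) (fun x => x) _ _)
      | @GRing.mul _ ?a => refine (@continuous_mul _ _ (fun=> a) (fun x => x) _ _)
      | +%R ?a => refine (@continuous_add _ _ (fun=> a) (fun x => x) _ _)
      | @Order.max _ _ ?a => refine (@continuous_maxr _ _ (fun=> a) (fun x => x) _ _)
      end
  | |- continuous fst => exact: continuous_fst1
  | |- continuous snd => exact: continuous_snd1
  | |- continuous (@cos _) => exact: continuous_cos
  | |- continuous (@sin _) => exact: continuous_sin
  | |- continuous (@atan _) => exact: continuous_atan1
  | |- continuous (@expR _) => exact: continuous_expR1
  | |- continuous (fun x => x.1) => exact: continuous_fst1
  | |- continuous (fun x => x.2) => exact: continuous_snd1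
  | |- continuous (fun x => _ + _) => apply: continuous_add
  | |- continuous (fun x => - _) => apply: continuous_opp
  | |- continuous (fun x => _ * _) => apply: continuous_mul
  | |- continuous (fun x => _ ^+ _) => apply: continuous_exp
  | |- continuous (fun x => _ ^-1) => apply: continuous_inv
  | |- continuous (fun x => (_, _)) => apply: continuous_pair
  | |- continuous (fun x => Order.max _ _) => apply: continuous_maxr
  | |- continuous (fun x => Order.min _ _) => apply: continuous_minr
  | |- continuous (fun x => `| _ |) => apply: continuous_normr
  | |- continuous (fun x => cos _) => apply: (continuous_compose (@continuous_cos _))
  | |- continuous (fun x => sin _) => apply: (continuous_compose (@continuous_sin _))
  | |- continuous (fun x => atan _) => apply: (continuous_compose (@continuous_atan1 _))
  | |- continuous (fun x => expR _) => apply: (continuous_compose (@continuous_expR1 _))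
  | |- continuous (fun x => (_ : _ * _).1) => apply: (continuous_compose (@continuous_fst1 _ _))
  | |- continuous (fun x => (_ : _ * _).2) => apply: (continuous_compose (@continuous_snd1 _ _))
  | H : continuous ?f |- continuous (fun x => ?f _) => apply: (continuous_compose H)
  end.

Section Angle.
Variable R : realType.
Implicit Types (v w : R * R) (a b : R).

(** For complex numbers [v] and [w], [dot] and [crs] are the real and imaginary parts of the product
    of the conjugate of [v] with [w]. *)
Definition dot v w : R := v.1 * w.1 + v.2 * w.2.
Definition crs v w : R := v.1 * w.2 - v.2 * w.1.

(** A relation, since arguments are defined only modulo [2 * pi]; the condition [0 < d] builds in
    that [v] is nonzero. *)
Definition ang v a := exists d : R, 0 < d /\ v = (d * cos a, d * sin a).

Lemma pairE v : v = (v.1, v.2). Proof. by case: v. Qed.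

Lemma dot_gt0 v : v != 0 -> 0 < dot v v.
Proof.
case: v => x y; rewrite /dot /= -!expr2 => n0.
rewrite lt_def addr_ge0 ?sqr_ge0// andbT; apply: contra n0.
by rewrite paddr_eq0 ?sqr_ge0// !sqrf_eq0 => /andP[/eqP -> /eqP ->].
Qed.

Lemma ang_neq0 v a : ang v a -> v != 0.
Proof.
move=> [d [d0 ->]]; apply/eqP => -[] /eqP.
rewrite mulf_eq0 gt_eqF//= => /eqP c0 /eqP; rewrite mulf_eq0 gt_eqF//= => /eqP s0.
by have := cos2Dsin2 a; rewrite c0 s0 expr0n /= addr0 => /eqP; rewrite eq_sym oner_eq0.
Qed.

Lemma two_pi_gt0 : 0 < 2 * pi :> R.
Proof. by rewrite mulr_gt0// pi_gt0. Qed.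

Lemma cosD2piz a (k : int) : cos (a + 2 * pi * k%:~R) = cos a :> R.
Proof.
have H (n : nat) b : cos (b + 2 * pi * n%:R) = cos b :> R.
  elim: n b => [|n IH] b; first by rewrite mulr0 addr0.
  have -> : b + 2 * pi * n.+1%:R = b + 2 * pi * n%:R + pi *+ 2.
    by rewrite -natr1 -[pi *+ 2]mulr_natl; ring.
  by rewrite cosD2pi IH.
case: k => n; first exact: H.
by rewrite NegzE mulrNz mulrN -[LHS](H n.+1) subrK.
Qed.

Lemma sinD2piz a (k : int) : sin (a + 2 * pi * k%:~R) = sin a :> R.
Proof. by rewrite -!cosBpihalf addrAC cosD2piz. Qed.

Lemma period_reduce (t : R) :
  exists k : int, 0 <= (t + 2 * pi * k%:~R : R) < 2 * pi.
Proof.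
have p0 := two_pi_gt0; exists (- Num.floor (t / (2 * pi))).
have /andP[] := floor_itv (t / (2 * pi)).
rewrite mulrNz ler_pdivlMr// ltr_pdivrMr// intrD => h1 h2.
by apply/andP; split; lra.
Qed.

(** The period is at least [4] because [pi >= 2]. The bound [3] covers two parameters at distance at
    most [1] from a common centre. *)
Lemma period_close (s t : R) (k : int) :
  s = t + 2 * pi * k%:~R -> `|s - t| <= 3 -> s = t.
Proof.
move=> E; have p0 := two_pi_gt0; have p2 := @pi_ge2 R.
rewrite E addrAC subrr add0r normrM (gtr0_norm p0) => h.
suff -> : k = 0 by rewrite mulr0 addr0.
have n1 : `|k%:~R| < 1 :> R.
  by rewrite ltNge; apply/negP => n1; have := ler_wpM2l (ltW p0) n1; lra.
have [n2 n3] : k%:~R < 1 :> R /\ (-1)%:~R < k%:~R :> R.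
  by move: n1; rewrite ltr_norml => /andP[n2 n3].
by move: n2 n3; rewrite ltrz1 ltr_int; lia.
Qed.

Lemma cos_sin_2piz a : cos a = 1 -> sin a = 0 :> R ->
  exists k : int, a = 2 * pi * k%:~R.
Proof.
move=> ca sa; have p0 := @pi_gt0 R; have [k] := period_reduce a.
set y := a + _ => /andP[y0 yp].
have cy : cos y = 1 by rewrite /y cosD2piz.
have sy : sin y = 0 by rewrite /y sinD2piz.
exists (- k); rewrite mulrNz.
suff : y = 0 by rewrite /y => ?; lra.
have [//|yn0] := eqVneq y 0; exfalso.
have {}y0 : 0 < y by rewrite lt_def yn0.
have [yltpi|pilty|ypi] := ltgtP y pi.
- by have := @sin_gt0_pi R y; rewrite y0 yltpi sy ltxx => /(_ isT).
- have : 0 < sin (y - pi) by apply: sin_gt0_pi; lra.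
  by rewrite -[sin _]opprK -sinDpi subrK sy oppr0 ltxx.
- by move: cy; rewrite ypi cospi; lra.
Qed.

Lemma ang_mod v a b : ang v a -> ang v b ->
  exists k : int, a = b + 2 * pi * k%:~R.
Proof.
move=> [d [d0 ->]] [e [e0 [Ec Es]]].
have ca := cos2Dsin2 a; have cb := cos2Dsin2 b.
have de : d = e.
  apply/eqP; rewrite -(@eqrXn2 _ 2%N) ?ltW//; apply/eqP.
  have -> : d ^+ 2 = (d * cos a) ^+ 2 + (d * sin a) ^+ 2.
    by rewrite !exprMn -mulrDr ca mulr1.
  by rewrite Ec Es !exprMn -mulrDr cb mulr1.
rewrite {}de in Ec Es.
have eq0 : e != 0 by rewrite gt_eqF.
move/(mulfI eq0) in Ec; move/(mulfI eq0) in Es.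
have [||k Hk] := @cos_sin_2piz (a - b).
- by rewrite cosB Ec Es -!expr2.
- by rewrite sinB Ec Es mulrC subrr.
by exists k; rewrite -Hk addrC subrK.
Qed.

Lemma ang_exists v : v != 0 -> exists a, ang v a.
Proof.
move=> /dot_gt0 v0; pose d := Num.sqrt (dot v v).
have d0 : 0 < d by rewrite sqrtr_gt0.
have dd : d ^+ 2 = dot v v by rewrite sqr_sqrtr// ltW.
pose c := v.1 / d; pose s := v.2 / d.
have cs : c ^+ 2 + s ^+ 2 = 1.
  by rewrite !exprMn -mulrDl !expr2 -/(dot v v) -invfM -expr2 dd mulfV// gt_eqF.
have c1 : -1 <= c <= 1.
  by rewrite -ler_norml -(@ler_pXn2r _ 2) ?nnegrE// expr1n real_normK ?num_real// -cs lerDl sqr_ge0.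
have vc : v.1 = d * c by rewrite mulrC divfK// gt_eqF.
have vs : v.2 = d * s by rewrite mulrC divfK// gt_eqF.
have ss : sin (acos c) = `|s|.
  by rewrite sin_acos// -cs addrAC subrr add0r sqrtr_sqr.
have [s0|s0] := leP 0 s.
  exists (acos c), d; split=> //; rewrite (pairE v) vc vs acosK ?in_itv//=.
  by rewrite ss ger0_norm.
exists (- acos c), d; split=> //; rewrite (pairE v) vc vs cosN acosK ?in_itv//=.
by rewrite sinN ss ltr0_norm// opprK.
Qed.

(** The turn from [v] to [w] is less than a right angle when [dot v w] is positive, so [atan] yields
    it without ambiguity and continuously. *)
Lemma ang_step v w a : ang v a -> 0 < dot v w ->
  ang w (a + atan (crs v w / dot v w)).
Proof.
move=> [d [d0 ve]] D0; set D := dot v w in D0 *; set c := crs v w.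
set t := atan _; pose q := c / D.
have ct0 : 0 < cos t by rewrite /t cos_gt0_pihalf// atan_gtNpi2 atan_ltpi2.
have st : sin t = q * cos t.
  by have := atanK q; rewrite -/t /tan => <-; rewrite divfK// gt_eqF.
exists (D / (d * cos t)); split; first by rewrite divr_gt0// mulr_gt0.
have dn0 : d != 0 by rewrite gt_eqF.
have tn0 : cos t != 0 by rewrite gt_eqF.
have Dn0 : D != 0 by rewrite gt_eqF.
have HD : D = d * (cos a * w.1 + sin a * w.2).
  by rewrite /D /dot ve /=; ring.
have Hc : c = d * (cos a * w.2 - sin a * w.1).
  by rewrite /c /crs ve /=; ring.
have ca := cos2Dsin2 a.
rewrite (pairE w) cosD sinD st; congr (_, _).
- transitivity ((D * cos a - c * sin a) / d); last by rewrite /q; field; rewrite ?dn0 ?Dn0 ?tn0.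
  rewrite HD Hc; transitivity (w.1 * (cos a ^+ 2 + sin a ^+ 2)); first by rewrite ca mulr1.
  by field.
- transitivity ((D * sin a + c * cos a) / d); last by rewrite /q; field; rewrite ?dn0 ?Dn0 ?tn0.
  rewrite HD Hc; transitivity (w.2 * (cos a ^+ 2 + sin a ^+ 2)); first by rewrite ca mulr1.
  by field.
Qed.

Lemma ang_opp v a : ang v a -> ang (- v) (a + pi).
Proof.
move=> [d [d0 ->]]; exists d; split=> //.
by rewrite cosDpi sinDpi !mulrN.
Qed.

End Angle.

(** * Continuous angles of nowhere vanishing plane maps *)

Section Lift.
Variable R : realType.
Implicit Types (F : R * R -> R * R) (z w : R * R).

(** Otherwise the intermediate value theorem would produce an odd multiple of [pi]. Applied to the
    difference of two continuous angles, this is the uniqueness of lifts. *)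
Lemma twopi_const (D : R -> R) : continuous D ->
  (forall t, exists k : int, D t = 2 * pi * k%:~R) -> forall a b, D a = D b.
Proof.
move=> cD Dk; have p0 := @two_pi_gt0 R.
have lt_contra x y v : Num.min (D x) (D y) <= v <= Num.max (D x) (D y) ->
    exists c, D c = v.
  have [xy|yx] := leP x y.
    by move=> h; have [c _ <-] := IVT xy (continuous_subspaceT cD) h; exists c.
  rewrite minC maxC => h.
  by have [c _ <-] := IVT (ltW yx) (continuous_subspaceT cD) h; exists c.
have noinc a b : D a < D b -> False.
  move=> ab; have [k Ek] := Dk a; have [l El] := Dk b.
  have kl : (k + 1 <= l)%R.
    by move: ab; rewrite Ek El ltr_pM2l// ltr_int -lezD1.
  have {}kl : k%:~R + 1 <= l%:~R :> R by rewrite -[1]/(1%:~R) -intrD ler_int.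
  have [|c Ec] := lt_contra a b (2 * pi * k%:~R + pi).
    have : 2 * pi * (k%:~R + 1) <= 2 * pi * l%:~R :> R by rewrite ler_pM2l.
    rewrite (min_l (ltW ab)) (max_r (ltW ab)) Ek El.
    by have := @pi_gt0 R; lra.
  have [m] := Dk c; rewrite Ec => /eqP; rewrite -subr_eq0.
  have -> : 2 * pi * k%:~R + pi - 2 * pi * m%:~R = pi * ((k + k + 1 - m - m)%:~R) :> R.
    by rewrite !intrD !mulrNz; ring.
  rewrite mulf_eq0 gt_eqF ?pi_gt0//= intr_eq0 => /eqP; lia.
by move=> a b; case: (ltgtP (D a) (D b)) => // /noinc.
Qed.

Lemma twopi_const2 (D : R * R -> R) : continuous D ->
  (forall t, exists k : int, D t = 2 * pi * k%:~R) -> forall a b, D a = D b.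
Proof.
move=> cD Dk a b.
pose c (t : R) := ((1 - t) * a.1 + t * b.1, (1 - t) * a.2 + t * b.2).
have := @twopi_const (fun t => D (c t)).
have cc : continuous c by rewrite /c; ct.
move=> /(_ (continuous_compose cD cc) (fun=> Dk _) 0 1).
by rewrite /c !subr0 !subrr !mul1r !mul0r !addr0 !add0r -!pairE.
Qed.

Definition box (M : R) : set (R * R) := `[- M, M] `*` `[- M, M].

Lemma box_compact M : compact (box M).
Proof. by apply: compact_setX; exact: segment_compact. Qed.

(** Uniform continuity on the box in the form needed for [ang_step]; compactness is applied with the
    filter of radii tending to [0] from above. *)
Lemma dot_near F M : continuous F -> (forall z, F z != 0) ->
  exists2 d : R, 0 < d & forall z w, box M z -> ball z d w -> 0 < dot (F z) (F w).
Proof.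
move=> cF F0.
have := (compact_near_coveringP (box M)).1 (@box_compact M).
move=> /(_ R 0^'+ (fun d z => forall w, ball z d w -> 0 < dot (F z) (F w)) _).
case=> [z Bz|].
  have cdot : continuous (fun p : (R * R) * (R * R) => dot (F p.1) (F p.2)).
    by rewrite /dot; ct.
  have := cdot (z, z); have /= d0 := dot_gt0 (F0 z).
  move=> /(_ _ (lt_nbhsr d0 : nbhs (dot (F z) (F z)) [set x | 0 < x])).
  case=> -[A B] /= [/nbhs_ballP[e /= e0 eA] /nbhs_ballP[e' /= e'0 eB]] AB.
  pose m := Num.min e e' / 2.
  have m0 : 0 < m by rewrite divr_gt0// lt_min e0.
  exists (ball z m, [set d | d < m]) => /=.
    by split; [exact: nbhsx_ballx|exact: nbhs_right_lt].
  case=> z' d /= [zz' dm] w z'w; apply: (AB (z', w)); split => /=.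
    apply: eA; apply: le_ball zz'.
    by rewrite /m ler_pdivrMr// ge_min; apply/orP; left; lra.
  apply: eB; apply: (@le_ball _ _ _ (m + d)).
    have : Num.min e e' <= e' by rewrite ge_min lexx orbT.
    by rewrite /m; move: dm; rewrite /m; lra.
  exact: ball_triangle zz' z'w.
move=> e /= e0 He; exists (e / 2); first by rewrite divr_gt0.
move=> z w Bz zw; apply: (He (e / 2) _ _ z Bz w zw) => /=; last by rewrite divr_gt0.
by rewrite sub0r normrN gtr0_norm ?divr_gt0//; lra.
Qed.

Definition clampr (M x : R) : R := Num.max (- M) (Num.min M x).
Definition clamp2 M z : R * R := (clampr M z.1, clampr M z.2).

Lemma clampr_id M x : `|x| <= M -> clampr M x = x.
Proof.
by rewrite /clampr ler_norml => /andP[h1 h2]; rewrite min_r// max_r.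
Qed.

Lemma clampr_in M x : 0 <= M -> - M <= clampr M x <= M.
Proof.
move=> M0; rewrite /clampr le_max lexx /= ge_max ge_min lexx /= andbT; lra.
Qed.

Lemma clamp2_continuous M : continuous (clamp2 M).
Proof. by rewrite /clamp2 /clampr; ct. Qed.

(* The angle is the sum of the small turning angles along the subdivided
   segment from the origin to [z]. *)
Lemma lift_box F M a0 : continuous F -> (forall z, F z != 0) -> 0 < M ->
  ang (F 0) a0 ->
  exists Th : R * R -> R, [/\ continuous Th, Th 0 = a0 &
    forall z, ang (F (clamp2 M z)) (Th z)].
Proof.
move=> cF F0 M0 Fa0.
have [d d0 Hd] := dot_near M cF F0.
have [N NM] : exists N : nat, M / N.+1%:R < d.
  exists (Num.truncn (M / d)); rewrite ltr_pdivrMr// mulrC -ltr_pdivrMr//.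
  exact: truncnS_gt.
have N0 : 0 < N.+1%:R :> R by [].
pose c (k : nat) z : R * R :=
  (k%:R / N.+1%:R * (clamp2 M z).1, k%:R / N.+1%:R * (clamp2 M z).2).
have cc k : continuous (c k).
  by rewrite /c; have := @clamp2_continuous M => ?; ct.
pose st k z := atan (crs (F (c k z)) (F (c k.+1 z)) / dot (F (c k z)) (F (c k.+1 z))).
have dst k z : (k <= N)%N -> 0 < dot (F (c k z)) (F (c k.+1 z)).
  move=> kN; have /andP[l1 u1] := clampr_in z.1 (ltW M0).
  have /andP[l2 u2] := clampr_in z.2 (ltW M0).
  have bnd x : - M <= x -> x <= M -> - M <= k%:R / N.+1%:R * x <= M.
    move=> lx ux; rewrite -ler_norml normrM.
    have : `|k%:R / N.+1%:R| <= 1 :> R.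
      by rewrite ger0_norm// ler_pdivrMr// mul1r ler_nat ltnW.
    move=> h; apply: (le_trans (ler_wpM2r (normr_ge0 _) h)).
    by rewrite mul1r ler_norml lx ux.
  have stp x : - M <= x -> x <= M ->
    `|k%:R / N.+1%:R * x - k.+1%:R / N.+1%:R * x| < d.
    move=> lx ux; rewrite -[k.+1%:R]natr1.
    have -> : k%:R / N.+1%:R * x - (k%:R + 1) / N.+1%:R * x = - (x / N.+1%:R).
      by move: (N.+1%:R^-1) => u; ring.
    rewrite normrN normrM [`|_^-1|]ger0_norm ?invr_ge0//; apply: le_lt_trans NM.
    by rewrite ler_pM2r ?invr_gt0// ler_norml lx ux.
  apply: Hd; first by split; rewrite /= in_itv /= bnd.
  by split; rewrite /ball /= stp.
pose Th z := a0 + \sum_(k < N.+1) st k z.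
exists Th; split.
- rewrite /Th => z; apply: (@cvgD _ R^o _ _ _ (fun=> a0)); first exact: cvg_cst.
  have cs (i : 'I_N.+1) : continuous (st i).
    rewrite /st; ct; rewrite /crs /dot; ct; first by have := cc i => ?; have := cc i.+1 => ?; ct.
    + by have := cc i.+1 => ?; ct.
    + by have := cc i => ?; ct.
    + by have := cc i.+1 => ?; ct.
    + by move=> z'; have := dst i z' (ltn_ord i); rewrite /dot => /gt_eqF ->.
    + by have := cc i => ?; ct.
    + by have := cc i.+1 => ?; ct.
    + by have := cc i => ?; ct.
    + by have := cc i.+1 => ?; ct.
  by apply: (@continuous_big R^o) => [|i _]; [exact: add_continuous|exact: cs].
- rewrite /Th big1 ?addr0// => i _; rewrite /st.
  have c0 j : c j 0 = 0.
    by rewrite /c /clamp2 /= !clampr_id ?normr0 ?ltW// !mulr0.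
  by rewrite !c0 (_ : crs _ _ = 0) ?mul0r ?atan0// /crs mulrC subrr.
- move=> z; rewrite /Th.
  suff H m : (m <= N.+1)%N -> ang (F (c m z)) (a0 + \sum_(k < m) st k z).
    have := H N.+1 (leqnn _); rewrite {1}/c divff ?pnatr_eq0// !mul1r.
    by rewrite -pairE.
  elim: m => [|m IH] mN.
    by rewrite big_ord0 addr0 /c !mul0r.
  rewrite big_ord_recr /= addrA; apply: ang_step; first exact/IH/ltnW.
  exact: dst.
Qed.

(** The lifts over growing squares share their value [a0] at the origin, so by uniqueness along the
    segment from the origin they agree wherever both are valid. *)
Lemma lift_exists F : continuous F -> (forall z, F z != 0) ->
  exists Th : R * R -> R, continuous Th /\ forall z, ang (F z) (Th z).
Proof.
move=> cF F0; have [a0 Ha0] := ang_exists (F0 0).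
have /choice[Th HTh] : forall n : nat, exists Th : R * R -> R,
    [/\ continuous Th, Th 0 = a0 &
     forall z, ang (F (clamp2 n.+1%:R z)) (Th z)].
  by move=> n; apply: lift_box.
have agree n m z : (n <= m)%N -> `|z.1| <= n.+1%:R -> `|z.2| <= n.+1%:R ->
    Th n z = Th m z.
  move=> nm z1 z2; have [cn n0 Hn] := HTh n; have [cm m0 Hm] := HTh m.
  pose cl (t : R) := Num.max 0 (Num.min 1 t).
  pose q (t : R) : R * R := (cl t * z.1, cl t * z.2).
  have cq : continuous q by rewrite /q /cl; ct.
  have cl1 t : `|cl t| <= 1.
    by rewrite ger0_norm /cl ?le_max ?lexx// ge_max ler01 ge_min lexx.
  have qn t : clamp2 n.+1%:R (q t) = q t.
    rewrite /clamp2 /= !clampr_id -?pairE// normrM.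
      by rewrite -[leRHS]mul1r ler_pM.
    by rewrite -[leRHS]mul1r ler_pM.
  have nm' : n.+1%:R <= m.+1%:R :> R by rewrite ler_nat.
  have qm t : clamp2 m.+1%:R (q t) = q t.
    rewrite /clamp2 /= !clampr_id -?pairE// normrM.
      by rewrite -[leRHS]mul1r ler_pM// (le_trans z2).
    by rewrite -[leRHS]mul1r ler_pM// (le_trans z1).
  have cD : continuous (fun t => Th n (q t) - Th m (q t)) by ct.
  have kD t : exists k : int, Th n (q t) - Th m (q t) = 2 * pi * k%:~R.
    have := Hn (q t); have := Hm (q t); rewrite qn qm => A B.
    by have [k ->] := ang_mod B A; exists k; rewrite addrAC subrr add0r.
  have := twopi_const cD kD 0 1.
  have -> : q 0 = 0 by rewrite /q /cl min_r ?ler01// maxxx !mul0r.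
  have -> : q 1 = z by rewrite /q /cl minxx max_r// !mul1r -pairE.
  by rewrite n0 m0 subrr => /eqP; rewrite eq_sym subr_eq0 => /eqP.
pose ix z := Num.truncn (`|z.1| + `|z.2|).
have ixP z n : (ix z <= n)%N -> `|z.1| <= n.+1%:R /\ `|z.2| <= n.+1%:R.
  move=> h; have : `|z.1| + `|z.2| <= n.+1%:R.
    by apply: ltW; apply: (lt_le_trans (truncnS_gt _)); rewrite ler_nat.
  by have := normr_ge0 z.1; have := normr_ge0 z.2; split; lra.
have ThE z n : (ix z <= n)%N -> Th (ix z) z = Th n z.
  by move=> h; have [? ?] := ixP z _ (leqnn _); apply: agree.
exists (fun z => Th (ix z) z); split.
- move=> z.
  (* Close to [z] the index [ix] may exceed [ix z], but by at most one, so the lift of index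
     [(ix z).+1] is valid on a whole neighbourhood. *)
  have [cn _ _] := HTh (ix z).+1.
  rewrite /continuous_at (ThE z (ix z).+1)//; apply: cvg_trans (cn z).
  apply: near_eq_cvg.
  have cs : continuous (fun w : R * R => `|w.1| + `|w.2|) by ct.
  have lt : `|z.1| + `|z.2| < (ix z).+2%:R.
    by apply: (lt_le_trans (truncnS_gt _)); rewrite ler_nat.
  have := cs z _ (lt_nbhsl lt : nbhs _ [set x | x < _]).
  apply: (@filterS _ (nbhs z)) => w /= h; rewrite (ThE w (ix z).+1)//.
  rewrite /ix -ltnS truncn_lt_nat//.
- move=> z; have [_ _ H] := HTh (ix z); have [h1 h2] := ixP z _ (leqnn _).
  by have := H z; rewrite /clamp2 !clampr_id// -pairE.
Qed.

End Lift.

(** * Winding numbers and local degree *)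

Section Winding.
Variable R : realType.
Implicit Types (l g : R -> R * R) (p q z v w : R * R) (f : R * R -> R * R).

Definition circ p (r t : R) : R * R := (p.1 + r * cos t, p.2 + r * sin t).

(** Loops are periodic functions on the whole line, so that their angles are total continuous
    functions; [winds_once] uses the parameter interval [[0, 1]] instead. *)
Definition wind l (m : int) := exists th : R -> R,
  [/\ continuous th, forall t, ang (l t) (th t) &
      forall t, th (t + 2 * pi) = th t + 2 * pi * m%:~R].

Definition loop l := [/\ continuous l, forall t, l t != 0 &
  forall t, l (t + 2 * pi) = l t].

Lemma twopi_inj (k m : int) : 2 * pi * k%:~R = 2 * pi * m%:~R :> R -> k = m.
Proof.
move=> /mulfI h; apply/eqP; rewrite -(@eqr_int R); apply/eqP; apply: h.
by rewrite gt_eqF// two_pi_gt0.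
Qed.

Lemma wind_lift l (th : R -> R) : loop l -> continuous th ->
  (forall t, ang (l t) (th t)) -> exists2 m : int, wind l m &
  forall t, th (t + 2 * pi) = th t + 2 * pi * m%:~R.
Proof.
move=> [cl l0 lp] cth Hth.
have cD : continuous (fun t => th (t + 2 * pi) - th t).
  by apply: continuous_add; [apply: (continuous_compose cth)|]; ct.
have kD t : exists k : int, th (t + 2 * pi) - th t = 2 * pi * k%:~R.
  have [k ->] : exists k : int, th (t + 2 * pi) = th t + 2 * pi * k%:~R.
    by apply: (@ang_mod _ (l t)) => //; rewrite -lp.
  by exists k; rewrite addrAC subrr add0r.
have [m Em] := kD 0.
have E t : th (t + 2 * pi) = th t + 2 * pi * m%:~R.
  by rewrite -Em; have /= := twopi_const cD kD t 0; lra.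
by exists m => //; exists th.
Qed.

Lemma wind_exists l : loop l -> exists m, wind l m.
Proof.
move=> ll; have [cl l0 lp] := ll.
have [|Th [cTh HTh]] := @lift_exists R (fun z => l z.1) _ (fun z => l0 z.1).
  by ct.
have [//||m Hm _] := @wind_lift l (fun t => Th (t, 0)) ll.
- by apply: (continuous_compose cTh); ct.
- by move=> t; exact: (HTh (t, 0)).
by exists m.
Qed.

Lemma wind_unique l m m' : wind l m -> wind l m' -> m = m'.
Proof.
move=> [th [ct_ Ht Et]] [th' [ct' Ht' Et']].
have cD : continuous (fun t => th t - th' t) by ct.
have kD t : exists k : int, th t - th' t = 2 * pi * k%:~R.
  by have [k ->] := ang_mod (Ht t) (Ht' t); exists k; rewrite addrAC subrr add0r.
apply: twopi_inj; have := twopi_const cD kD (0 + 2 * pi) 0.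
by rewrite Et Et'; lra.
Qed.

(** A single angle is chosen for the whole homotopy. Its increment over one period is a continuous
    multiple of [2 * pi] on the plane, hence the same at both ends. *)
Lemma wind_homotopy (H : R -> R -> R * R) m :
  continuous (fun z : R * R => H z.1 z.2) -> (forall t a, H t a != 0) ->
  (forall t a, H t (a + 2 * pi) = H t a) -> wind (H 0) m -> wind (H 1) m.
Proof.
move=> cH H0 Hp W.
have [Th [cTh HTh]] := lift_exists cH (fun z => H0 z.1 z.2).
have lH t : loop (H t).
  split; [|exact: H0|exact: Hp].
  by apply: (continuous_compose cH (f := fun a => (t, a))); ct.
have cD : continuous (fun z : R * R => Th (z.1, z.2 + 2 * pi) - Th z).
  by apply: continuous_add; [apply: (continuous_compose cTh)|]; ct.
have kD z : exists k : int, Th (z.1, z.2 + 2 * pi) - Th z = 2 * pi * k%:~R.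
  have [k ->] : exists k : int, Th (z.1, z.2 + 2 * pi) = Th z + 2 * pi * k%:~R.
    apply: (@ang_mod _ (H z.1 z.2)) => //.
    by rewrite -Hp; exact: (HTh (z.1, z.2 + 2 * pi)).
  by exists k; rewrite addrAC subrr add0r.
have W' t : exists2 k, wind (H t) k & Th (t, 0 + 2 * pi) - Th (t, 0) = 2 * pi * k%:~R.
  have [||k Hk Ek] := @wind_lift (H t) (fun a => Th (t, a)) (lH t).
  - by apply: (continuous_compose cTh); ct.
  - by move=> a; exact: (HTh (t, a)).
  by exists k => //; rewrite Ek addrAC subrr add0r.
have [k0 /(wind_unique W) <- E0] := W' 0.
have [k1 W1 E1] := W' 1.
suff -> : m = k1 by [].
by apply: twopi_inj; rewrite -E0 -E1; exact: (twopi_const2 cD kD (0, 0) (1, 0)).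
Qed.

Definition clamp01 (t : R) : R := Num.max 0 (Num.min 1 t).
Lemma clamp01_continuous : continuous clamp01.
Proof. by rewrite /clamp01; ct. Qed.
Lemma clamp01_itv t : 0 <= clamp01 t <= 1.
Proof. by rewrite /clamp01 le_max lexx/= ge_max ler01 ge_min lexx. Qed.
Lemma clamp01_id t : 0 <= t <= 1 -> clamp01 t = t.
Proof. by move=> /andP[h1 h2]; rewrite /clamp01 min_r// max_r. Qed.
Lemma clamp010 : clamp01 0 = 0. Proof. by rewrite clamp01_id// lexx ler01. Qed.
Lemma clamp011 : clamp01 1 = 1. Proof. by rewrite clamp01_id// lexx ler01. Qed.

Definition lerp (t : R) v w : R * R :=
  ((1 - t) * v.1 + t * w.1, (1 - t) * v.2 + t * w.2).

Lemma lerp0 v w : lerp 0 v w = v.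
Proof. by rewrite /lerp subr0 !mul1r !mul0r !addr0 -pairE. Qed.
Lemma lerp1 v w : lerp 1 v w = w.
Proof. by rewrite /lerp subrr !mul1r !mul0r !add0r -pairE. Qed.

Lemma wind_lerp l g m : continuous l -> continuous g ->
  (forall t, l (t + 2 * pi) = l t) -> (forall t, g (t + 2 * pi) = g t) ->
  (forall s t, 0 <= s <= 1 -> lerp s (l t) (g t) != 0) ->
  wind l m -> wind g m.
Proof.
move=> cl cg lp gp H Wl.
pose h s t := lerp (clamp01 s) (l t) (g t).
have Eh0 : h 0 = l by apply/funext => t; rewrite /h clamp010 lerp0.
have Eh1 : h 1 = g by apply/funext => t; rewrite /h clamp011 lerp1.
rewrite -Eh1; apply: wind_homotopy; last by rewrite Eh0.
- by rewrite /h /lerp; have := clamp01_continuous => ?; ct.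
- by move=> t a; apply: H; exact: clamp01_itv.
- by move=> t a; rewrite /h lp gp.
Qed.

Lemma ang_norm v a : ang v a ->
  v = (Num.sqrt (dot v v) * cos a, Num.sqrt (dot v v) * sin a).
Proof.
move=> [d [d0 ve]]; have -> : dot v v = d ^+ 2.
  have := cos2Dsin2 a => ca; rewrite /dot ve /=.
  by transitivity (d ^+ 2 * (cos a ^+ 2 + sin a ^+ 2)); [ring|rewrite ca mulr1].
by rewrite sqrtr_sqr gtr0_norm.
Qed.

Lemma dot_le_neq v w s : dot w w < dot v v -> 0 <= s <= 1 ->
  v != (s * w.1, s * w.2).
Proof.
move=> lt /andP[s0 s1]; apply/eqP => E; move: lt; rewrite E /dot /=.
apply/negP; rewrite -leNgt.
have -> : s * w.1 * (s * w.1) + s * w.2 * (s * w.2) = s ^+ 2 * (w.1 * w.1 + w.2 * w.2) by ring.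
rewrite -[leRHS]mul1r ler_wpM2r//; last by rewrite expr_le1.
by rewrite addr_ge0// -expr2 sqr_ge0.
Qed.

Lemma circ_continuous p r : continuous (circ p r).
Proof. by rewrite /circ; ct. Qed.

Lemma circ_periodic p r t : circ p r (t + 2 * pi) = circ p r t.
Proof. by rewrite /circ -[2 * pi]mulr1 (cosD2piz t 1) (sinD2piz t 1). Qed.

Lemma circ_period p r t (k : int) : circ p r (t + 2 * pi * k%:~R) = circ p r t.
Proof. by rewrite /circ cosD2piz sinD2piz. Qed.

Lemma circ0 p t : circ p 0 t = p.
Proof. by rewrite /circ !mul0r !addr0 -pairE. Qed.

Lemma circ_dist p r t :
  ((circ p r t).1 - p.1) ^+ 2 + ((circ p r t).2 - p.2) ^+ 2 = r ^+ 2.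
Proof.
rewrite /circ /=; have ca := cos2Dsin2 t.
transitivity (r ^+ 2 * (cos t ^+ 2 + sin t ^+ 2)); first by ring.
by rewrite ca mulr1.
Qed.

Lemma circ_in p r s t : `|s| <= `|r| -> closed_disk p r (circ p s t).
Proof.
move=> sr; rewrite /closed_disk /= circ_dist.
by rewrite -(real_normK (num_real s)) -(real_normK (num_real r)) lerXn2r// nnegrE.
Qed.

Lemma circ_neq p s t : s != 0 -> circ p s t != p.
Proof.
move=> s0; apply/eqP => E; have := circ_dist p s t; rewrite E !subrr expr0n /= addr0.
by move=> /esym/eqP; rewrite sqrf_eq0 (negbTE s0).
Qed.

Lemma disk_center p r : closed_disk p r p.
Proof. by rewrite /closed_disk /= !subrr expr0n /= addr0 sqr_ge0. Qed.

Lemma disk_coord p r z : 0 <= r -> closed_disk p r z ->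
  `|z.1 - p.1| <= r /\ `|z.2 - p.2| <= r.
Proof.
move=> r0 Dz; have le (x y : R) : x ^+ 2 + y ^+ 2 <= r ^+ 2 -> `|x| <= r.
  move=> h; have : x ^+ 2 <= r ^+ 2 by have := sqr_ge0 y; lra.
  by rewrite -(real_normK (num_real x)) ler_pXn2r ?nnegrE.
by split; [exact: le Dz|move: Dz; rewrite /closed_disk /= addrC => /le].
Qed.

Lemma lerp_disk p r z s : 0 <= s <= 1 -> closed_disk p r z ->
  closed_disk p r (lerp s p z).
Proof.
move=> /andP[s0 s1]; rewrite /closed_disk /=; apply: le_trans.
have -> : (1 - s) * p.1 + s * z.1 - p.1 = s * (z.1 - p.1) by ring.
have -> : (1 - s) * p.2 + s * z.2 - p.2 = s * (z.2 - p.2) by ring.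
rewrite !exprMn -mulrDr -[leRHS]mul1r ler_wpM2r ?expr_le1//.
by rewrite addr_ge0 ?sqr_ge0.
Qed.

End Winding.

(** * Local degree of planar embeddings and invariance of domain *)

Section Degree.
Variable R : realType.
Implicit Types (l g : R -> R * R) (p q z v w : R * R) (f : R * R -> R * R).

Lemma closed_diskE p r z : closed_disk p r z = (dot (z - p) (z - p) <= r ^+ 2) :> Prop.
Proof. rewrite /closed_disk /dot /= -!expr2. reflexivity. Qed.

(* The universal cover of the punctured disk, in coordinates [(u, t)] with
   radius [r * exp (- |u|)] and angle [t]. *)
Lemma wind_mult f g p r d m : 0 < r -> {within closed_disk p r, continuous f} ->
  (forall z, closed_disk p r z -> z != p -> f z != f p) ->
  wind (fun t => f (circ p r t) - f p) d ->
  continuous g -> (forall t, g (t + 2 * pi) = g t) ->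
  (forall t, closed_disk p r (g t) /\ g t != p) ->
  wind (fun t => g t - p) m -> wind (fun t => f (g t) - f p) (d * m).
Proof.
move=> r0 cf fN Wd cg gp gD [th [cth Hth Eth]].
pose pol (z : R * R) := circ p (r * expR (- `|z.1|)) z.2.
have cpol : continuous pol by rewrite /pol /circ; ct.
have rad z : 0 < r * expR (- `|z.1|) <= r.
  by rewrite mulr_gt0 ?expR_gt0//= ger_pMr// expR_le1 oppr_le0.
have polD z : closed_disk p r (pol z).
  by apply: circ_in; have /andP[a b] := rad z; rewrite (gtr0_norm a) (gtr0_norm r0).
have polN z : pol z != p.
  by apply: circ_neq; have /andP[a b] := rad z; rewrite gt_eqF.
pose G z := f (pol z) - f p.
have cfp : continuous (fun z => f (pol z)) by exact: (within_comp_continuous cf).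
have cG : continuous G.
  move=> z; apply: (@cvgB _ _ _ _ _ (fun z => f (pol z)) (fun=> f p)); first exact: cfp.
  exact: cvg_cst.
have G0 z : G z != 0 by rewrite subr_eq0 fN.
have [Th [cTh HTh]] := lift_exists cG G0.
have cD : continuous (fun z : R * R => Th (z.1, z.2 + 2 * pi) - Th z).
  by apply: continuous_add; [apply: (continuous_compose cTh)|]; ct.
have kD z : exists k : int, Th (z.1, z.2 + 2 * pi) - Th z = 2 * pi * k%:~R.
  have [k ->] : exists k : int, Th (z.1, z.2 + 2 * pi) = Th z + 2 * pi * k%:~R.
    apply: (@ang_mod _ (G z)) => //.
    have := HTh (z.1, z.2 + 2 * pi).
    by rewrite /G /pol /= circ_periodic.
  by exists k; rewrite addrAC subrr add0r.
have E z : Th (z.1, z.2 + 2 * pi) = Th z + 2 * pi * d%:~R.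
  have [k Ek] := kD (0, 0).
  have Ez y : Th (y.1, y.2 + 2 * pi) = Th y + 2 * pi * k%:~R.
    by rewrite -Ek; have /= := twopi_const2 cD kD y (0, 0); lra.
  rewrite Ez; congr (_ + 2 * pi * _%:~R); apply: (@wind_unique _ (fun t => f (circ p r t) - f p)) => //.
  exists (fun t => Th (0, t)); split.
  - by apply: (continuous_compose cTh); ct.
  - by move=> t; have := HTh (0, t); rewrite /G /pol /= normr0 oppr0 expR0 mulr1.
  - by move=> t; rewrite (Ez (0, t)).
have En z (n : nat) : Th (z.1, z.2 + 2 * pi * n%:R) = Th z + 2 * pi * d%:~R * n%:R.
  elim: n => [|n IH]; first by rewrite !mulr0 !addr0 -pairE.
  rewrite -[n.+1%:R]natr1 mulrDr mulr1 addrA.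
  by have /= -> := E (z.1, z.2 + 2 * pi * n%:R); rewrite IH; ring.
have Ez z (k : int) : Th (z.1, z.2 + 2 * pi * k%:~R) = Th z + 2 * pi * (d * k)%:~R.
  rewrite intrM mulrA; case: k => n; first exact: En.
  rewrite NegzE mulrNz.
  have := En (z.1, z.2 + 2 * pi * - n.+1%:R) n.+1.
  by rewrite /= -addrA -mulrDr addNr mulr0 addr0 -pairE => ->; ring.
pose v t := g t - p.
have v0 t : v t != 0 by rewrite subr_eq0; case: (gD t).
have cg1 : continuous (fun t => dot (v t) (v t)).
  by rewrite /dot /v /=; ct.
pose rho t := Num.sqrt (dot (v t) (v t)).
have rho0 t : 0 < rho t by rewrite sqrtr_gt0 dot_gt0.
have rhor t : rho t <= r.
  rewrite -(@ler_pXn2r _ 2) ?nnegrE ?(ltW (rho0 t)) ?(ltW r0)//.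
  by rewrite sqr_sqrtr ?(ltW (dot_gt0 _))// -closed_diskE; case: (gD t).
pose u t := - ln (rho t / r).
have crho : continuous rho.
  by move=> t; apply: (continuous_comp (cg1 t)); exact: sqrt_continuous.
have q0 t : 0 < rho t / r by rewrite divr_gt0.
have cu : continuous u.
  rewrite /u; apply: continuous_opp.
  have cq : continuous (fun t => rho t / r) by ct.
  by move=> t; apply: (continuous_comp (cq t)); exact: continuous_ln.
have u0 t : 0 <= u t by rewrite oppr_ge0 ln_le0// ler_pdivrMr// mul1r.
have polg t : pol (u t, th t) = g t.
  rewrite /pol /= ger0_norm// opprK lnK ?posrE// mulrC divfK ?gt_eqF//.
  have := ang_norm (Hth t); rewrite -/(v t) -/(rho t) /circ => E'.
  rewrite [RHS]pairE; congr (_, _); [move: (congr1 fst E')|move: (congr1 snd E')]; rewrite /v /=; lra.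
exists (fun t => Th (u t, th t)); split.
- by apply: (continuous_compose cTh); ct.
- by move=> t; have := HTh (u t, th t); rewrite /G polg.
- move=> t; rewrite Eth -(Ez (u t, th t)) /=; congr (Th (_, _)).
  by rewrite /u /rho /v gp.
Qed.

Definition emb f p r := [/\ 0 < r, {within closed_disk p r, continuous f} &
  forall a b, closed_disk p r a -> closed_disk p r b -> f a = f b -> a = b].

Lemma disk_sub p s r : 0 <= s <= r -> closed_disk p s `<=` closed_disk p r.
Proof.
move=> /andP[s0 sr] z; rewrite /closed_disk /= => /le_trans; apply.
by rewrite lerXn2r// nnegrE ?(le_trans s0).
Qed.

Lemma emb_sub f p r s : emb f p r -> 0 < s <= r -> emb f p s.
Proof.
move=> [r0 cf fi] /andP[s0 sr].
have sub : closed_disk p s `<=` closed_disk p r by apply: disk_sub; rewrite ltW.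
split=> //; first exact: continuous_subspaceW cf.
by move=> a b /sub Da /sub Db; exact: fi.
Qed.

Lemma continuous_subr (T : topologicalType) (h k : T -> R * R) :
  continuous h -> continuous k -> continuous (fun t => h t - k t).
Proof. by move=> ch ck t; apply: cvgB; [exact: ch|exact: ck]. Qed.

Lemma emb_loop f p r q : emb f p r -> (forall t, f (circ p r t) != q) ->
  loop (fun t => f (circ p r t) - q).
Proof.
move=> [r0 cf fi] qN; split.
- apply: continuous_subr; last exact: cst_continuous.
  apply: (within_comp_continuous cf); first exact: circ_continuous.
  by move=> t; exact: circ_in.
- by move=> t; rewrite subr_eq0.
- by move=> t; rewrite circ_periodic.
Qed.

Lemma emb_neq f p r z : emb f p r -> closed_disk p r z -> z != p -> f z != f p.
Proof.
by move=> [r0 _ fi] Dz; apply: contra => /eqP /fi ->//; exact: disk_center.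
Qed.

Lemma emb_wind f p r : emb f p r -> exists d, wind (fun t => f (circ p r t) - f p) d.
Proof.
move=> e; have [r0 _ _] := e; apply/wind_exists/emb_loop => // t.
by apply: (emb_neq e); [exact: circ_in|apply: circ_neq; rewrite gt_eqF].
Qed.

Lemma wind_circ p s : 0 < s -> wind (fun t => circ p s t - p) 1.
Proof.
move=> s0; exists id; split; first by move=> ?; exact: cvg_id.
- move=> t; exists s; split=> //; rewrite /circ.
  by rewrite [LHS]pairE /=; congr (_, _); ring.
- by move=> t; rewrite mulr1.
Qed.

(** The smaller circle is a loop of winding number [1] in the larger punctured disk, so [wind_mult]
    applies. *)
Lemma wind_radius f p r s d : emb f p r -> 0 < s <= r ->
  wind (fun t => f (circ p r t) - f p) d -> wind (fun t => f (circ p s t) - f p) d.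
Proof.
move=> e /andP[s0 sr] W; rewrite -[d]mulr1; have [r0 cf _] := e.
apply: (wind_mult r0 cf) => //.
- by move=> z; exact: emb_neq.
- exact: circ_continuous.
- by move=> t; rewrite circ_periodic.
- move=> t; split; first by apply: circ_in; rewrite !gtr0_norm.
  by apply: circ_neq; rewrite gt_eqF.
- exact: wind_circ.
Qed.

(** Injectivity on a disk is part of the notion, so a degree exists only for local embeddings; by
    [wind_radius] every admissible radius gives the same number. *)
Definition deg f p (d : int) :=
  exists2 r, emb f p r & wind (fun t => f (circ p r t) - f p) d.

Lemma deg_wind f p r d : emb f p r -> deg f p d ->
  wind (fun t => f (circ p r t) - f p) d.
Proof.
move=> e [s es W]; have [r0 _ _] := e; have [s0 _ _] := es.
have m0 : 0 < Num.min r s by rewrite lt_min r0.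
have [d' W'] := emb_wind e.
have w1 := @wind_radius f p r (Num.min r s) d' e.
have w2 := @wind_radius f p s (Num.min r s) d es.
suff -> : d = d' by [].
apply: wind_unique (w2 _ W) (w1 _ W').
  by rewrite m0 ge_min lexx orbT.
by rewrite m0 ge_min lexx.
Qed.

Lemma deg_unique f p d d' : deg f p d -> deg f p d' -> d = d'.
Proof. by move=> [r e W] /(deg_wind e); exact: wind_unique. Qed.

Lemma deg_exists f p r : emb f p r -> exists d, deg f p d.
Proof. by move=> e; have [d W] := emb_wind e; exists d, r. Qed.

(** Half a period changes the angle by [pi] plus a multiple of [2 * pi] that does not depend on the
    starting point; a full period doubles this. *)
Lemma wind_odd l d : continuous l -> (forall t, l (t + pi) = - l t) ->
  wind l d -> exists k : int, d = 2 * k + 1.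
Proof.
move=> cl lN [th [cth Hth Eth]].
have cD : continuous (fun t => th (t + pi) - th t - pi).
  apply: continuous_add; last by ct.
  by apply: continuous_add; [apply: (continuous_compose cth)|]; ct.
have kD t : exists k : int, th (t + pi) - th t - pi = 2 * pi * k%:~R.
  have := ang_opp (Hth t); rewrite -lN => /(ang_mod (Hth (t + pi)))[k ->].
  by exists k; ring.
have [k Ek] := kD 0; exists k; apply: (@twopi_inj R).
rewrite intrD intrM /=.
have /= := twopi_const cD kD pi 0; rewrite Ek.
have -> : pi + pi = 0 + 2 * pi :> R by ring.
by rewrite Eth -[k%:~R in RHS]/(k%:~R) => h; move: Ek; rewrite add0r; lra.
Qed.

(* Borsuk's antipodal trick: the homotopy
   [f (p + r/(1+t) e) - f (p - t r/(1+t) e)] ends at an odd loop. *)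
Lemma deg_odd f p d : deg f p d -> exists k : int, d = 2 * k + 1.
Proof.
move=> [r e W]; have [r0 cf fi] := e.
pose a t : R := r / (1 + clamp01 t); pose b t := - (clamp01 t * a t).
have c1 (t : R) : 0 < 1 + clamp01 t by have /andP[] := @clamp01_itv R t; lra.
have a0 t : 0 < a t by rewrite divr_gt0.
have ab t : a t - b t = r.
  by rewrite /b opprK /a; field; rewrite gt_eqF.
have b0 t : b t <= 0.
  by rewrite oppr_le0 mulr_ge0 ?(ltW (a0 t))//; have /andP[] := @clamp01_itv R t.
have ca : continuous a.
  have := @clamp01_continuous R => ?; rewrite /a; ct => x; by rewrite gt_eqF.
have cb : continuous b by have := @clamp01_continuous R => ?; rewrite /b; ct.
have Da t x : closed_disk p r (circ p (a t) x).
  by apply: circ_in; have := ab t; have := a0 t; have := b0 t => *; rewrite !gtr0_norm//; lra.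
have Db t x : closed_disk p r (circ p (b t) x).
  apply: circ_in; have := ab t; have := a0 t; have := b0 t => *.
  by rewrite ler0_norm// gtr0_norm//; lra.
pose H t x := f (circ p (a t) x) - f (circ p (b t) x).
have cH : continuous (fun z : R * R => H z.1 z.2).
  by rewrite /H; apply: continuous_subr; apply: (within_comp_continuous cf) => //; rewrite /circ; ct.
have H0 t x : H t x != 0.
  rewrite subr_eq0; apply/eqP => /fi E.
  have {E} [] : circ p (a t) x = circ p (b t) x by apply: E.
  move=> /addrI E1 /addrI E2; have := cos2Dsin2 x.
  have z1 : r * cos x = 0 by rewrite -(ab t) mulrBl E1 subrr.
  have z2 : r * sin x = 0 by rewrite -(ab t) mulrBl E2 subrr.
  move/eqP: z1; rewrite mulf_eq0 gt_eqF//= => /eqP ->.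
  move/eqP: z2; rewrite mulf_eq0 gt_eqF//= => /eqP ->.
  by rewrite expr0n /= addr0 => /eqP; rewrite eq_sym oner_eq0.
have Hp t x : H t (x + 2 * pi) = H t x by rewrite /H !circ_periodic.
have W1 : wind (H 1) d.
  apply: (wind_homotopy cH H0 Hp).
  suff -> : H 0 = (fun t => f (circ p r t) - f p) by [].
  apply/funext => x; rewrite /H /b /a clamp010 addr0 divr1 mul0r oppr0.
  by rewrite circ0.
apply: wind_odd W1; last first.
  move=> x; rewrite /H opprB; have -> : b 1 = - a 1 by rewrite /b clamp011 mul1r.
  by rewrite /circ cosDpi sinDpi !mulrNN !mulrN !mulNr.
have c1x : continuous (fun x : R => (1 : R, x)) by ct.
exact: (continuous_compose cH c1x).
Qed.

Lemma wind_const v m : wind (fun=> v) m -> m = 0.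
Proof.
move=> W; apply: (wind_unique W); have [th [_ H _]] := W.
by exists (fun=> th 0); split=> // t; [exact: cst_continuous|rewrite mulr0 addr0].
Qed.

Lemma wind_move_center f p r q d : emb f p r ->
  (forall s t, 0 <= s <= 1 -> f (circ p r t) - f p != (s * (q - f p).1, s * (q - f p).2)) ->
  wind (fun t => f (circ p r t) - f p) d -> wind (fun t => f (circ p r t) - q) d.
Proof.
move=> e H; have [r0 cf _] := e.
have cfc : continuous (fun t => f (circ p r t)).
  apply: (within_comp_continuous cf); first exact: circ_continuous.
  by move=> t; exact: circ_in.
apply: wind_lerp.
- by apply: continuous_subr => //; exact: cst_continuous.
- by apply: continuous_subr => //; exact: cst_continuous.
- by move=> t; rewrite circ_periodic.
- by move=> t; rewrite circ_periodic.
- move=> s t /(H s t); apply: contra => /eqP [] /= E1 E2.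
  by apply/eqP; rewrite [LHS]pairE /=; congr (_, _); lra.
Qed.

Lemma disk_nbhs p r : 0 < r -> nbhs p (closed_disk p r).
Proof.
move=> r0.
have c : continuous (fun z => (z.1 - p.1) ^+ 2 + (z.2 - p.2) ^+ 2) by ct.
have lt : (p.1 - p.1) ^+ 2 + (p.2 - p.2) ^+ 2 < r ^+ 2.
  by rewrite !subrr expr0n /= addr0 exprn_gt0.
have := c p _ (lt_nbhsl lt : nbhs _ [set x | x < _]).
by apply: (@filterS _ (nbhs p)) => z /= /ltW.
Qed.

Lemma nbhs_disk p A : nbhs p A -> exists2 r, 0 < r & closed_disk p r `<=` A.
Proof.
move=> /nbhs_ballP[e /= e0 eA]; exists (e / 2); first by rewrite divr_gt0.
move=> z Dz; apply: eA.
have e20 : 0 <= e / 2 by rewrite divr_ge0// ltW.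
have [h1 h2] := disk_coord e20 Dz.
by split; rewrite /ball /= distrC; lra.
Qed.

(** If a point [q] close to [f p] were missed, the image of the boundary circle would wind around
    [q] as often as around [f p], an odd number of times; shrinking the circle to [p] would make the
    same winding number [0]. *)
Theorem invariance_of_domain f p r : emb f p r ->
  nbhs (f p) (f @` closed_disk p r).
Proof.
move=> e; have [r0 cf fi] := e.
have [d W] := emb_wind e.
pose n2 t : R := dot (f (circ p r t) - f p) (f (circ p r t) - f p).
have cfc : continuous (fun t => f (circ p r t)).
  apply: (within_comp_continuous cf); first exact: circ_continuous.
  by move=> t; exact: circ_in.
have cn : continuous n2.
  by have := continuous_subr cfc (@cst_continuous _ _ (f p)) => h; rewrite /n2 /dot; ct.
have n20 t : 0 < n2 t.
  by apply: dot_gt0; rewrite subr_eq0; apply: (emb_neq e); [exact: circ_in|apply: circ_neq; rewrite gt_eqF].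
(* The least distance from [f p] to the image of the circle determines the neighbourhood of [f p]
   that is covered. *)
have [c _ Hc] := EVT_min (ltW (two_pi_gt0 R)) (continuous_subspaceT cn).
have {}Hc t : n2 c <= n2 t.
  have [k /andP[h1 h2]] := period_reduce t.
  have := Hc (t + 2 * pi * k%:~R); rewrite /n2 circ_period; apply.
  by rewrite in_itv /= h1 ltW.
have cq : continuous (fun q => dot (q - f p) (q - f p)).
  have : continuous (fun q : R * R => q - f p).
    by apply: continuous_subr => ?; [exact: cvg_id|exact: cvg_cst].
  by rewrite /dot => h; ct.
have lt0 : dot (f p - f p) (f p - f p) < n2 c.
  by rewrite subrr /dot /= !mulr0 addr0.
have := cq (f p) _ (lt_nbhsl lt0 : nbhs _ [set x | x < _]).
apply: (@filterS _ (nbhs (f p))) => q /= qlt.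
apply: contrapT => qN.
have {}qN z : closed_disk p r z -> f z != q.
  by move=> Dz; apply/eqP => E; apply: qN; exists z.
have Wq : wind (fun t => f (circ p r t) - q) d.
  apply: (wind_move_center e) W => s t st; apply: dot_le_neq => //.
  exact: lt_le_trans qlt (Hc t).
have : d = 0.
  pose H s t := f (circ p ((1 - clamp01 s) * r) t) - q.
  have Dc s t : closed_disk p r (circ p ((1 - clamp01 s) * r) t).
    apply: circ_in; have /andP[h0 h1] := @clamp01_itv R s.
    rewrite normrM [`|1 - _|]ger0_norm ?subr_ge0// ger_pMl ?normr_gt0 ?gt_eqF//.
    by rewrite gerBl.
  apply: (@wind_const (f p - q)).
  suff <- : H 1 = (fun=> f p - q).
    apply: (@wind_homotopy _ H).
    - rewrite /H; apply: continuous_subr; last exact: cst_continuous.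
      apply: (within_comp_continuous cf) => //; rewrite /circ.
      by have := @clamp01_continuous R => ?; ct.
    - by move=> s t; rewrite subr_eq0 qN.
    - by move=> s t; rewrite /H circ_periodic.
    - suff -> : H 0 = (fun t => f (circ p r t) - q) by [].
      by apply/funext => t; rewrite /H clamp010 subr0 mul1r.
  by apply/funext => t; rewrite /H clamp011 subrr mul0r circ0.
by have [k ->] := @deg_odd f p d (ex_intro2 _ _ r e W); lia.
Qed.

End Degree.

(** * Composition, local constancy and homotopy invariance of the degree *)

Section DegreeCalculus.
Variable R : realType.
Implicit Types (p q z v w : R * R) (f g : R * R -> R * R).

Lemma emb_continuous_at f p r : emb f p r -> {for p, continuous f}.
Proof.
move=> [r0 /subspace_continuousP cf _] N Nf.
have := cf p (disk_center p r) N Nf; rewrite /within /=.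
by move/(filterI (disk_nbhs p r0)); apply: (@filterS _ (nbhs p)) => z [Dz]; exact.
Qed.

Lemma emb_eq f g p r : emb f p r -> (forall z, closed_disk p r z -> f z = g z) ->
  emb g p r.
Proof.
move=> [r0 cf fi] E; split=> //.
  apply/subspace_continuousP => x Dx N Ng.
  have Nf : nbhs (f x) N by rewrite E.
  move/subspace_continuousP: cf => /(_ x Dx N Nf); rewrite /within /=.
  by apply: (@filterS _ (nbhs x)) => z Hz Dz; have : N (f z) := Hz Dz; rewrite E.
by move=> a b Da Db; rewrite -!E//; exact: fi.
Qed.

Lemma deg_eq_near f g p d : deg f p d -> (\forall z \near p, f z = g z) -> deg g p d.
Proof.
move=> fd /nbhs_disk[s s0 sE]; have [r e _] := fd; have [r0 _ _] := e.
have m0 : 0 < Num.min r s by rewrite lt_min r0.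
have e1 : emb f p (Num.min r s) by apply: (emb_sub e); rewrite m0 ge_min lexx.
have sub : closed_disk p (Num.min r s) `<=` closed_disk p s.
  by apply: disk_sub; rewrite (ltW m0) ge_min lexx orbT.
exists (Num.min r s); first by apply: (emb_eq e1) => z /sub /sE.
have := deg_wind e1 fd.
have E t : f (circ p (Num.min r s) t) = g (circ p (Num.min r s) t).
  by apply: sE; apply: sub; exact: circ_in.
have Ep : f p = g p by apply: sE; exact: disk_center.
by under eq_fun do rewrite E Ep.
Qed.

Lemma emb_comp f g p r s : emb f p r -> emb g (f p) s ->
  exists2 r', 0 < r' <= r & emb (g \o f) p r' /\
    f @` closed_disk p r' `<=` closed_disk (f p) s.
Proof.
move=> ef eg; have [r0 cf fi] := ef; have [s0 cg gi] := eg.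
have := emb_continuous_at ef (disk_nbhs (f p) s0).
move=> /nbhs_disk[t t0 tD].
have m0 : 0 < Num.min r t by rewrite lt_min r0.
have mr : 0 < Num.min r t <= r by rewrite m0 ge_min lexx.
have subr : closed_disk p (Num.min r t) `<=` closed_disk p r.
  by apply: disk_sub; rewrite (ltW m0) ge_min lexx.
have subt : closed_disk p (Num.min r t) `<=` closed_disk p t.
  by apply: disk_sub; rewrite (ltW m0) ge_min lexx orbT.
exists (Num.min r t) => //; split; last by move=> _ [z /subt /tD Hz <-].
split=> //.
  apply/subspace_continuousP => x Dx.
  move/subspace_continuousP: cf => /(_ x (subr _ Dx)) cf.
  move/subspace_continuousP: cg => /(_ (f x) (tD _ (subt _ Dx))) cg.
  move=> N /cg; rewrite /within /= => /cf; rewrite /within /=.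
  apply: (@filterS _ (nbhs x)) => z Hz Dz; apply: Hz; first exact: subr.
  by apply: tD; exact: subt.
move=> a b Da Db /gi E; apply: fi; try exact: subr.
by apply: E; apply: tD; exact: subt.
Qed.

Lemma deg_comp f g p d k : deg f p d -> deg g (f p) k -> deg (g \o f) p (k * d).
Proof.
move=> fd gk; have [r ef _] := fd; have [s eg Wg] := gk.
have [s0 cg gi] := eg; have [r0 cf fi] := ef.
have [r' /andP[r'0 r'r] [e fD]] := emb_comp ef eg.
exists r' => //=.
have e' : emb f p r' by apply: (emb_sub ef); rewrite r'0.
apply: (wind_mult s0 cg (p := f p) (g := fun t => f (circ p r' t))) => //.
- by move=> z; exact: emb_neq.
- have [_ cf' _] := e'; apply: (within_comp_continuous cf').
    exact: circ_continuous.
  by move=> t; exact: circ_in.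
- by move=> t; rewrite circ_periodic.
- move=> t; split; first by apply: fD; exists (circ p r' t) => //; exact: circ_in.
  by apply: (emb_neq e'); [exact: circ_in|apply: circ_neq; rewrite gt_eqF].
- exact: deg_wind.
Qed.

(** The centre is moved from [p] to [q] with the circle kept fixed, and only then is the circle
    shrunk. Injectivity of [f] reduces both homotopies to avoiding a point in the source disk. *)
Lemma deg_near f p r d q : emb f p r -> deg f p d ->
  (q.1 - p.1) ^+ 2 + (q.2 - p.2) ^+ 2 < r ^+ 2 -> deg f q d.
Proof.
move=> e fd qr; have [r0 cf fi] := e.
have W := deg_wind e fd.
pose P s := lerp (clamp01 s) p q.
have cP : continuous P.
  by have := @clamp01_continuous R => ?; rewrite /P /lerp; ct.
have Psub s : P s - p = (clamp01 s * (q - p).1, clamp01 s * (q - p).2).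
  by rewrite [LHS]pairE /=; congr (_, _); ring.
have cs s := @clamp01_itv R s.
have cle (s x y : R) : (clamp01 s * x) ^+ 2 + (clamp01 s * y) ^+ 2 <= x ^+ 2 + y ^+ 2.
  have /andP[s0 s1] := cs s.
  have -> : (clamp01 s * x) ^+ 2 + (clamp01 s * y) ^+ 2 = clamp01 s ^+ 2 * (x ^+ 2 + y ^+ 2) by ring.
  rewrite -[leRHS]mul1r ler_wpM2r ?expr_le1//.
  by rewrite addr_ge0 ?sqr_ge0.
have Plt s : ((P s).1 - p.1) ^+ 2 + ((P s).2 - p.2) ^+ 2 < r ^+ 2.
  apply: le_lt_trans qr; apply: le_trans (cle s _ _).
  by have [-> ->] : (P s).1 - p.1 = clamp01 s * (q.1 - p.1) /\
     (P s).2 - p.2 = clamp01 s * (q.2 - p.2) by rewrite /P /lerp /=; split; ring.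
have PD s : closed_disk p r (P s) by exact: (ltW (Plt s)).
have Dq : closed_disk p r q by exact: (ltW qr).
have PN s t : circ p r t != P s.
  by apply/eqP => E; have := Plt s; rewrite -E circ_dist ltxx.
have cfc : continuous (fun t => f (circ p r t)).
  by apply: (within_comp_continuous cf); [exact: circ_continuous|move=> t; exact: circ_in].
have W1 : wind (fun t => f (circ p r t) - f q) d.
  pose H s t := f (circ p r t) - f (P s).
  suff -> : (fun t => f (circ p r t) - f q) = H 1.
    apply: (@wind_homotopy _ H).
    - apply: continuous_subr.
        by apply: (continuous_compose cfc); ct.
      by apply: (within_comp_continuous cf) => //; apply: (continuous_compose cP); ct.
    - move=> s t; rewrite subr_eq0; apply: contra (PN s t) => /eqP/fi ->//.
      exact: circ_in.
    - by move=> s t; rewrite /H circ_periodic.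
    - by rewrite /H /P clamp010 lerp0.
  by rewrite /H /P clamp011 lerp1.
have /nbhs_disk[s s0 sD] : nbhs q (closed_disk p r).
  have c : continuous (fun z => (z.1 - p.1) ^+ 2 + (z.2 - p.2) ^+ 2) by ct.
  have := c q _ (lt_nbhsl qr : nbhs _ [set x | x < _]).
  by apply: (@filterS _ (nbhs q)) => z /= /ltW.
have eq_ : emb f q s.
  split=> //; first exact: continuous_subspaceW cf.
  by move=> a b /sD Da /sD Db; exact: fi.
exists s => //.
have [d' W'] := emb_wind eq_.
have Wp : wind (fun t => circ p r t - q) 1.
  apply: (@wind_lerp _ (fun t => circ p r t - p)); last exact: wind_circ.
  - by apply: continuous_subr; [exact: circ_continuous|exact: cst_continuous].
  - by apply: continuous_subr; [exact: circ_continuous|exact: cst_continuous].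
  - by move=> t; rewrite circ_periodic.
  - by move=> t; rewrite circ_periodic.
  move=> x t /clamp01_id xE; apply: contra (PN x t) => /eqP [E1 E2].
  apply/eqP; rewrite [LHS]pairE [RHS]pairE /P xE; congr (_, _); rewrite /lerp /=.
    by move: E1; rewrite /=; lra.
  by move: E2; rewrite /=; lra.
(* Shrinking the circle around [p] radially onto a small circle around [q]. *)
pose H x t := f (lerp (clamp01 x) (circ p r t) (circ q s t)) - f q.
have HD x t : closed_disk p r (lerp (clamp01 x) (circ p r t) (circ q s t)).
  have Dc : closed_disk p r (circ q s t) by apply: sD; exact: circ_in.
  have Er := circ_dist p r t.
  move: (circ p r t) (circ q s t) Dc Er => v w; rewrite /closed_disk /lerp /=.
  have /andP[x0 x1] := cs x.
  move: (clamp01 x) x0 x1 => y y0 y1.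
  set A := w.1 - p.1; set B := w.2 - p.2; set C := v.1 - p.1; set D := v.2 - p.2.
  have -> : (1 - y) * v.1 + y * w.1 - p.1 = (1 - y) * C + y * A by rewrite /C /A; ring.
  have -> : (1 - y) * v.2 + y * w.2 - p.2 = (1 - y) * D + y * B by rewrite /D /B; ring.
  move=> h1 h2.
  (* Convexity of the squared norm, with the defect written out. *)
  have -> : ((1 - y) * C + y * A) ^+ 2 + ((1 - y) * D + y * B) ^+ 2 =
    (1 - y) * (C ^+ 2 + D ^+ 2) + y * (A ^+ 2 + B ^+ 2) -
    y * (1 - y) * ((C - A) ^+ 2 + (D - B) ^+ 2) by ring.
  have n1 : 0 <= y * (1 - y) * ((C - A) ^+ 2 + (D - B) ^+ 2).
    by rewrite !mulr_ge0 ?subr_ge0// addr_ge0 ?sqr_ge0.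
  have n2 : y * (A ^+ 2 + B ^+ 2) <= y * r ^+ 2 by rewrite ler_wpM2l.
  by rewrite h2; lra.
have HN x t : lerp (clamp01 x) (circ p r t) (circ q s t) != q.
  apply/eqP => E.
  have [k0 k1] := andP (cs x).
  have E1 := congr1 fst E; have E2 := congr1 snd E.
  move: E1 E2; rewrite /lerp /circ /=; move: (clamp01 x) k0 k1 => y k0 k1.
  set c := cos t; set sn := sin t => E1 E2.
  have qe1 : (1 - y) * (q.1 - p.1) = ((1 - y) * r + y * s) * c by lra.
  have qe2 : (1 - y) * (q.2 - p.2) = ((1 - y) * r + y * s) * sn by lra.
  have ca : c ^+ 2 + sn ^+ 2 = 1 by exact: cos2Dsin2.
  (* An interpolated point equal to [q] would make [(1 - y)] times the distance from [p] to [q]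
     equal to [(1 - y) * r + y * s], although that distance is less than [r]. *)
  have Q : (1 - y) ^+ 2 * ((q.1 - p.1) ^+ 2 + (q.2 - p.2) ^+ 2) = ((1 - y) * r + y * s) ^+ 2.
    transitivity (((1 - y) * (q.1 - p.1)) ^+ 2 + ((1 - y) * (q.2 - p.2)) ^+ 2); first by ring.
    by rewrite qe1 qe2 !exprMn -mulrDr ca mulr1.
  have ge : ((1 - y) * r) ^+ 2 <= ((1 - y) * r + y * s) ^+ 2.
    by rewrite lerXn2r ?nnegrE ?lerDl ?addr_ge0 ?mulr_ge0 ?subr_ge0 ?(ltW r0) ?(ltW s0).
  have [y1|yN1] := eqVneq y 1.
    move: Q; rewrite y1 subrr expr0n /= !mul0r add0r mul1r => /esym/eqP.
    by rewrite sqrf_eq0 gt_eqF.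
  have : (1 - y) ^+ 2 * ((q.1 - p.1) ^+ 2 + (q.2 - p.2) ^+ 2) < (1 - y) ^+ 2 * r ^+ 2.
    by rewrite ltr_pM2l// exprn_gt0// subr_gt0 lt_neqAle yN1.
  by rewrite Q -exprMn ltNge ge.
suff W2 : wind (H 1) d.
  have -> : d = d' by apply: wind_unique W2 _; rewrite /H clamp011; under eq_fun do rewrite lerp1.
  exact: W'.
apply: (@wind_homotopy _ H).
- rewrite /H; apply: continuous_subr; last exact: cst_continuous.
  apply: (within_comp_continuous cf) => //.
  by have := @clamp01_continuous R => ?; rewrite /lerp /circ /=; ct.
- move=> x t; rewrite subr_eq0; apply: contra (HN x t) => /eqP/fi -> //.
- by move=> x t; rewrite /H !circ_periodic.
- by rewrite /H clamp010; under eq_fun do rewrite lerp0.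
Qed.

Lemma deg_homotopy (H : R -> R * R -> R * R) p r d : 0 < r ->
  (forall t, 0 <= t <= 1 -> emb (H t) p r) ->
  {within [set z : R * (R * R) | 0 <= z.1 <= 1 /\ closed_disk p r z.2],
    continuous (fun z : R * (R * R) => H z.1 z.2)} ->
  deg (H 0) p d -> deg (H 1) p d.
Proof.
move=> r0 e cH d0.
have i0 : 0 <= (0 : R) <= 1 by rewrite lexx ler01.
have i1 : 0 <= (1 : R) <= 1 by rewrite lexx ler01.
exists r; first exact: e.
have W := deg_wind (e 0 i0) d0.
pose G s t := H (clamp01 s) (circ p r t) - H (clamp01 s) p.
suff -> : (fun t => H 1 (circ p r t) - H 1 p) = G 1.
  apply: (@wind_homotopy _ G).
  - have c1 : continuous (fun z : R * R => (clamp01 z.1, circ p r z.2)).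
      by have := @clamp01_continuous R => ?; rewrite /circ; ct.
    have c2 : continuous (fun z : R * R => (clamp01 z.1, p)).
      by have := @clamp01_continuous R => ?; ct.
    rewrite /G; apply: continuous_subr.
      apply: (within_comp_continuous cH c1) => z.
      by split; [exact: clamp01_itv|exact: circ_in].
    apply: (within_comp_continuous cH c2) => z.
    by split; [exact: clamp01_itv|exact: disk_center].
  - move=> s t; rewrite subr_eq0; apply: (emb_neq (e _ _)); first exact: clamp01_itv.
      exact: circ_in.
    by apply: circ_neq; rewrite gt_eqF.
  - by move=> s t; rewrite /G circ_periodic.
  - by rewrite /G clamp010.
by rewrite /G clamp011.
Qed.

(** The angle given on [[0, 1]] and the periodic one, rescaled by [2 * pi], describe the same loop
    and so differ by a constant; the prescribed increment [2 * pi] then forces winding number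
    [1]. *)
Lemma loc_orient_pres_deg (D : set (R * R)) f p :
  loc_orient_pres D f p -> deg f p 1.
Proof.
move=> [r [r0 [_ [cf [fi [th [cth [H E]]]]]]]].
have e : emb f p r by split.
have [d W] := emb_wind e; exists r => //.
suff <- : d = 1 by [].
have [th' [cth' H' E']] := W.
have pn0 : 2 * pi != 0 :> R by rewrite gt_eqF// two_pi_gt0.
pose D' s := th (clamp01 s) - th' (2 * pi * clamp01 s).
have cD : continuous D'.
  apply: continuous_add.
    apply: (within_comp_continuous cth); first exact: clamp01_continuous.
    exact: clamp01_itv.
  by have := @clamp01_continuous R => ?; ct.
have kD t : exists k : int, D' t = 2 * pi * k%:~R.
  have [k Ek] : exists k : int, th (clamp01 t) = th' (2 * pi * clamp01 t) + 2 * pi * k%:~R.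
    apply: ang_mod (H' _).
    have [d0 [E1 E2]] := H _ (clamp01_itv t).
    exists (Num.sqrt (dot (f (circ p r (2 * pi * clamp01 t)) - f p) (f (circ p r (2 * pi * clamp01 t)) - f p))).
    rewrite [LHS in _ /\ LHS = _]pairE.
    by move: d0 E1 E2; rewrite /= /dot -!expr2 /circle_loop => d0 E1 E2; split=> //; congr (_, _).
  by exists k; rewrite /D' Ek addrAC subrr add0r.
have := twopi_const cD kD 1 0; rewrite /D' clamp011 clamp010 mulr1 mulr0.
have := E' 0; rewrite add0r => -> h; apply: (@twopi_inj R); rewrite mulr1; lra.
Qed.

Lemma deg_loc_orient_pres (D : set (R * R)) f p :
  nbhs p D -> deg f p 1 -> loc_orient_pres D f p.
Proof.
move=> /nbhs_disk[s s0 sD] fd; have [r e _] := fd; have [r0 _ _] := e.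
have m0 : 0 < Num.min r s by rewrite lt_min r0.
have e1 : emb f p (Num.min r s) by apply: (emb_sub e); rewrite m0 ge_min lexx.
have [_ cf fi] := e1.
exists (Num.min r s); split=> //; split.
  by apply: subset_trans sD; apply: disk_sub; rewrite (ltW m0) ge_min lexx orbT.
split=> //; split=> //.
have [th [cth H E]] := deg_wind e1 fd.
exists (fun t => th (2 * pi * t)); split; last split.
- by apply: continuous_subspaceT; ct.
- move=> t _ /=; have A := ang_norm (H (2 * pi * t)).
  have N0 := dot_gt0 (ang_neq0 (H (2 * pi * t))).
  have E1 := congr1 fst A; have E2 := congr1 snd A.
  by move: N0 E1 E2; rewrite /= /dot /= -!expr2 -sqrtr_gt0.
- by rewrite mulr1 mulr0; have := E 0; rewrite add0r mulr1 => ->; lra.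
Qed.

(** The hypotheses are what a map gives that keeps both sides of the axis and reverses the axis
    itself. Under them [f - f p] on the circle never points opposite to the reflected loop, which
    winds [-1] times. *)
Lemma deg_reflection f p r : emb f p r ->
  (forall z, closed_disk p r z ->
    [/\ p.2 < z.2 -> (f p).2 < (f z).2, z.2 < p.2 -> (f z).2 < (f p).2,
        z.2 = p.2 -> p.1 < z.1 -> (f z).1 < (f p).1 &
        z.2 = p.2 -> z.1 < p.1 -> (f p).1 < (f z).1]) ->
  deg f p (-1).
Proof.
move=> e H; have [r0 cf _] := e; exists r => //.
apply: (@wind_lerp _ (fun t => (- cos t, sin t))).
- by ct.
- apply: continuous_subr; last exact: cst_continuous.
  by apply: (within_comp_continuous cf); [exact: circ_continuous|move=> t; exact: circ_in].
- by move=> t; have := cosD2piz t 1; have := sinD2piz t 1; rewrite mulr1 => -> ->.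
- by move=> t; rewrite circ_periodic.
- move=> s t /andP[s0 s1]; have [h1 h2 h3 h4] := H _ (circ_in p t (lexx `|r|)).
  have ca := cos2Dsin2 t.
  apply/eqP => E.
  have E1 := congr1 fst E; have E2 := congr1 snd E.
  move: E1 E2; rewrite /lerp /=; set v := f (circ p r t) in h1 h2 h3 h4 * => E1 E2.
  have cp (x y : R) : 0 < x -> 0 < y -> (1 - s) * x + s * y = 0 -> False.
    move=> x0 y0; have [->|sN0] := eqVneq s 0; first by lra.
    have h : 0 < s * y by rewrite mulr_gt0// lt_def sN0.
    have : 0 <= (1 - s) * x by apply: mulr_ge0; rewrite ?subr_ge0// ltW.
    by lra.
  case: (ltgtP (sin t) 0) => st.
  - apply: (cp (- sin t) ((f p).2 - v.2)); [lra| |lra].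
    by rewrite subr_gt0; apply: h2; rewrite /circ /= gtrDl pmulr_rlt0.
  - apply: (cp (sin t) (v.2 - (f p).2)); [lra| |lra].
    by rewrite subr_gt0; apply: h1; rewrite /circ /= ltrDl pmulr_rgt0.
  - have E' : (circ p r t).2 = p.2 by rewrite /circ /= st mulr0 addr0.
    case: (ltgtP (cos t) 0) => ct0.
    + apply: (cp (- cos t) (v.1 - (f p).1)); [lra| |lra].
      by rewrite subr_gt0; apply: h4 => //; rewrite /circ /= gtrDl pmulr_rlt0.
    + apply: (cp (cos t) ((f p).1 - v.1)); [lra| |lra].
      by rewrite subr_gt0; apply: h3 => //; rewrite /circ /= ltrDl pmulr_rgt0.
    + by move: ca; rewrite st ct0 expr0n /= addr0 => /eqP; rewrite eq_sym oner_eq0.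
- exists (fun t => pi - t); split; first by ct.
  + move=> t; exists 1; split=> //.
    by rewrite cosB sinB cospi sinpi !mul0r !mul1r addr0 mulN1r sub0r mulN1r opprK.
  + by move=> t; rewrite mulrN1; ring.
Qed.

End DegreeCalculus.

(** * Surfaces, isotopies and orientation *)

Section SurfaceMaps.
Variables (R : realType) (X : topologicalType).
Hypothesis surfX : surface R X.
Implicit Types (c : chart R X) (x y : X) (z p q : R * R) (f g h : X -> X).

Lemma within_continuous_at (T U : topologicalType) (A : set T) (f : T -> U) a :
  {within A, continuous f} -> nbhs a A -> {for a, continuous f}.
Proof.
move=> /subspace_continuousP cf NA N Nf.
have := cf a (nbhs_singleton NA) N Nf; rewrite /within /=.
by move/(filterI NA); apply: (@filterS _ (nbhs a)) => b [Ab]; exact.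
Qed.

Lemma hausX : hausdorff_space X. Proof. by case: surfX. Qed.

Lemma chart_at x : exists c, is_chart c /\ cdom c x.
Proof. by case: surfX => _ _; exact. Qed.

Lemma chart_continuous c x : is_chart c -> cdom c x ->
  {for x, continuous (cmap c)} /\ nbhs x (cdom c).
Proof.
move=> [oc _ [cc _ _ _ _]] cx; have N := open_nbhs_nbhs (conj oc cx).
by split=> //; exact: within_continuous_at cc N.
Qed.

Lemma cmapK c x : is_chart c -> cdom c x -> cinv c (cmap c x) = x.
Proof. by move=> [_ _ [_ _ _ _ [K _]]]; exact: K. Qed.

Lemma chart_disk c x (N : set X) : is_chart c -> cdom c x -> nbhs x N ->
  exists2 r : R, 0 < r & [/\ {within closed_disk (cmap c x) r, continuous (cinv c)},
    closed_disk (cmap c x) r `<=` cmap c @` cdom c &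
    forall z, closed_disk (cmap c x) r z ->
      [/\ cdom c (cinv c z), N (cinv c z) & cmap c (cinv c z) = z]].
Proof.
move=> cc cx Nx; have [oc om [_ ci _ im [_ K]]] := cc.
have Nm : nbhs (cmap c x) (cmap c @` cdom c).
  by apply: open_nbhs_nbhs; split=> //; exists x.
have Nx' : nbhs (cinv c (cmap c x)) N by rewrite cmapK.
have N2 := within_continuous_at ci Nm Nx'.
have /nbhs_disk[r r0 rD] : nbhs (cmap c x) ((cmap c @` cdom c) `&` (cinv c @^-1` N)).
  exact: filterI Nm N2.
exists r => //; split.
- by apply: continuous_subspaceW ci => z /rD[].
- by move=> z /rD[].
- move=> z /rD[mz Nz]; split=> //; last exact: K.
  by apply: im; exists z.
Qed.

Lemma invdom_plane (e : R * R -> X) p r : 0 < r ->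
  {within closed_disk p r, continuous e} ->
  (forall a b, closed_disk p r a -> closed_disk p r b -> e a = e b -> a = b) ->
  nbhs (e p) (e @` closed_disk p r).
Proof.
move=> r0 ce ie; have [c [cc cx]] := chart_at (e p).
have [cmc Nc] := chart_continuous cc cx.
have Np := disk_nbhs p r0.
have /nbhs_disk[s s0 sD] : nbhs p (closed_disk p r `&` (e @^-1` cdom c)).
  exact: filterI Np (within_continuous_at ce Np Nc).
have em : emb (cmap c \o e) p s.
  split=> //.
    apply/subspace_continuousP => a Da N Na.
    have [Dra ca] := sD _ Da.
    have [cma _] := chart_continuous cc ca.
    move/subspace_continuousP: ce => /(_ a Dra _ (cma _ Na)); rewrite /within /=.
    by apply: (@filterS _ (nbhs a)) => b Hb /sD[/Hb].
  move=> a b /sD[Da ca] /sD[Db cb] /= E; apply: ie => //.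
  by rewrite -(cmapK cc ca) E cmapK.
have I := invariance_of_domain em.
have : nbhs (e p) (cdom c `&` (cmap c @^-1` ((cmap c \o e) @` closed_disk p s))).
  exact: filterI Nc (cmc _ I).
apply: (@filterS _ (nbhs (e p))) => x [dx [z Dz E]].
exists z; first by have [] := sD _ Dz.
have [_ dz] := sD _ Dz.
by rewrite -(cmapK cc dx) -E /= cmapK.
Qed.

Lemma invdom_surface f x (A : set X) : nbhs x A -> {within A, continuous f} ->
  (forall a b, A a -> A b -> f a = f b -> a = b) -> nbhs (f x) (f @` A).
Proof.
move=> NA cf fi; have [c [cc cx]] := chart_at x.
have [r r0 [ci rD H]] := chart_disk cc cx NA.
have := @invdom_plane (f \o cinv c) (cmap c x) r r0.
rewrite /= cmapK// => N.
apply: (@filterS _ (nbhs (f x)) _ _ _ _ (N _ _)).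
- by move=> _ [z /H[_ Az _] <-]; exists (cinv c z).
- apply/subspace_continuousP => a Da M Ma.
  have [_ Aa _] := H _ Da.
  move/subspace_continuousP: cf => /(_ _ Aa _ Ma) Mb.
  move/subspace_continuousP: ci => /(_ a Da _ Mb); rewrite /within /=.
  by apply: (@filterS _ (nbhs a)) => b Hb Db; apply: Hb => //; have [] := H _ Db.
- move=> a b Da Db /= E; have [_ Aa Ea] := H _ Da; have [_ Ab Eb] := H _ Db.
  by rewrite -Ea -Eb (fi _ _ Aa Ab E).
Qed.

Definition homeo f := exists g, [/\ continuous f, continuous g,
  forall x, g (f x) = x & forall x, f (g x) = x].

Lemma homeoP f : self_homeo [set: X] f <-> homeo f.
Proof.
split=> [[g [cf cg _ _ [K1 K2]]]|[g [cf cg K1 K2]]].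
  exists g; split.
  - by move=> x; apply: (within_continuous_at cf); exact: filterT.
  - by move=> x; apply: (within_continuous_at cg); exact: filterT.
  - by move=> x; exact: K1.
  - by move=> x; exact: K2.
exists g; split=> //; try exact: continuous_subspaceT.
Qed.

(** The inverse is continuous by invariance of domain. Extended and glued maps can thus be checked
    for continuity in one direction only. *)
Lemma bij_homeo f g : continuous f -> (forall x, g (f x) = x) ->
  (forall x, f (g x) = x) -> homeo f.
Proof.
move=> cf K1 K2; exists g; split=> // y N Ng.
have := @invdom_surface f (g y) N Ng (continuous_subspaceT cf).
rewrite K2 => /(_ _) H.
apply: (@filterS _ (nbhs y) _ _ _ _ (H _)); first by move=> _ [x Nx <-]; rewrite /= K1.
by move=> a b _ _ E; rewrite -(K1 a) E.
Qed.

Lemma homeo_id : homeo id.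
Proof. by exists id; split=> // x; exact: cvg_id. Qed.

Lemma homeo_comp f g : homeo f -> homeo g -> homeo (f \o g).
Proof.
move=> [f' [cf cf' K1 K2]] [g' [cg cg' L1 L2]]; exists (g' \o f'); split.
- exact: (continuous_compose cf cg).
- exact: (continuous_compose cg' cf').
- by move=> x /=; rewrite K1.
- by move=> x /=; rewrite L2.
Qed.

Lemma homeo_inv f g : homeo f -> (forall x, g (f x) = x) -> (forall x, f (g x) = x) ->
  homeo g.
Proof.
move=> [g' [cf cg' K1 K2]] L1 L2; exists f; split=> //.
by have -> : g = g' by apply/funext => x; rewrite -{1}(K2 x) L1.
Qed.

Lemma homeo_invE f : homeo f -> exists g, [/\ homeo g, forall x, g (f x) = x &
  forall x, f (g x) = x].
Proof.
by move=> hf; have [g [cf cg K1 K2]] := hf; exists g; split=> //; exact: homeo_inv hf K1 K2.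
Qed.

Lemma homeo_continuous f : homeo f -> continuous f. Proof. by case=> g []. Qed.

Lemma homeo_inj f : homeo f -> injective f.
Proof. by move=> [g [_ _ K _]] x y E; rewrite -(K x) E. Qed.

(** Time ranges over the whole line; [isotopyP] obtains this form by freezing time outside
    [[0, 1]]. *)
Definition isotopy (H : R -> X -> X) :=
  continuous (fun z : R * X => H z.1 z.2) /\ forall t, homeo (H t).

Lemma isotopyP h h' :
  isotopic R h h' <-> exists H, [/\ isotopy H, H 0 = h & H 1 = h'].
Proof.
split=> [[H [cH hH _ H0 H1]]|[H [[cH hH] H0 H1]]].
  exists (fun t => H (clamp01 t)); split; [split| |].
  - have cc := @clamp01_continuous R.
    have c1 : continuous (fun z : R * X => (clamp01 z.1, z.2)) by ct.
    by apply: (within_comp_continuous cH c1) => z; split=> //; exact: clamp01_itv.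
  - by move=> t; apply/homeoP/hH/clamp01_itv.
  - by apply/funext => x; rewrite clamp010 H0.
  - by apply/funext => x; rewrite clamp011 H1.
exists H; split=> //.
- by apply: continuous_subspaceT.
- by move=> t _; apply/homeoP.
- by move=> x _; rewrite H0.
- by move=> x _; rewrite H1.
Qed.

Lemma isotopy_continuous (T : topologicalType) (H : R -> X -> X)
    (a : T -> R) (b : T -> X) :
  isotopy H -> continuous a -> continuous b -> continuous (fun t => H (a t) (b t)).
Proof.
move=> [cH _] ca cb; exact: (continuous_compose cH (continuous_pair ca cb)).
Qed.

Lemma isotopic_refl h : homeo h -> isotopic R h h.
Proof.
move=> hh; apply/isotopyP; exists (fun=> h); split=> //; split=> //.
by apply: (continuous_compose (homeo_continuous hh)); ct.
Qed.

Lemma isotopic_sym h h' : isotopic R h h' -> isotopic R h' h.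
Proof.
move=> /isotopyP[H [iH H0 H1]]; apply/isotopyP; exists (fun t => H (1 - t)).
rewrite subrr subr0; split=> //; split; last by move=> t; case: iH.
by apply: isotopy_continuous; ct.
Qed.

Lemma isotopic_homeo h h' : isotopic R h h' -> homeo h /\ homeo h'.
Proof. by move=> /isotopyP[H [[_ hH] <- <-]]. Qed.

Lemma isotopic_comp h h' k k' : isotopic R h h' -> isotopic R k k' ->
  isotopic R (h \o k) (h' \o k').
Proof.
move=> /isotopyP[H [iH H0 H1]] /isotopyP[K [iK K0 K1]]; apply/isotopyP.
exists (fun t => H t \o K t); rewrite H0 H1 K0 K1; split=> //; split.
  by apply: isotopy_continuous => //; [|apply: isotopy_continuous => //]; ct.
by move=> t; apply: homeo_comp; [case: iH|case: iK].
Qed.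

(** Composition replaces concatenation in time: with [g] inverse to [h'], the product of the two
    isotopies runs from [h' \o g \o h] to [h'' \o g \o h']. *)
Lemma isotopic_trans h h' h'' : isotopic R h h' -> isotopic R h' h'' ->
  isotopic R h h''.
Proof.
move=> i1 i2; have [_ hh'] := isotopic_homeo i1.
have [g [hg K1 K2]] := homeo_invE hh'.
have := isotopic_comp (isotopic_comp i2 (isotopic_refl hg)) i1.
congr (isotopic _ _ _); apply/funext => x /=; first by rewrite K2.
by rewrite K1.
Qed.

Lemma disk_compact p r : 0 < r -> compact (closed_disk p r).
Proof.
move=> r0.
have cb : compact (`[p.1 - r, p.1 + r] `*` `[p.2 - r, p.2 + r]).
  by apply: compact_setX; exact: segment_compact.
apply: (subclosed_compact _ cb).
  have c : continuous (fun z => (z.1 - p.1) ^+ 2 + (z.2 - p.2) ^+ 2) by ct.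
  have -> : closed_disk p r =
     (fun z => (z.1 - p.1) ^+ 2 + (z.2 - p.2) ^+ 2) @^-1` [set t | t <= r ^+ 2] by [].
  by apply: closed_comp; [move=> z _; exact: c|exact: closed_le].
move=> z Dz; have [] := disk_coord (ltW r0) Dz; rewrite !ler_norml.
move=> /andP[h1 h2] /andP[h3 h4].
by split; rewrite /= in_itv /=; apply/andP; split; lra.
Qed.

Lemma disk_image_connected (T : topologicalType) (e : R * R -> T) p r : 0 < r ->
  {within closed_disk p r, continuous e} -> connected (e @` closed_disk p r).
Proof.
move=> r0 ce.
have -> : e @` closed_disk p r =
    \bigcup_(z in closed_disk p r) ((fun s => e (lerp s p z)) @` `[0, 1]).
  apply/seteqP; split=> [_ [z Dz <-]|_ [z Dz [s /= s01 <-]]].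
    by exists z => //; exists 1; rewrite ?lerp1//= in_itv /= ler01 lexx.
  by exists (lerp s p z) => //; apply: lerp_disk => //; rewrite in_itv in s01.
apply: bigcup_connected.
  exists (e p) => z Dz; exists 0; rewrite ?lerp0//= in_itv /= ler01 lexx.
  by [].
move=> z Dz; apply: connected_continuous_connected; first exact: segment_connected.
have c : continuous (fun s => lerp (clamp01 s) p z).
  by have := @clamp01_continuous R => ?; rewrite /lerp; ct.
have lD s : closed_disk p r (lerp (clamp01 s) p z).
  by apply: lerp_disk => //; exact: clamp01_itv.
have cl := within_comp_continuous ce c lD.
apply/subspace_continuousP => s; rewrite /= in_itv /= => s01 N Ns.
have Ns' : nbhs (e (lerp (clamp01 s) p z)) N by rewrite clamp01_id.
have := cl s N Ns'; rewrite /within /=.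
apply: (@filterS _ (nbhs s)) => t Ht; rewrite in_itv /= => t01.
by have : N (e (lerp (clamp01 t) p z)) := Ht; rewrite clamp01_id.
Qed.

(* Near [t0] the circle bounding a small disk around [y0] avoids a connected
   neighbourhood [V] of [H t0 y0]; the part of [V] covered by the disk is
   clopen in [V], hence all of [V]. *)
Lemma isotopy_inv (H G : R -> X -> X) : isotopy H ->
  (forall t x, G t (H t x) = x) -> (forall t x, H t (G t x) = x) -> isotopy G.
Proof.
move=> iH K1 K2; have [cH hH] := iH.
have cHt t : continuous (H t) by exact: homeo_continuous.
have cGt t : continuous (G t).
  by apply: homeo_continuous; exact: (homeo_inv (hH t)).
split; last by move=> t; exact: (homeo_inv (hH t)).
move=> [t0 x0] N /= NN; set y0 := G t0 x0 in NN.
have Ey0 : H t0 y0 = x0 by rewrite /y0 K2.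
have [c [cc cy]] := chart_at y0.
have [r r0 [ci rD rH]] := chart_disk cc cy NN.
set p := cmap c y0 in ci rD rH.
pose B := cinv c @` closed_disk p r.
pose od : set (R * R) := [set z | (z.1 - p.1) ^+ 2 + (z.2 - p.2) ^+ 2 < r ^+ 2].
pose O := cdom c `&` (cmap c @^-1` od) .
have cdist : continuous (fun z => (z.1 - p.1) ^+ 2 + (z.2 - p.2) ^+ 2) by ct.
have ood : open od.
  by apply: (@open_comp _ _ _ [set t | t < r ^+ 2]); [move=> z _; exact: cdist|exact: open_lt].
have oO : open O.
  rewrite openE => x [cx ox]; have [cmx Nx] := chart_continuous cc cx.
  by apply: filterI => //; apply: cmx; exact: open_nbhs_nbhs.
have OB : O `<=` B.
  move=> x [cx ox]; exists (cmap c x); last by rewrite cmapK.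
  exact: (ltW ox).
have BO x : B x -> ~ O x -> exists t, x = cinv c (circ p r t).
  move=> [z Dz <-{x}] nO; have [dz _ Ez] := rH _ Dz.
  have : (z.1 - p.1) ^+ 2 + (z.2 - p.2) ^+ 2 = r ^+ 2.
    apply/eqP; rewrite eq_le -/(closed_disk p r z); apply/andP; split; first exact: Dz.
    by rewrite leNgt; apply/negP => h; apply: nO; split=> //=; rewrite Ez.
  move=> Er; have : z - p != 0.
    apply/eqP => E; move: Er; have E1 := congr1 fst E; have E2 := congr1 snd E.
    rewrite /= in E1 E2; rewrite E1 E2 expr0n /= addr0 => /esym/eqP.
    by rewrite sqrf_eq0 gt_eqF.
  move=> /ang_exists[t /ang_norm]; have -> : dot (z - p) (z - p) = r ^+ 2.
    by rewrite -Er /dot /= -!expr2.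
  rewrite sqrtr_sqr gtr0_norm// => E; exists t; congr (cinv c _).
  rewrite [LHS]pairE /circ; have E1 := congr1 fst E; have E2 := congr1 snd E.
  by move: E1 E2 => /= E1 E2; congr (_, _); lra.
have cB : compact B.
  by apply: continuous_compact => //; exact: disk_compact.
have clB : closed B by apply: compact_closed => //; exact: hausX.
pose s t := cinv c (circ p r t).
have cs : continuous s.
  by apply: (within_comp_continuous ci); [exact: circ_continuous|move=> t; exact: circ_in].
have sO t : ~ O (s t).
  move=> [_]; rewrite /s /od /=; have [_ _ ->] := rH _ (circ_in p t (lexx `|r|)).
  by rewrite circ_dist ltxx.
have Oy : O y0.
  by split=> //; rewrite /od /= !subrr expr0n /= addr0 exprn_gt0.
have := (compact_near_coveringP _).1 (@segment_compact R 0 (2 * pi)).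
move=> /(_ (R * X)%type (nbhs (t0, x0)) (fun (u : R * X) t => H u.1 (s t) <> u.2) _) [t _|].
  have Hne : H t0 (s t) <> x0.
    by move=> E; apply: (sO t); have -> : s t = y0 by rewrite /y0 -E K1.
  have := hausX; rewrite open_hausdorff => /(_ (H t0 (s t)) x0 _).
  move=> [|[U V] /= [/set_mem Us /set_mem Vx] [oU oV UV]]; first exact/eqP.
  have cHs : continuous (fun q : R * R => H q.1 (s q.2)).
    by apply: isotopy_continuous => //; ct.
  have : nbhs (t0, t) [set q : R * R | U (H q.1 (s q.2))].
    by apply: cHs; exact: open_nbhs_nbhs.
  move=> [[A1 A2] /= [NA1 NA2] AU].
  exists (A2, A1 `*` V) => /=.
    split=> //; exists (A1, V) => //; split=> //=; exact: open_nbhs_nbhs.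
  move=> [t' [t1 x1]] /= [At [At1 Vx1]] E.
  have : (U `&` V) x1 by split=> //; rewrite -E; apply: (AU (t1, t')).
  by move/eqP: UV => ->.
move=> [A1 A2] /= [NA1 NA2] AH.
have {}AH t1 x1 t : A1 t1 -> A2 x1 -> H t1 (s t) <> x1.
  move=> a1 a2; have [k /andP[h1 h2]] := period_reduce t.
  have -> : s t = s (t + 2 * pi * k%:~R) by rewrite /s circ_period.
  by apply: (AH (t1, x1)) => //=; rewrite in_itv /= h1 ltW.
have [d [cd dx]] := chart_at x0.
have [r' r'0 [ci' _ rH']] := chart_disk cd dx NA2.
pose V := cinv d @` closed_disk (cmap d x0) r'.
have VA : V `<=` A2 by move=> _ [z Dz <-]; have [] := rH' _ Dz.
have NV : nbhs x0 V.
  have := @invdom_plane (cinv d) (cmap d x0) r' r'0 ci'; rewrite cmapK//; apply.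
  by move=> a b /rH'[_ _ Ea] /rH'[_ _ Eb] E; rewrite -Ea -Eb E.
have connV : connected V by exact: disk_image_connected.
have NT : nbhs t0 [set t | V (H t y0)].
  have ch : continuous (fun t => H t y0) by apply: isotopy_continuous => //; ct.
  by apply: ch; rewrite Ey0.
exists (A1 `&` [set t | V (H t y0)], V) => /=.
  by split=> //; exact: filterI.
move=> [t x] /= [[A1t Vt] Vx].
have NV_ y : V (H t y) -> B y -> O y.
  move=> Vy By; apply: contrapT => /(BO _ By)[a Ey].
  by apply: (AH t (H t y) a A1t (VA _ Vy)); rewrite /s -Ey.
have E : V `&` (G t @^-1` O) = V.
  apply: connV.
  - by exists (H t y0); split=> //=; rewrite K1.
  - by exists (G t @^-1` O) => //; apply: open_comp => // ? _; exact: cGt.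
  - exists (G t @^-1` B); first by apply: closed_comp => // ? _; exact: cGt.
    apply/seteqP; split=> y [Vy Hy]; split=> //; first exact: OB.
    by apply: NV_ => //; rewrite K2.
have [_ [dG oG]] : (V `&` (G t @^-1` O)) x by rewrite E.
have [_ Nx _] := rH _ (ltW oG).
by move: Nx; rewrite cmapK.
Qed.

Lemma isotopic_inv h h' g g' : isotopic R h h' ->
  (forall x, g (h x) = x) -> (forall x, h (g x) = x) ->
  (forall x, g' (h' x) = x) -> (forall x, h' (g' x) = x) -> isotopic R g g'.
Proof.
move=> /isotopyP[H [iH H0 H1]] K1 K2 K1' K2'.
have /choice[G HG] : forall t, exists g : X -> X,
    (forall x, g (H t x) = x) /\ (forall x, H t (g x) = x).
  by move=> t; have [_ /(_ t)[k [_ _ L1 L2]]] := iH; exists k.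
apply/isotopyP; exists G; split.
- by apply: (isotopy_inv iH) => t x; case: (HG t).
- by apply/funext => x; have [L1 L2] := HG 0; rewrite -{1}(K2 x) -H0 L1.
- by apply/funext => x; have [L1 L2] := HG 1; rewrite -{1}(K2' x) -H1 L1.
Qed.

Lemma bchart_interior (S : set X) c x : bchart S c -> cdom c x -> S x ->
  (cmap c x).2 <> 0 -> interior S x.
Proof.
move=> bc cx Sx n0.
have [oc [W [oW EW]] [cc ci _ im [K1 K2]]] := bc.
have : (cmap c @` (cdom c `&` S)) (cmap c x) by exists x.
rewrite EW => -[Wx]; rewrite /upper_half_plane /= => ge0.
have gt0 : 0 < (cmap c x).2 by rewrite lt_def ge0 andbT; exact/eqP.
have : nbhs (cmap c x) (W `&` [set z | 0 < z.2]).
  apply: filterI; first exact: open_nbhs_nbhs.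
  have cs : continuous (fun z : R * R => z.2) by ct.
  exact: (cs (cmap c x) _ (lt_nbhsr gt0 : nbhs _ [set x | 0 < x])).
move=> /nbhs_disk[r r0 rD].
have rW z : closed_disk (cmap c x) r z -> (cmap c @` (cdom c `&` S)) z.
  by move=> /rD[Wz z0]; rewrite EW; split=> //; exact: ltW.
have := @invdom_plane (cinv c) (cmap c x) r r0.
rewrite K1// => N; apply: (@filterS _ (nbhs x) _ _ _ _ (N _ _)).
- by move=> _ [z /rW Dz <-]; have [_] : (cdom c `&` S) (cinv c z) by apply: im; exists z.
- exact: continuous_subspaceW ci.
- by move=> a b /rW Da /rW Db E; rewrite -(K2 _ Da) -(K2 _ Db) E.
Qed.

(** Frees the boundary from the choice of charts. At a point of height [0] interior to [S], a
    boundary chart would restrict to an embedding of a disk, and its image would reach below the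
    axis. *)
Lemma sbdE (S : set X) : bsurface R S -> sbd R S = S `\` interior S.
Proof.
move=> [_ chS]; apply/seteqP; split=> x.
  move=> [Sx [c [[oc [W [oW EW]] [cc ci im _ [K1 K2]]] cx c0]]]; split=> // Si.
  have [d [cd dx]] := chart_at x.
  have Nc : nbhs x (interior S `&` cdom c).
    by apply: filterI; [exact: nbhs_interior|exact: open_nbhs_nbhs].
  have [r r0 [cid _ rH]] := chart_disk cd dx Nc.
  have rS z : closed_disk (cmap d x) r z -> (cdom c `&` S) (cinv d z).
    by move=> /rH[_ [Sz cz] _]; split=> //; exact: interior_subset.
  have em : emb (cmap c \o cinv d) (cmap d x) r.
    split=> //.
      apply/subspace_continuousP => a Da N Na.
      move/subspace_continuousP: cc => /(_ _ (rS _ Da) _ Na) M.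
      move/subspace_continuousP: cid => /(_ _ Da _ M); rewrite /within /=.
      by apply: (@filterS _ (nbhs a)) => b Hb Db; apply: Hb => //; exact: rS.
    move=> a b Da Db /= E; have [_ _ Ea] := rH _ Da; have [_ _ Eb] := rH _ Db.
    by rewrite -Ea -Eb -(K1 _ (rS _ Da)) E K1//; exact: rS.
  have := invariance_of_domain em; rewrite /= cmapK// => /nbhs_disk[s s0 sD].
  (* The point straight below the image lies on the rim of the covered disk but outside the half
     plane. *)
  have [|z Dz Ez] := sD ((cmap c x).1, (cmap c x).2 - s).
    rewrite /closed_disk /= subrr expr0n /= add0r.
    by rewrite addrAC subrr add0r sqrrN.
  have : (cmap c @` (cdom c `&` S)) (cmap c (cinv d z)).
    by exists (cinv d z) => //; exact: rS.
  rewrite EW => -[_]; rewrite /upper_half_plane /= in Ez *.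
  by rewrite Ez /= c0; lra.
move=> [Sx nSi]; split=> //; have [c [bc cx]] := chS x Sx.
exists c; split=> //; apply: contrapT => n0; apply: nSi.
exact: bchart_interior bc cx Sx n0.
Qed.

Lemma setD_sbd (S : set X) : bsurface R S -> S `\` sbd R S = interior S.
Proof.
move=> bS; rewrite (sbdE bS) setDD; apply/seteqP; split=> y; first by case.
by move=> iy; split=> //; exact: interior_subset.
Qed.

End SurfaceMaps.

(** * Local degree on an oriented surface *)

Section Orientation.
Variables (R : realType) (X : topologicalType) (O : set (chart R X)).
Hypothesis surfX : surface R X.
Hypothesis orO : is_orientation O.
Implicit Types (c d e : chart R X) (x y : X) (z p q : R * R) (f g h : X -> X).

Lemma O_chart c : O c -> is_chart c. Proof. by case: orO => H _ _ /H. Qed.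

Lemma O_cover x : exists c, O c /\ cdom c x. Proof. by case: orO. Qed.

Lemma O_transition c d x : O c -> O d -> cdom c x -> cdom d x ->
  deg (cmap d \o cinv c) (cmap c x) 1.
Proof.
case: orO => _ _ H Oc Od cx dx.
by apply: loc_orient_pres_deg; apply: (H c d) => //; exists x.
Qed.

Lemma chart_nbhs c x (N : set X) : is_chart c -> cdom c x -> nbhs x N ->
  \forall z \near cmap c x, N (cinv c z) /\ cmap c (cinv c z) = z.
Proof.
move=> cc cx Nx; have [r r0 [_ _ H]] := chart_disk cc cx Nx.
by apply: (@filterS _ (nbhs (cmap c x)) _ _ _ _ (disk_nbhs _ r0)) => z /H[].
Qed.

Lemma chart_image_nbhs c x (N : set X) : is_chart c -> cdom c x -> nbhs x N ->
  nbhs (cmap c x) (cmap c @` (cdom c `&` N)).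
Proof.
move=> cc cx Nx; have [_ Nc] := chart_continuous cc cx.
apply: (@filterS _ (nbhs (cmap c x)) _ _ _ _ (chart_nbhs cc cx (filterI Nc Nx))).
by move=> z [H E]; exists (cinv c z).
Qed.

Definition chart_deg f x (m : int) c d :=
  deg (cmap d \o f \o cinv c) (cmap c x) m.

(** One pair of charts is enough because transition maps have degree [1], see [odeg_chart];
    continuity at [x] is recorded so that the target chart can be changed. *)
Definition odeg f x (m : int) := {for x, continuous f} /\
  exists c d, [/\ O c, O d, cdom c x, cdom d (f x) & chart_deg f x m c d].

Lemma odeg_chart f x m c d : odeg f x m -> O c -> O d -> cdom c x ->
  cdom d (f x) -> chart_deg f x m c d.
Proof.
move=> [cf [c0 [d0 [Oc0 Od0 cx0 dx0 H]]]] Oc Od cx dx.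
have T1 := O_transition Oc Oc0 cx cx0.
have T2 := O_transition Od0 Od dx0 dx.
have E1 : (cmap c0 \o cinv c) (cmap c x) = cmap c0 x.
  by rewrite /= (cmapK (O_chart Oc)).
have E2 : (cmap d0 \o f \o cinv c0) (cmap c0 x) = cmap d0 (f x).
  by rewrite /= (cmapK (O_chart Oc0)).
rewrite -[m]mulr1 -[m]mul1r.
have := @deg_comp _ _ _ _ _ _ T1; rewrite E1 => /(_ _ _ H) C1.
have := @deg_comp _ _ _ _ _ _ C1; rewrite /= (cmapK (O_chart Oc)) // (cmapK (O_chart Oc0))//.
move=> /(_ _ _ T2); rewrite mulrA mul1r => /deg_eq_near; apply.
have [_ Nc0] := chart_continuous (O_chart Oc0) cx0.
have [_ Nd0] := chart_continuous (O_chart Od0) dx0.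
have N : nbhs x (cdom c0 `&` (f @^-1` cdom d0)).
  by apply: filterI => //; exact: cf.
apply: (@filterS _ (nbhs (cmap c x)) _ _ _ _ (chart_nbhs (O_chart Oc) cx N)).
move=> z [[c0z d0z] _] /=.
by rewrite (cmapK (O_chart Oc0) c0z) (cmapK (O_chart Od0) d0z).
Qed.

Lemma odeg_unique f x m k : odeg f x m -> odeg f x k -> m = k.
Proof.
move=> fm [_ [c [d [Oc Od cx dx H]]]].
exact: deg_unique (odeg_chart fm Oc Od cx dx) H.
Qed.

Lemma chart_emb f x (A : set X) c d : is_chart c -> is_chart d -> cdom c x ->
  cdom d (f x) -> nbhs x A -> {within A, continuous f} ->
  (forall a b, A a -> A b -> f a = f b -> a = b) ->
  exists2 r, emb (cmap d \o f \o cinv c) (cmap c x) r &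
   forall z, closed_disk (cmap c x) r z ->
     [/\ cdom c (cinv c z), (A `&` (f @^-1` cdom d)) (cinv c z) & cmap c (cinv c z) = z].
Proof.
move=> cc cd cx dx NA cf fi.
have [_ Nd] := chart_continuous cd dx.
have N : nbhs x (A `&` (f @^-1` cdom d)).
  by apply: filterI => //; exact: (within_continuous_at cf NA).
have [r r0 [ci rD H]] := chart_disk cc cx N.
exists r => //; split=> //.
  apply/subspace_continuousP => a Da M Ma.
  have [_ [Aa da] _] := H _ Da.
  have [cda _] := chart_continuous cd da.
  move/subspace_continuousP: cf => /(_ _ Aa _ (cda _ Ma)) Mb.
  move/subspace_continuousP: ci => /(_ a Da _ Mb); rewrite /within /=.
  by apply: (@filterS _ (nbhs a)) => b Hb Db; apply: Hb => //; have [_ []] := H _ Db.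
move=> a b /H[_ [Aa da] Ea] /H[_ [Ab db] Eb] /= E.
rewrite -Ea -Eb; congr cmap; apply: fi => //.
by rewrite -(cmapK cd da) E cmapK.
Qed.

Lemma odeg_exists f x (A : set X) : nbhs x A -> {within A, continuous f} ->
  (forall a b, A a -> A b -> f a = f b -> a = b) -> exists m, odeg f x m.
Proof.
move=> NA cf fi; have [c [Oc cx]] := O_cover x; have [d [Od dx]] := O_cover (f x).
have [r e _] := chart_emb (O_chart Oc) (O_chart Od) cx dx NA cf fi.
have [m Hm] := deg_exists e.
exists m; split; first exact: within_continuous_at cf NA.
by exists c, d.
Qed.

Lemma odeg_id x : odeg id x 1.
Proof.
have [c [Oc cx]] := O_cover x; split; first exact: cvg_id.
by exists c, c; split=> //; exact: O_transition.
Qed.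

Lemma odeg_comp f g x m k : odeg f x m -> odeg g (f x) k -> odeg (g \o f) x (k * m).
Proof.
move=> fm gk; have [cf [c [d [Oc Od cx dx H]]]] := fm.
have [cg _] := gk.
split; first exact: continuous_comp.
have [e [Oe ex]] := O_cover (g (f x)).
exists c, e; split=> //.
have K := odeg_chart gk Od Oe dx ex.
have := @deg_comp _ _ _ _ _ _ H; rewrite /= (cmapK (O_chart Oc)) // => /(_ _ _ K).
move/deg_eq_near; apply.
have [_ Nd] := chart_continuous (O_chart Od) dx.
have N : nbhs x (f @^-1` cdom d) by exact: cf.
apply: (@filterS _ (nbhs (cmap c x)) _ _ _ _ (chart_nbhs (O_chart Oc) cx N)).
by move=> z [dz _] /=; rewrite (cmapK (O_chart Od) dz).
Qed.

Lemma odeg_eq_near f g x m : odeg f x m -> (\forall y \near x, f y = g y) ->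
  odeg g x m.
Proof.
move=> [cf [c [d [Oc Od cx dx H]]]] E; have Ex := nbhs_singleton E.
split.
  move=> N Ng; have Nf : nbhs (f x) N by rewrite Ex.
  have : nbhs x ([set y | f y = g y] `&` (f @^-1` N)) by exact: filterI E (cf _ Nf).
  apply: (@filterS _ (nbhs x)) => y [Ey Ny].
  by have : N (f y) := Ny; rewrite Ey.
exists c, d; rewrite -Ex; split=> //.
apply: (deg_eq_near H).
apply: (@filterS _ (nbhs (cmap c x)) _ _ _ _ (chart_nbhs (O_chart Oc) cx E)).
by move=> z [Ez _] /=; rewrite Ez.
Qed.

Lemma odeg_near f x (A : set X) m : open A -> A x -> {within A, continuous f} ->
  (forall a b, A a -> A b -> f a = f b -> a = b) -> odeg f x m ->
  \forall y \near x, odeg f y m.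
Proof.
move=> oA Ax cf fi [_ [c [d [Oc Od cx dx H]]]].
have NA : nbhs x A by exact: open_nbhs_nbhs.
have [r e rH] := chart_emb (O_chart Oc) (O_chart Od) cx dx NA cf fi.
have [r0 _ _] := e.
have [cmx Nc] := chart_continuous (O_chart Oc) cx.
have Nd : nbhs x (f @^-1` cdom d).
  apply: (within_continuous_at cf NA).
  by have [] := chart_continuous (O_chart Od) dx.
have r20 : 0 < r / 2 by rewrite divr_gt0.
have : nbhs x (A `&` (f @^-1` cdom d) `&`
   (cdom c `&` (cmap c @^-1` closed_disk (cmap c x) (r / 2)))).
  do 2 apply: filterI => //.
  by apply: cmx; exact: disk_nbhs.
apply: (@filterS _ (nbhs x)) => y [[Ay dy] [cy Dy]].
split; first by apply: (within_continuous_at cf); exact: open_nbhs_nbhs.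
exists c, d; split=> //; apply: (deg_near e H).
apply: le_lt_trans Dy _.
by rewrite ltr_pXn2r ?nnegrE ?(ltW r20) ?(ltW r0)//; lra.
Qed.

Lemma locally_const_01 (P : R -> Prop) :
  (forall t0, exists2 e : R, 0 < e & forall s t, ball t0 e s -> ball t0 e t -> P s -> P t) ->
  P 0 -> P 1.
Proof.
move=> H P0.
have o (Q : R -> Prop) : (forall t0, exists2 e : R, 0 < e &
    forall s t, ball t0 e s -> ball t0 e t -> Q s -> Q t) -> open [set t | Q t].
  move=> HQ; rewrite openE => t Qt; have [e e0 He] := HQ t.
  apply/nbhs_ballP; exists e => //= s ts; apply: (He t s) => //; exact: ballxx.
have oP := o _ H.
have onP : open [set t | ~ P t].
  apply: o => t0; have [e e0 He] := H t0; exists e => // s t bs bt nPs Pt.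
  by apply: nPs; exact: (He t s).
have : `[(0 : R), 1]%classic `&` [set t | P t] = `[(0 : R), 1]%classic.
  apply: segment_connected.
  - by exists 0; split=> //=; rewrite in_itv /= lexx ler01.
  - by exists [set t | P t].
  - exists (~` [set t | ~ P t]); first exact: open_closedC.
    by apply/seteqP; split=> t [t01 Pt]; split=> //= ; exact: contrapT.
have i1 : `[(0 : R), 1]%classic 1 by rewrite /= in_itv /= ler01 lexx.
by move=> E; move: i1; rewrite -E => -[].
Qed.

(** For times close to [t0] one pair of charts and one disk serve simultaneously, so interpolating
    linearly between two such times gives a homotopy of planar embeddings. *)
Lemma odeg_isotopy (H : R -> X -> X) x m : isotopy H -> odeg (H 0) x m ->
  odeg (H 1) x m.
Proof.
move=> iH; apply: (@locally_const_01 (fun t => odeg (H t) x m)) => t0.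
have [cH hH] := iH.
have [c [Oc cx]] := O_cover x; have [d [Od dx]] := O_cover (H t0 x).
have [_ Nd] := chart_continuous (O_chart Od) dx.
have [[A1 A2] /= [/nbhs_ballP[e /= e0 eA] NA2] AH] : nbhs (t0, x) [set u : R * X | cdom d (H u.1 u.2)].
  exact: (cH (t0, x)).
exists e => // s t bs bt Hs.
have [r r0 [ci rD rH]] := chart_disk (O_chart Oc) cx NA2.
have cst t' : continuous (H t') by exact: homeo_continuous.
split; first exact: cst.
have dH u y : ball t0 e u -> A2 y -> cdom d (H u y).
  by move=> bu Ay; apply: (AH (u, y)); split=> //; exact: eA.
have A2x : A2 x by exact: nbhs_singleton.
exists c, d; split=> //; first exact: dH.
pose G u := cmap d \o H ((1 - u) * s + u * t) \o cinv c.
have bu u : 0 <= u <= 1 -> ball t0 e ((1 - u) * s + u * t).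
  move=> /andP[u0 u1]; move: bs bt; rewrite /ball /= => bs bt.
  have -> : t0 - ((1 - u) * s + u * t) = (1 - u) * (t0 - s) + u * (t0 - t) by ring.
  apply: le_lt_trans (ler_normD _ _) _; rewrite !normrM (ger0_norm u0) (@ger0_norm _ (1 - u)) ?subr_ge0//.
  have [->|uN] := eqVneq u 0; first by rewrite subr0 mul1r mul0r addr0.
  have h1 : u * `|t0 - t| < u * e by rewrite ltr_pM2l// lt_def uN.
  have h2 : (1 - u) * `|t0 - s| <= (1 - u) * e by rewrite ler_wpM2l ?subr_ge0// ltW.
  lra.
suff : deg (G 1) (cmap c x) m.
  by rewrite /G subrr mul0r mul1r add0r.
apply: (@deg_homotopy _ G _ r m r0).
- move=> u u01; split=> //.
    apply/subspace_continuousP => a Da M Ma.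
    have [_ Aa _] := rH _ Da.
    have [cda _] := chart_continuous (O_chart Od) (dH _ _ (bu _ u01) Aa).
    have Mb := cst _ _ _ (cda _ Ma).
    move/subspace_continuousP: ci => /(_ a Da _ Mb); rewrite /within /=.
    by apply: (@filterS _ (nbhs a)) => b Hb Db; exact: Hb.
  move=> a b /rH[_ Aa Ea] /rH[_ Ab Eb] /= E; rewrite -Ea -Eb; congr cmap.
  apply: (homeo_inj (hH ((1 - u) * s + u * t))).
  have {}E : cmap d (H ((1 - u) * s + u * t) (cinv c a)) =
    cmap d (H ((1 - u) * s + u * t) (cinv c b)) := E.
  by rewrite -(cmapK (O_chart Od) (dH _ _ (bu _ u01) Aa)) E cmapK//;
    [exact: O_chart|apply: dH => //; exact: bu].
- apply/subspace_continuousP => -[u a] /= [u01 Da] M Ma.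
  have [_ Aa _] := rH _ Da.
  have [cda _] := chart_continuous (O_chart Od) (dH _ _ (bu _ u01) Aa).
  have := cda _ Ma.
  have cL : continuous (fun v : R * X => H ((1 - v.1) * s + v.1 * t) v.2).
    by apply: isotopy_continuous => //; ct.
  move=> /(cL (u, cinv c a)) [[B1 B2] /= [NB1 NB2] BM].
  move/subspace_continuousP: ci => /(_ a Da _ NB2); rewrite /within /= => NB.
  exists (B1, [set b | closed_disk (cmap c x) r b -> B2 (cinv c b)]) => //=.
  move=> [v b] /= [Bv Bb] [_ Db].
  by apply: (BM (v, cinv c b)); split=> //; exact: Bb.
- by rewrite /G subr0 mul0r mul1r addr0; exact: (odeg_chart Hs Oc Od cx (dH _ _ bs A2x)).
Qed.

Lemma orient_pres_onP (A : set X) h : open A -> {within A, continuous h} ->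
  orient_pres_on O A h <-> (forall x, A x -> odeg h x 1).
Proof.
move=> oA ch; split=> H.
  move=> x Ax; have NA : nbhs x A by exact: open_nbhs_nbhs.
  split; first exact: within_continuous_at ch NA.
  have [c [Oc cx]] := O_cover x; have [d [Od dx]] := O_cover (h x).
  by exists c, d; split=> //; apply: loc_orient_pres_deg; exact: H.
move=> c d x Oc Od Ax cx dx.
apply: deg_loc_orient_pres; last exact: (odeg_chart (H x Ax)).
rewrite -setIA; apply: chart_image_nbhs => //; first exact: O_chart.
apply: filterI; first exact: open_nbhs_nbhs.
have [ch' _] := H x Ax; apply: ch'.
by have [] := chart_continuous (O_chart Od) dx.
Qed.

Lemma MF_repP h : MF_rep O h <-> homeo h /\ forall x, odeg h x 1.
Proof.
rewrite /MF_rep; split=> [[hh oh]|[hh oh]].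
  have {}hh := (homeoP h).1 hh; split=> // x.
  apply: (orient_pres_onP openT _).1 => //.
  by apply: continuous_subspaceT; exact: homeo_continuous.
split; first exact/homeoP.
apply/orient_pres_onP => //; first exact: openT.
by apply: continuous_subspaceT; exact: homeo_continuous.
Qed.

Lemma MF_rep_id : MF_rep O id.
Proof. by apply/MF_repP; split; [exact: homeo_id|move=> x; exact: odeg_id]. Qed.

Lemma MF_rep_comp f g : MF_rep O f -> MF_rep O g -> MF_rep O (f \o g).
Proof.
move=> /MF_repP[hf of_] /MF_repP[hg og]; apply/MF_repP; split.
  exact: homeo_comp.
by move=> x; rewrite -[1]mulr1; exact: odeg_comp.
Qed.

(** Multiplicativity along [f \o g], which is the identity, forces the degree of [g] to be [1]. *)
Lemma MF_rep_inv f g : MF_rep O f -> (forall x, g (f x) = x) ->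
  (forall x, f (g x) = x) -> MF_rep O g.
Proof.
move=> /MF_repP[hf of_] K1 K2; apply/MF_repP.
have hg := homeo_inv hf K1 K2; split=> // x.
have [m gm] : exists m, odeg g x m.
  apply: (@odeg_exists _ _ setT); first exact: filterT.
    by apply: continuous_subspaceT; exact: homeo_continuous.
  by move=> a b _ _; exact: homeo_inj.
have := odeg_comp gm (of_ (g x)); rewrite mul1r => fg.
have <- : m = 1; last by [].
apply: odeg_unique fg _; apply: odeg_eq_near (odeg_id x) _.
by apply: (@filterE _ (nbhs x)) => y; rewrite /= K2.
Qed.

Lemma MF_rep_isotopic f g : MF_rep O f -> isotopic R f g -> MF_rep O g.
Proof.
move=> /MF_repP[hf of_] i; have [_ hg] := isotopic_homeo i; apply/MF_repP.
split=> // x; have /isotopyP[H [iH H0 H1]] := i.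
by rewrite -H1; apply: odeg_isotopy => //; rewrite H0.
Qed.

End Orientation.

(** * Collars of the pipes *)

Section Extension.
Variables (R : realType) (X : topologicalType).
Hypothesis surfX : surface R X.

(** Surjectivity comes from the intermediate value theorem on [[v - C, v + C]]. The lemma inverts
    all fibrewise pushes and twists; continuity of the inverse is supplied later by [bij_homeo]. *)
Lemma near_id_bij (m : R -> R) (C : R) : continuous m ->
  (forall u v, u < v -> m u < m v) -> (forall u, `|m u - u| <= C) ->
  exists m' : R -> R, (forall u, m' (m u) = u) /\ (forall v, m (m' v) = v).
Proof.
move=> cm lt_m bm.
have C0 : 0 <= C by apply: le_trans (bm 0); exact: normr_ge0.
have /choice[m' Hm'] : forall v, exists u, m u = v.
  move=> v; have := bm (v - C); have := bm (v + C); rewrite !ler_norml => /andP[h1 h2] /andP[h3 h4].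
  have le1 : v - C <= v + C by lra.
  have [|u _ Eu] := @IVT R m (v - C) (v + C) v le1 (continuous_subspaceT cm).
    rewrite ge_min le_max; apply/andP; split; apply/orP; [left|right]; lra.
  by exists u.
exists m'; split=> // u; case: (ltgtP (m' (m u)) u) => // /lt_m; rewrite Hm' ltxx//.
Qed.

Lemma paste_continuous (T U : topologicalType) (k : T -> R) (f g : T -> U) :
  continuous k -> continuous f -> continuous g -> (forall x, k x = 0 -> f x = g x) ->
  continuous (fun x => if 0 <= k x then f x else g x).
Proof.
move=> ck cf cg E x N; case: (ltgtP (k x) 0) => kx NN.
- have kN : nbhs x [set y | k y < 0].
    by have := ck x _ (lt_nbhsl kx : nbhs _ [set t | t < 0]).
  have gN : nbhs x (g @^-1` N) by exact: (cg x N NN).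
  apply: filterS (filterI gN kN) => y [Ny ky].
  by rewrite /= leNgt ky.
- have kN : nbhs x [set y | 0 < k y].
    by have := ck x _ (lt_nbhsr kx : nbhs _ [set t | 0 < t]).
  have fN : nbhs x (f @^-1` N) by exact: (cf x N NN).
  apply: filterS (filterI fN kN) => y [Ny ky].
  by rewrite /= (ltW ky).
- have fN : nbhs x (f @^-1` N) by exact: (cf x N NN).
  have gN : nbhs x (g @^-1` N) by apply: cg; rewrite -E.
  by apply: filterS (filterI fN gN) => y [Ny ky] /=; case: ifP.
Qed.

(* A fibre-preserving isotopy of the plane, supported over a closed set,
   descends along an open map [e] and extends by the identity. *)
Lemma extend_isotopy (e : R * R -> X) (phi psi : R -> R * R -> R * R)
    (C : set (R * R)) :
  continuous e -> (forall z N, nbhs z N -> nbhs (e z) (e @` N)) ->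
  (forall t z w, e z = e w -> e (phi t z) = e (phi t w)) ->
  (forall t z w, e z = e w -> e (psi t z) = e (psi t w)) ->
  continuous (fun v : R * (R * R) => phi v.1 v.2) ->
  (forall t z, e (phi t (psi t z)) = e z) -> (forall t z, e (psi t (phi t z)) = e z) ->
  closed (e @` C) -> (forall t z, ~ C z -> phi t z = z) ->
  exists H : R -> X -> X, [/\ isotopy H, forall t z, H t (e z) = e (phi t z) &
    forall t x, (forall z, e z <> x) -> H t x = x].
Proof.
move=> ce oe Ephi Epsi cphi K1 K2 clC supp.
pose ext (f : R -> R * R -> R * R) t x :=
  match pselect (exists z, e z = x) with
  | left ex => e (f t (projT1 (cid ex))) | right _ => x end.
have extE (f : R -> R * R -> R * R) t z : (forall t z w, e z = e w -> e (f t z) = e (f t w)) ->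
    ext f t (e z) = e (f t z).
  move=> Ef; rewrite /ext; case: pselect => [ex|[]]; last by exists z.
  by apply: Ef; case: (cid ex).
have extN f t x : (forall z, e z <> x) -> ext f t x = x.
  by move=> Nx; rewrite /ext; case: pselect => // -[z Ez]; case: (Nx z Ez).
have K1' t x : ext phi t (ext psi t x) = x.
  have [[z <-]|nz] := pselect (exists z, e z = x); first by rewrite !extE// K1.
  by rewrite !extN// => z Ez; apply: nz; exists z.
have K2' t x : ext psi t (ext phi t x) = x.
  have [[z <-]|nz] := pselect (exists z, e z = x); first by rewrite !extE// K2.
  by rewrite !extN// => z Ez; apply: nz; exists z.
have cext : continuous (fun v : R * X => ext phi v.1 v.2).
  move=> [t x] N /= NN; have [[z Ez]|nz] := pselect (exists z, e z = x).
    have ceph : continuous (fun v : R * (R * R) => e (phi v.1 v.2)).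
      exact: (continuous_compose ce cphi).
    have NN' : nbhs (e (phi t z)) N by rewrite -extE// Ez.
    have [[A B] /= [NA NB] AB] : nbhs (t, z) [set v : R * (R * R) | N (e (phi v.1 v.2))].
      exact: (ceph (t, z)).
    exists (A, e @` B) => /=; first by split=> //; rewrite -Ez; exact: oe.
    move=> [s y] /= [As [w Bw <-]]; rewrite extE//; exact: (AB (s, w)).
  have Ex : ext phi t x = x by apply: extN => z Ez; apply: nz; exists z.
  exists (setT, N `&` ~` (e @` C)) => /=.
    split; first exact: filterT.
    apply: filterI; first by rewrite -Ex.
    apply: open_nbhs_nbhs; split; first exact: closed_openC.
    by move=> [z _ Ez]; apply: nz; exists z.
  move=> [s y] /= [_ [Ny nC]].
  have [[z Ez]|nz'] := pselect (exists z, e z = y).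
    rewrite -Ez extE// supp ?Ez// => Cz; apply: nC; exists z => //.
  by rewrite extN// => z Ez; apply: nz'; exists z.
exists (ext phi); split; [|by move=> t z; rewrite extE|exact: extN].
split=> // t; apply: (bij_homeo surfX _ (K2' t) (K1' t)).
by apply: (continuous_compose cext (f := fun x => (t, x))); ct.
Qed.

End Extension.

(** * Cylinder coordinates near the boundary of a pipe *)

Section Coordinates.
Variables (R : realType) (X : topologicalType).
Hypothesis surfX : surface R X.

Definition cis (t : R) : R * R := (cos t, sin t).

Lemma cis_unit t : @unit_circle R (cis t).
Proof. by rewrite /unit_circle /= cos2Dsin2. Qed.

Lemma cis_continuous : continuous cis.
Proof. by rewrite /cis; ct. Qed.

Lemma cis_periodic t (k : int) : cis (t + 2 * pi * k%:~R) = cis t.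
Proof. by rewrite /cis cosD2piz sinD2piz. Qed.

Lemma cis_inj s t : cis s = cis t -> exists k : int, s = t + 2 * pi * k%:~R.
Proof.
move=> E; apply: (@ang_mod _ (cis s)).
  by exists 1; rewrite !mul1r.
by exists 1; rewrite !mul1r E.
Qed.

Lemma cis_surj b : @unit_circle R b -> exists t, b = cis t.
Proof.
rewrite /unit_circle /= => b1.
have : b != 0.
  by apply/eqP => b0; move: b1; rewrite b0 /= expr0n /= addr0 => /eqP; rewrite eq_sym oner_eq0.
move=> /ang_exists[t /ang_norm]; rewrite /dot -!expr2 b1 sqrtr1 !mul1r => ->.
by exists t.
Qed.

Lemma unit_circleE : @unit_circle R = cis @` `[0, 2 * pi].
Proof.
apply/seteqP; split=> [b /cis_surj[t ->]|_ [t _ <-]]; last exact: cis_unit.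
have [k /andP[h1 h2]] := period_reduce t.
exists (t + 2 * pi * k%:~R); last exact: cis_periodic.
by rewrite /= in_itv /= h1 ltW.
Qed.

Lemma unit_circle1 : @unit_circle R (1, 0).
Proof. by rewrite /unit_circle /= expr1n expr0n /= addr0. Qed.

Lemma unit_circle_compact : compact (@unit_circle R).
Proof.
rewrite unit_circleE; apply: continuous_compact; last exact: segment_compact.
by apply: continuous_subspaceT; exact: cis_continuous.
Qed.

Lemma unit_circle_connected : connected (@unit_circle R).
Proof.
rewrite unit_circleE; apply: connected_continuous_connected; first exact: segment_connected.
by apply: continuous_subspaceT; exact: cis_continuous.
Qed.

Lemma homeomorphic_image (T U : topologicalType) (A : set T) (B : set U) f g :
  homeo_pair A B f g -> A = g @` B.
Proof.
move=> [_ _ fA gB [K1 K2]]; apply/seteqP; split=> [x Ax|x]; last exact: gB.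
by exists (f x); [apply: fA; exists x|rewrite K1].
Qed.

Lemma homeomorphic_circle (A : set X) : homeomorphic A (@unit_circle R) ->
  compact A /\ connected A.
Proof.
move=> [f [g fg]]; rewrite (homeomorphic_image fg); have [_ cg _ _ _] := fg; split.
  by apply: continuous_compact => //; exact: unit_circle_compact.
by apply: connected_continuous_connected => //; exact: unit_circle_connected.
Qed.

Variables (S Ua : set X) (f : X -> (R * R) * R) (g : (R * R) * R -> X).
Hypotheses (bS : bsurface R S) (fg : homeo_pair Ua (@half_cylinder R) f g)
  (oU : exists V, open V /\ Ua = V `&` S).

(** The covering of the cylinder by a half plane, made total by collapsing negative heights onto the
    boundary circle. *)
Definition cyl (z : R * R) : X := g (cis z.1, Num.max 0 z.2).

Lemma cyl_in z : @half_cylinder R (cis z.1, Num.max 0 z.2).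
Proof. by split; [exact: cis_unit|rewrite /= le_max lexx]. Qed.

Lemma cyl_continuous : continuous cyl.
Proof.
have [_ cg _ _ _] := fg.
apply: (within_comp_continuous cg); last exact: cyl_in.
by have := cis_continuous => ?; ct.
Qed.

Lemma cyl_U z : Ua (cyl z).
Proof.
by have [_ _ _ gU _] := fg; apply: gU; exists (cis z.1, Num.max 0 z.2) => //; exact: cyl_in.
Qed.

Lemma cylK z : 0 <= z.2 -> f (cyl z) = (cis z.1, z.2).
Proof.
by move=> z0; have [_ _ _ _ [_ K2]] := fg; rewrite /cyl K2; [rewrite max_r|exact: cyl_in].
Qed.

Lemma cyl_surj x : Ua x -> exists z, 0 <= z.2 /\ x = cyl z.
Proof.
have [_ _ fU _ [K1 _]] := fg.
move=> Ux; have [/cis_surj[t Et] u0] : @half_cylinder R (f x) by apply: fU; exists x.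
exists (t, (f x).2); split=> //; rewrite /cyl /= max_r// -Et.
by rewrite -[LHS]K1//; congr g; case: (f x).
Qed.

Lemma cyl_inj z w : 0 <= z.2 -> 0 <= w.2 -> cyl z = cyl w ->
  z.2 = w.2 /\ exists k : int, z.1 = w.1 + 2 * pi * k%:~R.
Proof.
move=> z0 w0 E; have := cylK z0; rewrite E cylK// => -[E1 E2 E3]; split=> //.
by apply: cis_inj; rewrite /cis E1 E2.
Qed.

Lemma cyl_interior z : 0 < z.2 -> interior S (cyl z).
Proof.
move=> z0; pose r := Num.min (z.2 / 2) 1.
have r0 : 0 < r by rewrite lt_min divr_gt0//=.
have rz : r <= z.2 / 2 by rewrite ge_min lexx.
have r1 : r <= 1 by rewrite ge_min lexx orbT.
have D w : closed_disk z r w -> `|w.1 - z.1| <= r /\ 0 <= w.2.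
  by move=> /(disk_coord (ltW r0))[h]; rewrite ler_norml => /andP[? ?]; split=> //; lra.
have := @invdom_plane R X surfX cyl z r r0.
move=> H; apply: (@filterS _ (nbhs (cyl z)) _ _ _ _ (H _ _)).
- move=> _ [w _ <-]; have := cyl_U w; case: oU => V [_ ->]; by case.
- by apply: continuous_subspaceT; exact: cyl_continuous.
- move=> a b /D[a1 a2] /D[b1 b2] /cyl_inj[||E2 [k /period_close E1]] //.
  rewrite (pairE a) (pairE b) E2 E1//.
  by move: a1 b1; rewrite !ler_norml => /andP[? ?] /andP[? ?]; apply/andP; split; lra.
Qed.

(** Near the direction [b] the circle is parametrised by [crs b], which together with the height
    embeds a neighbourhood in the upper half plane. For an interior point, invariance of domain
    would yield negative heights. *)
Lemma cyl_boundary z : z.2 = 0 -> ~ interior S (cyl z).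
Proof.
move=> z0 Si; set x := cyl z.
have [cf _ fU _ [K1 _]] := fg; have [V [oV EU]] := oU.
have UN : nbhs x Ua.
  rewrite EU; apply: filterI => //; apply: open_nbhs_nbhs; split=> //.
  by have := cyl_U z; rewrite EU => -[].
pose b := cis z.1; have fx : f x = (b, 0) by rewrite cylK ?z0.
have cfx := within_continuous_at cf UN.
have cdt : continuous (fun v : (R * R) * R => dot b v.1) by rewrite /dot; ct.
have bb : b.1 * b.1 + b.2 * b.2 = 1 by rewrite -!expr2 /= cos2Dsin2.
have d0 : 0 < dot b (f x).1 by rewrite fx /dot bb.
have N : nbhs x (Ua `&` [set y | 0 < dot b (f y).1]).
  apply: filterI => //.
  exact: (cfx _ (cdt _ _ (lt_nbhsr d0 : nbhs _ [set t | 0 < t]))).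
have [c [cc cx]] := chart_at surfX x.
have [r r0 [ci _ rH]] := chart_disk cc cx N.
pose E w := (crs b (f (cinv c w)).1, (f (cinv c w)).2).
have em : emb E (cmap c x) r.
  split=> //.
    apply/subspace_continuousP => a Da M Ma.
    have [_ [Uy _] _] := rH _ Da.
    have ck : continuous (fun v : (R * R) * R => (crs b v.1, v.2)) by rewrite /crs; ct.
    have := ck _ _ Ma => Ma'.
    move/subspace_continuousP: cf => /(_ _ Uy _ Ma') Mb.
    move/subspace_continuousP: ci => /(_ a Da _ Mb); rewrite /within /=.
    apply: (@filterS _ (nbhs a)) => a' Hb Db; apply: Hb => //.
    by have [_ []] := rH _ Db.
  move=> a a' /rH[_ [Ua0 da] Ea] /rH[_ [Ub0 db] Eb] [E1 E2].
  rewrite -Ea -Eb; congr cmap; rewrite -(K1 _ Ua0) -(K1 _ Ub0); congr g.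
  have [] : @half_cylinder R (f (cinv c a)) by apply: fU; exists (cinv c a).
  have [] : @half_cylinder R (f (cinv c a')) by apply: fU; exists (cinv c a').
  move: da db E1 E2; rewrite /= /dot /crs /unit_circle /=.
  case: (f (cinv c a)) => -[p q] u; case: (f (cinv c a')) => -[p' q'] u' /=.
  move: bb; rewrite /b /=; move: (cos z.1) (sin z.1) => m n mn da db E1 -> c1 _ c2 _.
  (* On the unit circle [crs b] determines [dot b] up to sign, and the sign is positive by the
     choice of the neighbourhood. *)
  have S1 : (m * p + n * q) ^+ 2 = (m * p' + n * q') ^+ 2.
    have h1 : (m * p + n * q) ^+ 2 + (m * q - n * p) ^+ 2 = (m * m + n * n) * (p ^+ 2 + q ^+ 2) by ring.
    have h2 : (m * p' + n * q') ^+ 2 + (m * q' - n * p') ^+ 2 = (m * m + n * n) * (p' ^+ 2 + q' ^+ 2) by ring.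
    by move: h1 h2; rewrite mn c1 c2 E1; lra.
  have S2 : m * p + n * q = m * p' + n * q'.
    by apply/eqP; rewrite -(@eqrXn2 _ 2%N) ?ltW//; apply/eqP.
  congr (_, _, _).
    transitivity (m * (m * p + n * q) - n * (m * q - n * p)).
      by transitivity ((m * m + n * n) * p); [rewrite mn mul1r|ring].
    rewrite S2 E1.
    by transitivity ((m * m + n * n) * p'); [ring|rewrite mn mul1r].
  transitivity (n * (m * p + n * q) + m * (m * q - n * p)).
    by transitivity ((m * m + n * n) * q); [rewrite mn mul1r|ring].
  rewrite S2 E1.
  by transitivity ((m * m + n * n) * q'); [ring|rewrite mn mul1r].
have := invariance_of_domain em; rewrite /E cmapK// fx => /nbhs_disk[s s0 sD].
have [|w Dw [_ Ew]] := sD (crs b b, - s).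
  by rewrite /closed_disk /= subrr subr0 expr0n /= add0r sqrrN.
have [_ [Uw _] _] := rH _ Dw.
have [_ ] : @half_cylinder R (f (cinv c w)) by apply: fU; exists (cinv c w).
by rewrite /= Ew; lra.
Qed.

Lemma cyl_sbd z : 0 <= z.2 -> sbd R S (cyl z) <-> z.2 = 0.
Proof.
move=> z0; rewrite (sbdE surfX bS); split=> [[_ nS]|zE].
  apply/eqP; rewrite eq_le z0 andbT leNgt; apply/negP => zp.
  by apply: nS; exact: cyl_interior.
split; last exact: cyl_boundary.
by have := cyl_U z; case: oU => V [_ ->] [].
Qed.

End Coordinates.

(** * Topology of a Nyikos decomposition *)

Section Nyikos.
Variables (R : realType) (X : topologicalType) (K : set X) (n : nat) (P : 'I_n -> set X).
Hypothesis surfX : surface R X.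
Hypothesis nyk : nyikos_decomposition R K P.
Implicit Types (x y : X) (i j : 'I_n) (z w : R * R).

Local Notation sbd := (sbd R).

Lemma bsurfK : bsurface R K. Proof. by case: nyk => -[]. Qed.
Lemma closedK : closed K.
Proof. by case: nyk => -[cK _] *; apply: compact_closed => //; exact: (hausX surfX). Qed.
Lemma compactK : compact K. Proof. by case: nyk => -[]. Qed.
Lemma pipeP i : long_pipe R (P i). Proof. by case: nyk => _ []. Qed.
Lemma bsurfP i : bsurface R (P i). Proof. by case: (pipeP i). Qed.
Lemma disjP i j x : P i x -> P j x -> i = j.
Proof.
move=> Px Px'; apply: contrapT => /eqP ij; case: nyk => _ [_ /(_ _ _ ij) E] _ _ _.
by have : (P i `&` P j) x by []; rewrite E.
Qed.
Lemma coverX x : K x \/ exists i, P i x.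
Proof.
case: nyk => _ _ E _ _; have : [set: X] x by []; rewrite -E => -[|[i _ Pi]]; [by left|].
by right; exists i.
Qed.
Lemma KP i : K `&` P i = sbd (P i). Proof. by case: nyk. Qed.

Lemma sbdP_K i x : sbd (P i) x -> K x. Proof. by rewrite -KP => -[]. Qed.
Lemma sbdP_P i x : sbd (P i) x -> P i x. Proof. by rewrite -KP => -[]. Qed.

Lemma sbdKP x : sbd K x <-> exists i, sbd (P i) x.
Proof.
case: nyk => _ _ _ _ [H1 H2]; split.
  move=> Kx; have [|i Ei] := H2 (connected_component (sbd K) x); first by exists x.
  by exists i; rewrite -Ei; exact: connected_component_refl.
by move=> [i]; have [y [Ky ->]] := H1 i; exact: connected_component_sub.
Qed.

Lemma compact_sbdP i : compact (sbd (P i)).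
Proof. by have [_ /homeomorphic_circle[]] := pipeP i. Qed.
Lemma closed_sbdP i : closed (sbd (P i)).
Proof. by apply: compact_closed; [exact: (hausX surfX)|exact: compact_sbdP]. Qed.
Lemma intK_sbd x : interior K x -> forall i, ~ P i x.
Proof.
move=> iKx i Pix; have Kx : K x by exact: interior_subset.
have : sbd (P i) x by rewrite -KP.
by move=> h; have /sbdKP : exists i, sbd (P i) x by [exists i]; rewrite (sbdE surfX bsurfK) => -[].
Qed.

Lemma intP_K i x : interior (P i) x -> ~ K x.
Proof.
move=> iP Kx; have : sbd (P i) x by rewrite -KP; split=> //; exact: interior_subset.
by rewrite (sbdE surfX (bsurfP i)) => -[].
Qed.

Lemma trichotomy x : interior K x \/ exists i, sbd (P i) x \/ interior (P i) x.
Proof.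
have HP i : P i x -> exists i, sbd (P i) x \/ interior (P i) x.
  move=> Pi; exists i; have [iP|niP] := pselect (interior (P i) x); first by right.
  by left; rewrite (sbdE surfX (bsurfP i)).
have [Kx|[i /HP]] := coverX x; last by right.
have [iK|niK] := pselect (interior K x); first by left.
by right; have /sbdKP[i /sbdP_P/HP] : sbd K x by rewrite (sbdE surfX bsurfK).
Qed.

Lemma notK x : ~ K x <-> exists i, interior (P i) x.
Proof.
split=> [nK|[i /intP_K]//].
case: (trichotomy x) => [/interior_subset//|[i [/sbdP_K//|iP]]]; by exists i.
Qed.

Lemma nbhs_sbdP j x : sbd (P j) x -> \forall y \near x, forall i, i != j -> ~ sbd (P i) y.
Proof.
move=> jx.
apply: filter_forall => i; have [->|ij] := eqVneq i j.
  by apply: (@filterE _ (nbhs x)).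
have : nbhs x (~` sbd (P i)).
  apply: open_nbhs_nbhs; split; first by apply: closed_openC; exact: closed_sbdP.
  by move=> /sbdP_P/(disjP (sbdP_P jx)) E; rewrite E eqxx in ij.
by apply: (@filterS _ (nbhs x)).
Qed.

(** One member of the exhaustion of the pipe with its coordinates, the ordinal index being
    forgotten. *)
Definition pipe_end i (f : X -> (R * R) * R) (g : (R * R) * R -> X) (Ua : set X) :=
  [/\ homeo_pair Ua (@half_cylinder R) f g, exists V, open V /\ Ua = V `&` P i &
      sbd (P i) `<=` Ua].

(** The exhaustion is increasing and relatively open, so compactness along the filter of final
    segments of the index order puts [Q] inside a single member. *)
Lemma pipe_end_exists i (Q : set X) : compact Q -> Q `<=` P i ->
  exists f g Ua, pipe_end i f g Ua /\ Q `<=` Ua.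
Proof.
move=> cQ QP; have [_ _ [I [lt [U [om EP HU mono]]]]] := pipeP i.
have [[irr tr] tot _ unc _] := om.
have [a0] : exists a : I, True.
  apply: contrapT => nI; apply: unc; suff -> : [set: I] = set0 by exact: countable0.
  by apply/seteqP; split=> // a _; apply: nI; exists a.
move=> _.
have sub a b : lt a b -> U a `<=` U b.
  move=> /mono[clab _] x Ux; apply: clab; split; first exact: subset_closure.
  by have [[V [_ E]] _] := HU a; move: Ux; rewrite E => -[].
pose F : set_system I := [set S | exists a, forall b, lt a b \/ a = b -> S b].
have FF : Filter F.
  split.
  - by exists a0.
  - move=> A B [a Ha] [b Hb]; case: (tot a b) => ab.
    + exists b => c bc; split; [|exact: Hb]; apply: Ha; left.
      by case: bc => [/(tr _ _ _ ab)|<-].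
    + by exists a => c ac; split; [exact: Ha|apply: Hb; rewrite -ab].
    + exists a => c ac; split; [exact: Ha|]; apply: Hb; left.
      by case: ac => [/(tr _ _ _ ab)|<-].
  - by move=> A B AB [a Ha]; exists a => b /Ha/AB.
have := (compact_near_coveringP Q).1 cQ _ F (fun b x => P i x -> U b x) FF.
case=> [x Qx|b Hb].
  have Px := QP _ Qx; have : (\bigcup_a U a) x by rewrite -EP.
  move=> [a _ Ux]; have [[V [oV E]] _] := HU a.
  exists (V, [set b | lt a b \/ a = b]) => /=.
    split; last by exists a.
    by apply: open_nbhs_nbhs; split=> //; move: Ux; rewrite E => -[].
  move=> [y b] /= [Vy ab] Py; have Uy : U a y by rewrite E.
  by case: ab => [/sub|<-]; [exact|].
have [oV [sU [f [g fg]]]] := HU b.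
exists f, g, (U b); split; first by split.
by move=> x Qx; apply: (Hb b) => //; [right|exact: QP].
Qed.

Lemma pipe_end0 i : exists f g Ua, pipe_end i f g Ua.
Proof.
have [f [g [Ua [H _]]]] := pipe_end_exists (@compact0 _) (@sub0set _ (P i)).
by exists f, g, Ua.
Qed.

Lemma end_height0 j f g Ua x : pipe_end j f g Ua -> sbd (P j) x ->
  f x = ((f x).1, 0) /\ @unit_circle R (f x).1 /\ g ((f x).1, 0) = x.
Proof.
move=> [fg oU sU] jx; have Ux := sU _ jx.
have [z [z0 Ez]] := cyl_surj fg Ux.
have z20 : z.2 = 0 by apply/(cyl_sbd surfX (bsurfP j) fg oU z0); rewrite -Ez.
have Ef : f x = (cis z.1, 0) by rewrite Ez (cylK fg z0) z20.
rewrite Ef /=; split=> //; split; first exact: cis_unit.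
by rewrite [RHS]Ez /cyl z20 maxxx.
Qed.

Lemma end_interior j f g Ua b u : pipe_end j f g Ua -> @unit_circle R b -> 0 < u ->
  interior (P j) (g (b, u)).
Proof.
move=> [fg oU sU] /cis_surj[t ->] u0.
have := cyl_interior surfX fg oU (z := (t, u)) u0.
by rewrite /cyl /= max_r// ltW.
Qed.

Lemma end_sbd j f g Ua b : pipe_end j f g Ua -> @unit_circle R b ->
  sbd (P j) (g (b, 0)).
Proof.
move=> [fg oU sU] /cis_surj[t ->].
by have /= := (cyl_sbd surfX (bsurfP j) fg oU (z := (t, 0)) (lexx 0)).2 erefl; rewrite /cyl /= maxxx.
Qed.

Lemma end_inj j f g Ua b b' u u' : pipe_end j f g Ua -> @unit_circle R b ->
  @unit_circle R b' -> 0 <= u -> 0 <= u' -> g (b, u) = g (b', u') -> (b, u) = (b', u').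
Proof.
move=> [[_ _ _ _ [_ K2]] _ _] ub ub' u0 u0' E.
by rewrite -[LHS]K2// E K2.
Qed.

(* A boundary chart of [K] on the lower side and the cylinder coordinates of the
   pipe on the upper side fit together along the common boundary arc. *)
Lemma local_product j f g Ua x : pipe_end j f g Ua -> sbd (P j) x ->
  exists (b : R -> R * R) (E : R * R -> X),
  [/\ continuous b /\ forall s, @unit_circle R (b s), continuous E, injective E,
      (forall s u, 0 <= u -> E (s, u) = g (b s, u)) /\
      (forall s u, u < 0 -> interior K (E (s, u))) & E (0, 0) = x].
Proof.
move=> pe jx; have [fg oU sU] := pe.
have Kx := sbdP_K jx.
have : sbd K x by apply/sbdKP; exists j.
move=> [_ [c [bc cx c0]]].
have [oc [W [oW EW]] [cc ci _ im [K1 K2]]] := bc.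
have mx : (cmap c @` (cdom c `&` K)) (cmap c x) by exists x.
have N0 := nbhs_sbdP jx.
have NK1 : nbhs (cinv c (cmap c x)) (fun y => forall i, i != j -> ~ sbd (P i) y).
  by rewrite K1.
move/subspace_continuousP: (ci) => /(_ _ mx _ NK1); rewrite /within /= => N1.
have NW : nbhs (cmap c x) W.
  by apply: open_nbhs_nbhs; split=> //; move: mx; rewrite EW => -[].
have /nbhs_disk[r r0 rD] : nbhs (cmap c x) (W `&`
    [set z | (cmap c @` (cdom c `&` K)) z -> forall i, i != j -> ~ sbd (P i) (cinv c z)]).
  exact: filterI NW N1.
set x0 := (cmap c x).1.
(* Squeezes the line into an interval: [atan] stays within [2] in absolute value because
   [pi / 2 < 2], so both coordinates stay within [r / 2] and the point remains in the disk. *)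
pose sq (s : R) := r / 4 * atan s.
have csq : continuous sq by rewrite /sq; ct.
have sq_lt s : - (r / 2) <= sq s <= r / 2.
  have h1 := atan_gtNpi2 s; have h2 := atan_ltpi2 s; have h3 := @pihalf_lt2 R.
  have r40 : 0 < r / 4 by rewrite divr_gt0.
  have a1 : r / 4 * atan s <= r / 4 * 2 by rewrite ler_pM2l//; lra.
  have a2 : r / 4 * (-2) <= r / 4 * atan s by rewrite ler_pM2l//; lra.
  by rewrite /sq; apply/andP; split; lra.
have sq_inj : injective sq.
  have r40 : r / 4 != 0 by rewrite gt_eqF// divr_gt0.
  by move=> s t /(mulfI r40) E; rewrite -[s]atanK E atanK.
have sq0 : sq 0 = 0 by rewrite /sq atan0 mulr0.
have sq_pos u : 0 < u -> 0 < sq u.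
  by move=> u0; rewrite /sq mulr_gt0 ?divr_gt0// -atan0 lt_atan.
have sq_ge0 u : 0 <= u -> 0 <= sq u.
  by rewrite le_eqVlt => /orP[/eqP <-|/sq_pos/ltW//]; rewrite sq0.
have inD s u : 0 <= u -> closed_disk (cmap c x) r (x0 + sq s, sq u).
  move=> _; rewrite /closed_disk /= c0 subr0 -/x0.
  have -> : x0 + sq s - x0 = sq s by ring.
  have hs := sq_lt s; have hu := sq_lt u.
  have le (t : R) : - (r / 2) <= t <= r / 2 -> t ^+ 2 <= (r / 2) ^+ 2.
    move=> h; rewrite -(real_normK (num_real t)) ler_pXn2r ?nnegrE ?divr_ge0 ?(ltW r0)//.
    by rewrite ler_norml.
  have r2 : 0 <= r ^+ 2 by rewrite sqr_ge0.
  by have := le _ hs; have := le _ hu; rewrite !expr2 in r2 *; lra.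
have dK s u : 0 <= u -> (cmap c @` (cdom c `&` K)) (x0 + sq s, sq u).
  move=> u0; rewrite EW; split; first by have [] := rD _ (inD s u u0).
  exact: sq_ge0.
pose q s := cinv c (x0 + sq s, 0).
have qP s : [/\ cdom c (q s), K (q s), cmap c (q s) = (x0 + sq s, 0) & sbd (P j) (q s)].
  have D := dK s 0 (lexx 0); rewrite sq0 in D.
  have [cq Kq] : (cdom c `&` K) (q s) by apply: im; exists (x0 + sq s, 0).
  have Eq : cmap c (q s) = (x0 + sq s, 0) by rewrite /q K2.
  split=> //.
  have /sbdKP[i iq] : sbd K (q s) by split=> //; exists c; rewrite Eq.
  have [<-//|ij] := eqVneq i j.
  have [_ H] := rD _ (inD s 0 (lexx 0)).
  by move: H; rewrite /= sq0 => /(_ D _ ij).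
pose b s := (f (q s)).1.
have cq : continuous q.
  apply: (within_comp_continuous ci); first by ct.
  by move=> s; have := dK s 0 (lexx 0); rewrite sq0.
have cb : continuous b.
  have [cf _ _ _ _] := fg.
  have : continuous (fun s => f (q s)).
    by apply: (within_comp_continuous cf) => // s; apply: sU; have [] := qP s.
  by move=> cfq; rewrite /b; apply: (continuous_compose (@continuous_fst1 _ _)).
have ub s : @unit_circle R (b s).
  by have [_ _ _ sq_] := qP s; have [_ []] := end_height0 pe sq_.
have gb s : g (b s, 0) = q s.
  by have [_ _ _ sq_] := qP s; have [_ []] := end_height0 pe sq_.
have binj : injective b.
  move=> s t E; have : q s = q t by rewrite -!gb E.
  have [_ _ Es _] := qP s; have [_ _ Et _] := qP t.
  by move=> /(congr1 (cmap c)); rewrite Es Et => -[] /addrI /sq_inj.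
pose E1 (z : R * R) := g (b z.1, Num.max 0 z.2).
pose E2 (z : R * R) := cinv c (x0 + sq z.1, sq (Num.max 0 (- z.2))).
pose E (z : R * R) := if 0 <= z.2 then E1 z else E2 z.
have m0 (u : R) : 0 <= Num.max 0 u by rewrite le_max lexx.
have Epos s u : 0 <= u -> E (s, u) = g (b s, u).
  by move=> u0; rewrite /E /= u0 /E1 /= max_r.
have Eneg s u : u < 0 -> E (s, u) = cinv c (x0 + sq s, sq (- u)).
  by move=> u0; rewrite /E /= leNgt u0 /= /E2 /= max_r// oppr_ge0 ltW.
have cE : continuous E.
  apply: paste_continuous.
  - by ct.
  - have [_ cg _ _ _] := fg; apply: (within_comp_continuous cg); first by ct.
    by move=> z; split=> /=.
  - by apply: (within_comp_continuous ci); [ct|move=> z; exact: dK].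
  - by move=> z z0; rewrite /E1 /E2 z0 oppr0 maxxx sq0 gb.
have EKint s u : u < 0 -> interior K (E (s, u)).
  move=> u0; rewrite Eneg//; have nu0 : 0 < - u by rewrite oppr_gt0.
  have D := dK s (- u) (ltW nu0).
  have [cy Ky] : (cdom c `&` K) (cinv c (x0 + sq s, sq (- u))).
    by apply: im; exists (x0 + sq s, sq (- u)).
  apply: (bchart_interior surfX bc) => //.
  by rewrite K2//= => /eqP; rewrite gt_eqF// sq_pos.
exists b, E; split=> //.
- move=> [s u] [t v] H; case: (ltP u 0) => u0; case: (ltP v 0) => v0.
  + have D1 := dK s (- u); have D2 := dK t (- v).
    rewrite !oppr_ge0 in D1 D2; have {}D1 := D1 (ltW u0); have {}D2 := D2 (ltW v0).
    move: H; rewrite !Eneg// => /(congr1 (cmap c)); rewrite !K2// => -[] /addrI /sq_inj -> /sq_inj.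
    by move=> /oppr_inj ->.
  + have iK := EKint s u u0; rewrite H Epos// in iK.
    have [v00|vn] := eqVneq v 0.
      by case: (intK_sbd iK (i := j)); rewrite v00; apply: sbdP_P; exact: end_sbd pe (ub t).
    have vp : 0 < v by rewrite lt_def vn.
    by case: (intP_K (end_interior pe (ub t) vp)); exact: interior_subset.
  + have iK := EKint t v v0; rewrite -H Epos// in iK.
    have [u00|un] := eqVneq u 0.
      by case: (intK_sbd iK (i := j)); rewrite u00; apply: sbdP_P; exact: end_sbd pe (ub s).
    have up : 0 < u by rewrite lt_def un.
    by case: (intP_K (end_interior pe (ub s) up)); exact: interior_subset.
  + by move: H; rewrite !Epos// => /(end_inj pe (ub s) (ub t) u0 v0)[/binj -> ->].
- rewrite Epos// gb /q sq0 addr0 /x0 -c0 -pairE.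
  by rewrite K1.
Qed.

Lemma injective_plane_nbhs (E : R * R -> X) z : continuous E -> injective E ->
  nbhs (E z) (E @` closed_disk z 1).
Proof.
move=> cE iE; apply: (invdom_plane surfX) => //.
  by apply: continuous_subspaceT.
by move=> a b _ _ /iE.
Qed.

Lemma nbhs_KP j x : sbd (P j) x -> nbhs x (K `|` P j).
Proof.
move=> jx; have [f [g [Ua pe]]] := pipe_end0 j.
have [b [E [[cb ub] cE iE [Epos Eneg] E0]]] := local_product pe jx.
have := injective_plane_nbhs (0, 0) cE iE; rewrite E0.
apply: (@filterS _ (nbhs x)) => _ [[s u] _ <-].
case: (ltP u 0) => u0; first by left; exact: (interior_subset (Eneg s u u0)).
rewrite Epos//; have [->|un] := eqVneq u 0.
  by left; apply: sbdP_K; exact: end_sbd pe (ub s).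
have up : 0 < u by rewrite lt_def un.
by right; apply: interior_subset; exact: end_interior pe (ub s) up.
Qed.

(** Near the circle of another pipe [P j] only [K] and [P j] are present, and [P i] meets [K] only
    in its own circle, which is compact. *)
Lemma closedP i : closed (P i).
Proof.
move=> x clx; apply: contrapT => nPi.
have no (A : set X) : nbhs x A -> (forall y, A y -> ~ P i y) -> False.
  by move=> /clx[y [Py Ay]] /(_ y Ay).
case: (trichotomy x) => [iK|[j [jx|iPj]]].
- apply: (no (interior K)); first exact: nbhs_interior.
  by move=> y /intK_sbd.
- have nx : nbhs x (~` sbd (P i)).
    apply: open_nbhs_nbhs; split; first by apply: closed_openC; exact: closed_sbdP.
    by move=> /sbdP_P.
  apply: (no _ (filterI (nbhs_KP jx) nx)) => y [[Ky|Pjy] ny] Piy.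
    by apply: ny; rewrite -KP.
  have E : i = j := disjP Piy Pjy.
  by apply: nPi; rewrite E; exact: sbdP_P.
- apply: (no (interior (P j))); first exact: nbhs_interior.
  move=> y /interior_subset Pjy /disjP /(_ Pjy) E.
  by apply: nPi; rewrite E; exact: interior_subset.
Qed.

(** Any interior point shares a cylinder with the base point [x0]; the part of positive height of
    that cylinder is connected and contains both. *)
Lemma connected_intP i : connected (interior (P i)).
Proof.
have [f0 [g0 [U0 pe0]]] := pipe_end0 i.
have u1 := @unit_circle1 R.
set x0 := g0 ((1, 0), 1).
have ix0 : interior (P i) x0 by exact: end_interior pe0 u1 ltr01.
have cx y : interior (P i) y -> exists C, [/\ connected C, C x0, C y & C `<=` interior (P i)].
  move=> iy; have [||f [g [Ua [pe QU]]]] := @pipe_end_exists i [set x0; y].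
  - by apply: finite_compact.
  - by move=> _ [->|->]; exact: interior_subset.
  have [fg oU sU] := pe.
  exists (cyl g @` [set z | 0 < z.2]); split.
  - apply: connected_continuous_connected; last first.
      by apply: continuous_subspaceT; exact: cyl_continuous fg.
    have -> : [set z : R * R | 0 < z.2] = (fun z => (z.1, expR z.2)) @` setT.
      apply/seteqP; split=> [z /= z0|_ [z _ <-]]; last exact: expR_gt0.
      by exists (z.1, ln z.2) => //=; rewrite lnK ?posrE// -pairE.
    apply: connected_continuous_connected; last by apply: continuous_subspaceT; ct.
    have -> : [set: R * R] = \bigcup_(z in [set: R * R]) (fun t => lerp t 0 z) @` setT.
      apply/seteqP; split=> // z _; exists z => //; exists 1 => //; exact: lerp1.
    apply: bigcup_connected; first by exists 0 => z _; exists 0 => //; exact: lerp0.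
    move=> z _; apply: connected_continuous_connected.
      by apply/connected_intervalP => a b _ _ c _.
    by apply: continuous_subspaceT; rewrite /lerp; ct.
  - have [z [z0 Ez]] := cyl_surj fg (QU x0 (or_introl erefl)).
    exists z => //=; rewrite lt_def z0 andbT; apply/eqP => z20.
    by apply: (cyl_boundary surfX fg oU z20); rewrite -Ez.
  - have [z [z0 Ez]] := cyl_surj fg (QU y (or_intror erefl)).
    exists z => //=; rewrite lt_def z0 andbT; apply/eqP => z20.
    by apply: (cyl_boundary surfX fg oU z20); rewrite -Ez.
  - by move=> _ [z z0 <-]; apply: (cyl_interior surfX fg oU).
have /choice[C HC] : forall y, exists C, interior (P i) y ->
    [/\ connected C, C x0, C y & C `<=` interior (P i)].
  move=> y; have [/cx[C HC]|ny] := pselect (interior (P i) y); first by exists C.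
  by exists set0.
have -> : interior (P i) = \bigcup_(y in interior (P i)) C y.
  apply/seteqP; split=> [y iy|x [y iy Cx]]; first by exists y => //; case: (HC y iy).
  by have [_ _ _] := HC y iy; exact.
by apply: bigcup_connected; [exists x0 => y /HC[]|move=> y /HC[]].
Qed.

End Nyikos.

(** * Construction of two-sided collars *)

Section Bicollar.
Variables (R : realType) (X : topologicalType) (K : set X) (n : nat) (P : 'I_n -> set X).
Hypothesis surfX : surface R X.
Hypothesis nyk : nyikos_decomposition R K P.
Variables (j : 'I_n) (f : X -> (R * R) * R) (g : (R * R) * R -> X) (Ua : set X).
Hypothesis pe : pipe_end P j f g Ua.
Implicit Types (x y : X) (z w c : R * R).

Local Notation sbd := (sbd R).

Definition tent (u : R) : R := Num.max 0 (1 - `|u|).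

Lemma tent_ge0 u : 0 <= tent u. Proof. by rewrite /tent le_max lexx. Qed.
Lemma tent0 : tent 0 = 1. Proof. by rewrite /tent normr0 subr0 max_r. Qed.
Lemma tent_out u : 1 <= `|u| -> tent u = 0.
Proof. by move=> h; rewrite /tent max_l// subr_le0. Qed.
Lemma tent_le1 u : tent u <= 1.
Proof. by rewrite /tent ge_max ler01 gerBl normr_ge0. Qed.
Lemma tent_lip u v : `|tent u - tent v| <= `|u - v|.
Proof.
have h1 := ler_dist_dist u v; move: h1; rewrite !ler_norml => /andP[h1 h2].
have h3 := normr_ge0 u; have h4 := normr_ge0 v.
by rewrite /tent; case: (leP 0 (1 - `|u|)) => a; case: (leP 0 (1 - `|v|)) => b;
  apply/andP; split; lra.
Qed.
Lemma tent_continuous : continuous tent. Proof. by rewrite /tent; ct. Qed.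

Definition norm1 (v : R * R) : R := `|v.1| + `|v.2|.
Definition bump (d : R) (b0 c : R * R) : R := Num.max 0 (d - norm1 (c - b0)).

Lemma bump_ge0 d b0 c : 0 <= bump d b0 c. Proof. by rewrite /bump le_max lexx. Qed.
Lemma bump_continuous d b0 : continuous (bump d b0).
Proof.
have : continuous (fun c : R * R => (c.1 - b0.1, c.2 - b0.2)) by ct.
by move=> h; rewrite /bump /norm1 /=; ct.
Qed.
Lemma bump_le d b0 c : 0 <= d -> bump d b0 c <= d.
Proof. by move=> d0; rewrite /bump ge_max d0 gerBl addr_ge0. Qed.

(** [E] continues the pipe coordinates over an arc across the circle into [K]. The bound [1 / 2]
    keeps pushes along the fibres increasing, as [tent] is 1-Lipschitz; the last clause places the
    support of the bump over [[-1, 1]], so that a push has compact support. *)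
Definition collar_datum (b0 : R * R) (d : R) := 0 < d <= 1 / 2 /\
  exists (b : R -> R * R) (E : R * R -> X),
  [/\ continuous b /\ forall s, @unit_circle R (b s), continuous E, injective E,
      (forall s u, 0 <= u -> E (s, u) = g (b s, u)) /\
      (forall s u, u < 0 -> interior K (E (s, u))) &
      forall c, @unit_circle R c -> 0 < bump d b0 c -> exists2 s, `|s| <= 1 & c = b s].

Lemma collar_datum_exists b0 : @unit_circle R b0 -> exists d, collar_datum b0 d.
Proof.
move=> ub0; have jx := end_sbd surfX nyk pe ub0.
have [b [E [[cb ub] cE iE [Epos Eneg] E0]]] := local_product surfX nyk pe jx.
have := injective_plane_nbhs surfX (0, 0) cE iE; rewrite E0.
have [[_ cg _ _ _] _ _] := pe.
have h0 : half_cylinder (b0, 0 : R) by split=> /=.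
move/subspace_continuousP: (cg) => /(_ _ h0) cg0 /cg0; rewrite /within /=.
move=> [[A1 A2] /= [/nbhs_ballP[e /= e0 eA] NA2] AH].
exists (Num.min e (1 / 2)); split.
  by rewrite lt_min e0 /= ge_min lexx orbT andbT; lra.
exists b, E; split=> // c uc; rewrite /bump lt_max ltxx /= subr_gt0 => lt.
have {lt} lt : norm1 (c - b0) < e by apply: lt_le_trans lt _; rewrite ge_min lexx.
have [|[s u] Ds Es] := AH (c, 0) _ (conj uc (lexx 0)).
  split; last exact: nbhs_singleton.
  apply: eA; move: lt; rewrite /norm1 /= => lt.
  have n1 := normr_ge0 (c.1 - b0.1); have n2 := normr_ge0 (c.2 - b0.2).
  by split; rewrite /ball /= distrC; lra.
exists s.
  by have [] := disk_coord ler01 Ds; rewrite /= subr0.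
case: (ltP u 0) => u0.
  have := Eneg s u u0; rewrite Es => /(intK_sbd surfX nyk)/(_ j) [].
  by apply: (sbdP_P nyk); exact: end_sbd surfX nyk _ _ _ _ _ pe uc.
move: Es; rewrite Epos// => /(end_inj pe (ub s) uc u0 (lexx 0)).
by move=> [->].
Qed.

Lemma injective_open (E : R * R -> X) : continuous E -> injective E ->
  forall z N, nbhs z N -> nbhs (E z) (E @` N).
Proof.
move=> cE iE z N /nbhs_disk[r r0 rN].
apply: (@filterS _ (nbhs (E z)) _ (E @` closed_disk z r)).
  by move=> _ [w /rN Nw <-]; exists w.
apply: (invdom_plane surfX) => //; first by apply: continuous_subspaceT.
by move=> a b _ _ /iE.
Qed.

(* [chi] pushes the level [mu + bump] down to the level [mu] along the vertical
   fibres of a local product. *)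
Lemma push_step b0 d (mu : R * R -> R) : collar_datum b0 d -> continuous mu ->
  (forall c, 0 <= mu c) -> exists chi : X -> X,
  [/\ homeo chi,
      forall c, @unit_circle R c -> chi (g (c, mu c + bump d b0 c)) = g (c, mu c),
      forall c u, @unit_circle R c -> 0 <= u < mu c + bump d b0 c ->
        interior K (chi (g (c, u))) \/
        exists2 u', 0 <= u' < mu c & chi (g (c, u)) = g (c, u') &
      forall y, interior K y -> interior K (chi y)].
Proof.
move=> [/andP[d0 d2] [b [E [[cb ub] cE iE [Epos Eneg] Eb]]]] cmu mu0.
pose L s := bump d b0 (b s); pose M s := mu (b s).
have cbump := @bump_continuous d b0.
have cL : continuous L by rewrite /L; ct.
have cM : continuous M by rewrite /M; ct.
have L0 s : 0 <= L s by exact: bump_ge0.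
have L2 s : L s <= 1 / 2 by apply: le_trans d2; apply: bump_le; exact: ltW.
(* The displacement [L s] is attained at height [M s + L s], so this level lands exactly on [M s];
   the slope stays at least [1 / 2]. *)
pose m s u := u - L s * tent (u - M s - L s).
have cm s : continuous (m s) by have := tent_continuous => ?; rewrite /m; ct.
have m_lt s u v : u < v -> m s u < m s v.
  move=> uv; have := tent_lip (v - M s - L s) (u - M s - L s).
  have -> : v - M s - L s - (u - M s - L s) = v - u by ring.
  rewrite [X in _ <= X]ger0_norm ?subr_ge0 ?(ltW uv)// ler_norml => /andP[_ h].
  have h1 : L s * (tent (v - M s - L s) - tent (u - M s - L s)) <= L s * (v - u).
    by rewrite ler_wpM2l.
  have h2 : L s * (v - u) <= 1 / 2 * (v - u) by rewrite ler_wpM2r// subr_ge0 ltW.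
  by rewrite /m; lra.
have m_le s u : m s u <= u.
  by rewrite /m gerBl mulr_ge0// tent_ge0.
have m_near s u : `|m s u - u| <= 1 / 2.
  rewrite /m; have -> : u - L s * tent (u - M s - L s) - u = - (L s * tent (u - M s - L s)) by ring.
  rewrite normrN ger0_norm ?mulr_ge0 ?tent_ge0//.
  apply: le_trans (L2 s); rewrite -[leRHS]mulr1 ler_wpM2l// tent_le1.
  by [].
have /choice[m' Hm'] : forall s, exists m' : R -> R,
    (forall u, m' (m s u) = u) /\ (forall v, m s (m' v) = v).
  by move=> s; exact: (near_id_bij (cm s) (m_lt s) (m_near s)).
pose phi (t : R) (z : R * R) := (z.1, m z.1 z.2).
pose psi (t : R) (z : R * R) := (z.1, m' z.1 z.2).
have binj s t : b s = b t -> s = t.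
  by move=> Est; have [] : (s, 0 : R) = (t, 0) by apply: iE; rewrite !Epos// Est.
have Lout s : ~~ (`|s| <= 1) -> L s = 0.
  move=> s1; apply/eqP; rewrite eq_le L0 andbT leNgt; apply/negP => Lp.
  by have [s' s'1 /binj E'] := Eb _ (ub s) Lp; rewrite E' s'1 in s1.
have cML : continuous (fun s => M s + L s) by ct.
have le11 : -1 <= 1 :> R by lra.
have [s0 _ Hs0] := EVT_max le11 (continuous_subspaceT cML).
(* [M s0 + L s0] is the greatest height of a tent centre over [[-1, 1]], and [1] is the half-width
   of [tent]. *)
pose M0 := M s0 + L s0 + 1.
pose C : set (R * R) := `[-1, 1] `*` `[- M0, M0].
have cC : compact C by apply: compact_setX; exact: segment_compact.
have clC : closed (E @` C).
  apply: compact_closed; first exact: hausX surfX.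
  by apply: continuous_compact => //; apply: continuous_subspaceT.
have supp t z : ~ C z -> phi t z = z.
  move=> nC; rewrite /phi /m; suff -> : L z.1 * tent (z.2 - M z.1 - L z.1) = 0.
    by rewrite subr0 -pairE.
  have [s1|s1] := boolP (`|z.1| <= 1); last by rewrite Lout// mul0r.
  rewrite tent_out ?mulr0//; rewrite leNgt; apply/negP => lt.
  apply: nC; split; rewrite /= in_itv /= -ler_norml//.
  have z1i : z.1 \in `[-1, 1] by rewrite in_itv /= -ler_norml.
  have := Hs0 _ z1i; have ML0 : 0 <= M z.1 + L z.1 by rewrite addr_ge0// mu0.
  move: lt; rewrite ltr_norml => /andP[l1 l2].
  by move=> h; rewrite ler_norml /M0; apply/andP; split; lra.
have cphi : continuous (fun v : R * (R * R) => phi v.1 v.2).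
  by have := tent_continuous => ?; rewrite /phi /m; ct.
have [||||H [iH HE HN]] := @extend_isotopy R X surfX E phi psi C cE (injective_open cE iE) _ _ cphi _ _ clC supp.
- by move=> t z w /iE ->.
- by move=> t z w /iE ->.
- by move=> t z; rewrite /phi /psi /=; have [_ ->] := Hm' z.1; rewrite -pairE.
- by move=> t z; rewrite /phi /psi /=; have [-> _] := Hm' z.1; rewrite -pairE.
have key c u : @unit_circle R c -> 0 <= u ->
    (exists2 s, c = b s & g (c, u) = E (s, u)) \/
    (bump d b0 c = 0 /\ H 0 (g (c, u)) = g (c, u)).
  move=> uc u0; have [Lp|Lz] := ltP 0 (bump d b0 c).
    by left; have [s _ Ec] := Eb c uc Lp; exists s => //; rewrite Epos// Ec.
  have Bz : bump d b0 c = 0 by apply/eqP; rewrite eq_le Lz bump_ge0.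
  have [[[s v] Esv]|nE] := pselect (exists z, E z = g (c, u)); last first.
    by right; split=> //; apply: HN => z Ez; apply: nE; exists z.
  have [v0|v0] := ltP v 0.
    exfalso; have := Eneg s v v0; rewrite Esv => /(intK_sbd surfX nyk)/(_ j) [].
    have [->|un] := eqVneq u 0; first by apply: (sbdP_P nyk); exact: end_sbd surfX nyk _ _ _ _ _ pe uc.
    by apply: interior_subset; apply: (end_interior surfX pe uc); rewrite lt_def un.
  left; exists s.
    by move: Esv; rewrite Epos// => /(end_inj pe (ub s) uc v0 u0)[->].
  rewrite -Esv; congr (E (_, _)).
  by move: Esv; rewrite Epos// => /(end_inj pe (ub s) uc v0 u0)[].
have mtop s : m s (M s + L s) = M s.
  have E0 : M s + L s - M s - L s = 0 by ring.
  rewrite /m E0 tent0 mulr1 addrK; reflexivity.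
exists (H 0); split.
- by case: iH.
- move=> c uc; have c0 : 0 <= mu c + bump d b0 c by rewrite addr_ge0// bump_ge0.
  case: (key c _ uc c0) => [[s Ec ->]|[Bz ->]]; last by rewrite Bz addr0.
  by rewrite HE /phi /= Ec -/(M s) -/(L s) mtop Epos// mu0.
- move=> c u uc /andP[u0 ult]; case: (key c u uc u0) => [[s Ec ->]|[Bz ->]]; last first.
    by right; exists u => //; rewrite u0 -(addr0 (mu c)) -Bz.
  rewrite HE /phi /=; have [v0|v0] := ltP (m s u) 0; first by left; exact: Eneg.
  right; exists (m s u); last by rewrite Epos// Ec.
  by rewrite v0 Ec -/(M s) -(mtop s) m_lt// /M /L -Ec.
- move=> y iy; have [[[s v] Ey]|nE] := pselect (exists z, E z = y); last first.
    by rewrite HN// => z Ez; apply: nE; exists z.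
  have v0 : v < 0.
    rewrite ltNge; apply/negP => v0; move: iy; rewrite -Ey Epos//.
    move=> /(intK_sbd surfX nyk)/(_ j) [].
    have [->|un] := eqVneq v 0; first by apply: (sbdP_P nyk); exact: end_sbd surfX nyk _ _ _ _ _ pe (ub s).
    by apply: interior_subset; apply: (end_interior surfX pe (ub s)); rewrite lt_def un.
  by rewrite -Ey HE /phi /=; apply: Eneg; apply: le_lt_trans v0.
Qed.

(** [mu] is a finite sum of bumps that together are positive on the whole circle. The push of one
    bump removes one summand, and the composite brings the level [mu] down to [0]. *)
Lemma collar_push : exists (mu : R * R -> R) (Psi : X -> X),
  [/\ continuous mu, forall c, @unit_circle R c -> 0 < mu c, homeo Psi,
      forall c, @unit_circle R c -> Psi (g (c, mu c)) = g (c, 0) &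
      forall c u, @unit_circle R c -> 0 <= u < mu c -> interior K (Psi (g (c, u)))].
Proof.
have /choice[del Hdel] : forall b0, exists d, @unit_circle R b0 -> collar_datum b0 d.
  move=> b0; have [/collar_datum_exists[d Hd]|nu] := pselect (@unit_circle R b0).
    by exists d.
  by exists 0.
pose lam b0 c := bump (del b0) b0 c.
have clam b0 : continuous (lam b0) by exact: bump_continuous.
pose mus (l : seq (R * R)) c := \sum_(b0 <- l) lam b0 c.
have cmus l : continuous (mus l).
  by rewrite /mus; apply: (@continuous_big R^o) => [|i _]; [exact: add_continuous|exact: clam].
have mus0 l c : 0 <= mus l c.
  by apply: sumr_ge0 => i _; exact: bump_ge0.
have step l : (forall b0, b0 \in l -> @unit_circle R b0) -> exists Psi : X -> X,
  [/\ homeo Psi,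
      forall c, @unit_circle R c -> Psi (g (c, mus l c)) = g (c, 0),
      forall c u, @unit_circle R c -> 0 <= u < mus l c -> interior K (Psi (g (c, u))) &
      forall y, interior K y -> interior K (Psi y)].
  elim: l => [|b0 l IH] ul.
    exists id; split=> //; first exact: homeo_id.
      by move=> c _; rewrite /mus big_nil.
    by move=> c u _ /andP[u0]; rewrite /mus big_nil ltNge u0.
  have [|Psi [hP P1 P2 P3]] := IH.
    by move=> b bl; apply: ul; rewrite inE bl orbT.
  have ub0 : @unit_circle R b0 by apply: ul; rewrite inE eqxx.
  have [chi [hc C1 C2 C3]] := push_step (Hdel b0 ub0) (cmus l) (mus0 l).
  have E c : mus (b0 :: l) c = mus l c + bump (del b0) b0 c.
    by rewrite /mus big_cons addrC.
  exists (Psi \o chi); split.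
  - exact: homeo_comp.
  - by move=> c uc; rewrite /= E C1// P1.
  - move=> c u uc; rewrite E => uu /=.
    by case: (C2 c u uc uu) => [/P3//|[u' u'lt ->]]; exact: P2.
  - by move=> y /C3/P3.
(* Finite lists ordered by inclusion, which turns the near-covering form of compactness into the
   choice of a finite subcover. *)
pose F : set_system (seq (R * R)) := [set S : set (seq (R * R)) | exists2 l0 : seq (R * R),
  (forall b0, b0 \in l0 -> @unit_circle R b0) &
  forall l : seq (R * R), {subset l0 <= l} -> S l].
have FF : Filter F.
  split.
  - by exists [::].
  - move=> A B [l ul Al] [l' ul' Bl']; exists (l ++ l').
      by move=> b0; rewrite mem_cat => /orP[/ul|/ul'].
    move=> m sm; split; [apply: Al|apply: Bl'] => b0 h; apply: sm.
      by rewrite mem_cat h.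
    by rewrite mem_cat h orbT.
  - by move=> A B AB [l ul Al]; exists l => // m /Al/AB.
have := (compact_near_coveringP _).1 (@unit_circle_compact R) _ F
  (fun l c => 0 < mus l c) FF.
case=> [c uc|l ul Hl].
  have lp : 0 < lam c c.
    have [/andP[d0 _] _] := Hdel c uc.
    by rewrite /lam /bump /norm1 subrr /= normr0 addr0 subr0 lt_max d0 orbT.
  have := clam c c _ (lt_nbhsr lp : nbhs _ [set t | 0 < t]) => Nc.
  exists ([set c' | 0 < lam c c'], [set l : seq (R * R) | c \in l]) => /=.
    split; first exact: Nc.
    exists [:: c]; first by move=> b0; rewrite inE => /eqP ->.
    by move=> l; apply; rewrite inE.
  move=> [c' l] /= [lc' cl]; rewrite /mus (big_rem c)//=; apply: (lt_le_trans lc').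
  by rewrite lerDl; apply: sumr_ge0 => i _; exact: bump_ge0.
have [Psi [hP P1 P2 P3]] := step l ul.
exists (mus l), Psi; split=> // c uc.
by apply: (Hl l).
Qed.

(** The plane modulo horizontal translation by [2 * pi] becomes an open annulus around the circle,
    with the sign of the height telling [K] from the pipe. The final clause allows points of [Ua] to
    be located by their height. *)
Definition bicollar (B : R * R -> X) :=
  [/\ continuous B, (forall z N, nbhs z N -> nbhs (B z) (B @` N)),
      (forall z w, B z = B w <-> z.2 = w.2 /\ exists k : int, z.1 = w.1 + 2 * pi * k%:~R),
      (forall z, z.2 < 0 -> interior K (B z)) &
      [/\ forall z, z.2 = 0 -> sbd (P j) (B z) /\ B z = cyl g z,
          forall z, 0 < z.2 -> interior (P j) (B z) &
          forall x, Ua x -> exists2 z, 0 <= z.2 & x = B z]].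

Lemma bicollar_exists : exists B, bicollar B.
Proof.
have [fg oU sU] := pe.
have [mu [Psi [cmu mu0 hP P1 P2]]] := collar_push.
(* As [z.2] goes from [0] to minus infinity, [h] decreases strictly from [mu] towards [0] without
   reaching it; [Psi] sends level [mu] to the circle and all lower levels into [K]. *)
pose h (z : R * R) := mu (cis z.1) / (1 + Num.max 0 (- z.2)).
pose B (z : R * R) := if 0 <= z.2 then cyl g z else Psi (cyl g (z.1, h z)).
have den z : 0 < 1 + Num.max 0 (- z.2) by rewrite ltr_wpDr// le_max lexx.
have h0 z : 0 < h z by rewrite divr_gt0// mu0//; exact: cis_unit.
have hlt z : z.2 < 0 -> h z < mu (cis z.1).
  move=> z0; rewrite ltr_pdivrMr// ltr_pMr; last by apply: mu0; exact: cis_unit.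
  by rewrite ltrDl lt_max oppr_gt0 z0 orbT.
have ccyl := cyl_continuous fg.
have ccis := @cis_continuous R.
have ch : continuous h by rewrite /h; ct => z; rewrite gt_eqF.
have cP := homeo_continuous hP.
have cB : continuous B.
  apply: paste_continuous => //.
  - by ct.
  - by apply: (continuous_compose cP); apply: (continuous_compose ccyl); ct.
  - move=> z z0; rewrite /cyl /= z0 (max_r (ltW (h0 z))) maxxx.
    by rewrite /h z0 oppr0 maxxx addr0 divr1 P1//; exact: cis_unit.
have Bneg z : z.2 < 0 -> B z = Psi (cyl g (z.1, h z)) by move=> z0; rewrite /B leNgt z0.
have Bpos z : 0 <= z.2 -> B z = cyl g z by move=> z0; rewrite /B z0.
have BK z : z.2 < 0 -> interior K (B z).
  move=> z0; rewrite Bneg// /cyl /= max_r ?(ltW (h0 z))//.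
  by apply: P2; [exact: cis_unit|rewrite (ltW (h0 z)) hlt].
have B0 z : z.2 = 0 -> sbd (P j) (B z).
  move=> z0; rewrite Bpos ?z0//.
  by apply/(cyl_sbd surfX (bsurfP nyk j) fg oU) => //; rewrite z0.
have Bp z : 0 < z.2 -> interior (P j) (B z).
  by move=> z0; rewrite Bpos ?(ltW z0)//; apply: (cyl_interior surfX fg oU).
have BP z : 0 <= z.2 -> P j (B z).
  rewrite le_eqVlt => /orP[/eqP/esym/B0/(sbdP_P nyk)//|/Bp]; exact: interior_subset.
have Beq z w : B z = B w <-> z.2 = w.2 /\ exists k : int, z.1 = w.1 + 2 * pi * k%:~R.
  split; last first.
    move=> [E2 [k E1]]; have Ec : cis z.1 = cis w.1 by rewrite E1 cis_periodic.
    by rewrite /B E2 /cyl /h /= Ec E2.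
  case: (ltP z.2 0) => z0; case: (ltP w.2 0) => w0 E.
  - move: E; rewrite !Bneg// => /(homeo_inj hP) /(cyl_inj fg (z := (z.1, h z)) (w := (w.1, h w)) (ltW (h0 z)) (ltW (h0 w))) /=.
    move=> [Eh [k Ek]]; split; last by exists k.
    have Ec : cis z.1 = cis w.1 by rewrite Ek cis_periodic.
    move: Eh; rewrite /h Ec => /mulfI; rewrite gt_eqF ?mu0 //; last exact: cis_unit.
    move=> /(_ isT) /invr_inj /addrI; rewrite !max_r ?oppr_ge0 ?ltW//.
    exact: oppr_inj.
  - by have := intK_sbd surfX nyk (BK z z0) (i := j); rewrite E => /(_ (BP w w0)).
  - by have := intK_sbd surfX nyk (BK w w0) (i := j); rewrite -E => /(_ (BP z z0)).
  - by apply: (cyl_inj fg) => //; rewrite -!Bpos.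
exists B; split=> //; last first.
  split=> // [z z0|x /(cyl_surj fg)[z [z0 ->]]]; last by exists z => //; rewrite Bpos.
  by split; [exact: B0|rewrite Bpos// z0].
move=> z N /nbhs_disk[r r0 rN].
have m0 : 0 < Num.min r 1 by rewrite lt_min r0 ltr01.
have sub : closed_disk z (Num.min r 1) `<=` closed_disk z r.
  by apply: disk_sub; rewrite (ltW m0) ge_min lexx.
have sub1 : closed_disk z (Num.min r 1) `<=` closed_disk z 1.
  by apply: disk_sub; rewrite (ltW m0) ge_min lexx orbT.
apply: (@filterS _ (nbhs (B z)) _ (B @` closed_disk z (Num.min r 1))).
  by move=> _ [w /sub/rN Nw <-]; exists w.
apply: (invdom_plane surfX) => //; first by apply: continuous_subspaceT.
move=> a b /sub1/(disk_coord ler01)[a1 _] /sub1/(disk_coord ler01)[b1 _].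
move=> /Beq[E2 [k /period_close E1]]; rewrite (pairE a) (pairE b) E2 E1//.
by move: a1 b1; rewrite !ler_norml => /andP[? ?] /andP[? ?]; apply/andP; split; lra.
Qed.

End Bicollar.

(** * Pushing and twisting along the collars *)

Section Band.
Variables (R : realType) (X : topologicalType) (K : set X) (n : nat) (P : 'I_n -> set X).
Hypothesis surfX : surface R X.
Hypothesis nyk : nyikos_decomposition R K P.
Implicit Types (x y : X) (i j k : 'I_n) (z w : R * R).

Local Notation sbd := (sbd R).

Section OneBicollar.
Variables (j : 'I_n) (f : X -> (R * R) * R) (g : (R * R) * R -> X) (Ua : set X)
  (B : R * R -> X).
Hypothesis pe : pipe_end P j f g Ua.
Hypothesis bB : bicollar K P j g Ua B.

Lemma bicollar_K z : K (B z) <-> z.2 <= 0.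
Proof.
have [_ _ _ Bn [B0 Bp _]] := bB; split=> [Kz|z0].
  by rewrite leNgt; apply/negP => /Bp /(intP_K surfX nyk).
move: z0; rewrite le_eqVlt => /orP[/eqP/B0[/(sbdP_K nyk)]//|/Bn]; exact: interior_subset.
Qed.

Lemma bicollar_P z : P j (B z) <-> 0 <= z.2.
Proof.
have [_ _ _ Bn [B0 Bp _]] := bB; split=> [Pz|z0].
  by rewrite leNgt; apply/negP => /Bn h; exact: (intK_sbd surfX nyk h Pz).
by move: z0; rewrite le_eqVlt => /orP[/eqP/esym/B0[/(sbdP_P nyk)]//|/Bp]; exact: interior_subset.
Qed.

Lemma bicollar_other k z : k != j -> ~ P k (B z).
Proof.
have [_ _ _ Bn _] := bB; move=> kj Pk.
have [z0|z0] := ltP z.2 0; first exact: (intK_sbd surfX nyk (Bn z z0) Pk).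
by have := disjP nyk Pk ((bicollar_P z).2 z0) => E; rewrite E eqxx in kj.
Qed.

Lemma bicollar_sbd x : sbd (P j) x -> exists t, x = B (t, 0).
Proof.
have [_ _ Beq _ [_ _ Bs]] := bB; have [_ _ sU] := pe.
move=> jx; have [z z0 Ex] := Bs _ (sU _ jx).
have z20 : z.2 = 0.
  apply/eqP; rewrite eq_le z0 andbT; apply/bicollar_K; rewrite -Ex.
  exact: (sbdP_K nyk jx).
by exists z.1; rewrite Ex {1}(pairE z) z20.
Qed.

(** Equivariance under the period lets the plane maps descend to the annulus, and reducing the angle
    to one period shows that the support has compact, hence closed, image. *)
Lemma band_isotopy (phi psi : R -> R * R -> R * R) (M : R) :
  (forall t z (k : int), phi t (z.1 + 2 * pi * k%:~R, z.2) =
     ((phi t z).1 + 2 * pi * k%:~R, (phi t z).2)) ->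
  (forall t z (k : int), psi t (z.1 + 2 * pi * k%:~R, z.2) =
     ((psi t z).1 + 2 * pi * k%:~R, (psi t z).2)) ->
  continuous (fun v : R * (R * R) => phi v.1 v.2) ->
  (forall t z, phi t (psi t z) = z) -> (forall t z, psi t (phi t z) = z) ->
  (forall t z, M <= `|z.2| -> phi t z = z) ->
  exists H : R -> X -> X, [/\ isotopy H, forall t z, H t (B z) = B (phi t z) &
    forall t x, (forall z, B z <> x) -> H t x = x].
Proof.
move=> ephi epsi cphi K1 K2 supp; have [cB oB Beq _ _] := bB.
have equi (chi : R -> R * R -> R * R) :
    (forall t z (k : int), chi t (z.1 + 2 * pi * k%:~R, z.2) =
     ((chi t z).1 + 2 * pi * k%:~R, (chi t z).2)) ->
    forall t z w, B z = B w -> B (chi t z) = B (chi t w).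
  move=> ec t z w /Beq[E2 [k E1]]; rewrite (pairE z) E1 E2 ec.
  by apply/Beq; split=> //; exists k.
pose C : set (R * R) := [set z | `|z.2| <= M].
pose C' : set (R * R) := `[0, 2 * pi] `*` `[- M, M].
have EC : B @` C = B @` C'.
  apply/seteqP; split=> _ [z Cz <-]; last first.
    exists z => //; move: Cz => -[_] /=; rewrite in_itv /=.
    by rewrite /C /= ler_norml.
  have [k /andP[h1 h2]] := period_reduce z.1.
  exists (z.1 + 2 * pi * k%:~R, z.2); last by apply/Beq; split=> //; exists k.
  by split; rewrite /= in_itv /= -?ler_norml// h1 ltW.
apply: (@extend_isotopy R X surfX B phi psi C) => //.
- exact: equi.
- exact: equi.
- by move=> t z; rewrite K1.
- by move=> t z; rewrite K2.
- rewrite EC; apply: compact_closed; first exact: (hausX surfX).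
  apply: continuous_compact; first by apply: continuous_subspaceT.
  by apply: compact_setX; exact: segment_compact.
- move=> t z nC; apply: supp; rewrite leNgt; apply/negP => lt; apply: nC.
  exact: ltW.
Qed.

End OneBicollar.

(** [T] raises the circle above every height at which [Q] meets the pipe. The clauses on
    [interior K] and on the other pipes make such pushes composable from pipe to pipe. *)
Lemma push_one (Q : set X) i : compact Q -> exists T : X -> X,
  [/\ isotopic R id T, forall x, interior K x -> exists2 y, interior K y & T y = x,
      forall x, Q x -> P i x -> exists2 y, interior K y & T y = x &
      forall k x, k != i -> P k x -> T x = x].
Proof.
move=> cQ.
have cQi : compact (Q `&` P i).
  by apply: compact_closedI => //; exact: (closedP surfX nyk).
have [f [g [Ua [pe QU]]]] := pipe_end_exists nyk cQi (@subIsetr _ Q (P i)).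
have [B bB] := bicollar_exists surfX nyk pe.
have [cB oB Beq Bn [B0 Bp Bs]] := bB.
have [s s0 Hs] : exists2 s : R, 0 < s & forall z, Q (B z) -> P i (B z) -> z.2 < s.
  have := (compact_near_coveringP _).1 cQi R (pinfty_nbhs R)
    (fun s x => forall z, B z = x -> z.2 < s) _.
  case=> [x QPx|s [_ Hs]].
    have [z z0 Ex] := Bs _ (QU _ QPx).
    exists (B @` [set w | w.2 < z.2 + 1], [set s | z.2 + 1 < s]) => /=.
      split; last by exists (z.2 + 1); split; [exact: num_real|].
      rewrite Ex; apply: oB.
      have lt : z.2 < z.2 + 1 by lra.
      have cs : continuous (fun z : R * R => z.2) by ct.
      exact: (cs z _ (lt_nbhsl lt : nbhs _ [set t | t < z.2 + 1])).
    move=> [y s] /= [[w wlt <-] slt] v /Beq[-> _].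
    exact: lt_trans slt.
  exists (Num.max 1 (s + 1)); first by rewrite lt_max ltr01.
  move=> z Qz Pz; rewrite lt_max; apply/orP; right.
  have sl : s < s + 1 by rewrite ltrDl.
  exact: (Hs _ sl (B z) (conj Qz Pz) z erefl).
pose c t := clamp01 t * s.
have c0 t : 0 <= c t <= s.
  have /andP[t0 t1] := clamp01_itv t.
  by rewrite /c mulr_ge0 ?(ltW s0)//= -[leRHS]mul1r ler_wpM2r// ltW.
have cc : continuous c by have := @clamp01_continuous R => ?; rewrite /c; ct.
have s20 : 0 < 2 * s by rewrite mulr_gt0.
(* The tent is stretched to half-width [2 * s] so that a displacement of at most [s] changes the
   slope by at most [1 / 2]; at time [1] height [0] rises to [s]. *)
pose m t u := u + c t * tent (u / (2 * s)).
have cm t : continuous (m t) by have := @tent_continuous R => ?; rewrite /m; ct.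
have m_lt t u v : u < v -> m t u < m t v.
  move=> uv; have /andP[ct0 cts] := c0 t.
  have := tent_lip (v / (2 * s)) (u / (2 * s)).
  have d0 : 0 <= (v - u) / (2 * s) by apply: divr_ge0; [rewrite subr_ge0|]; exact: ltW.
  rewrite -mulrBl [X in _ <= X]ger0_norm//.
  rewrite ler_norml => /andP[h _].
  have h1 : c t * (tent (u / (2 * s)) - tent (v / (2 * s))) <= c t * ((v - u) / (2 * s)).
    by rewrite ler_wpM2l//; lra.
  have h2 : c t * ((v - u) / (2 * s)) <= s * ((v - u) / (2 * s)).
    by rewrite ler_wpM2r.
  have h3 : s * ((v - u) / (2 * s)) = (v - u) / 2 by field; rewrite gt_eqF.
  by rewrite /m; lra.
have m_ge t u : u <= m t u.
  by rewrite /m lerDl mulr_ge0 ?tent_ge0//; case/andP: (c0 t).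
have m_near t u : `|m t u - u| <= s.
  rewrite /m addrAC subrr add0r; have /andP[ct0 cts] := c0 t.
  rewrite ger0_norm; last by apply: mulr_ge0 => //; exact: tent_ge0.
  apply: le_trans cts; rewrite -[leRHS]mulr1.
  by apply: ler_wpM2l => //; exact: tent_le1.
have /choice[m' Hm'] : forall t, exists m' : R -> R,
    (forall u, m' (m t u) = u) /\ (forall v, m t (m' v) = v).
  by move=> t; exact: (near_id_bij (cm t) (m_lt t) (m_near t)).
have [||||||H [iH HE HN]] := @band_isotopy i g Ua B bB
  (fun t z => (z.1, m t z.2)) (fun t z => (z.1, m' t z.2)) (2 * s).
- by [].
- by [].
- by have := @tent_continuous R => ?; rewrite /m; ct.
- by move=> t z /=; have [_ ->] := Hm' t; rewrite -pairE.
- by move=> t z /=; have [-> _] := Hm' t; rewrite -pairE.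
- move=> t z sz; rewrite /m tent_out ?mulr0 ?addr0 -?pairE//.
  by rewrite normrM [X in _ * X]ger0_norm ?invr_ge0 ?(ltW s20)// ler_pdivlMr// mul1r.
have m'_le t v : m' t v <= v by have [_ E] := Hm' t; rewrite -{2}(E v) m_ge.
have H0 : H 0 = id.
  apply/funext => x; have [[z <-]|nx] := pselect (exists z, B z = x).
    by rewrite HE /m /c clamp010 !mul0r addr0 -pairE.
  by apply: HN => z Ez; apply: nx; exists z.
have H1 z : H 1 (B (z.1, m' 1 z.2)) = B z.
  by rewrite HE /=; have [_ ->] := Hm' 1; rewrite -pairE.
exists (H 1); split.
- by apply/isotopyP; exists H.
- move=> x Kx; have [[z Ez]|nx] := pselect (exists z, B z = x); last first.
    by exists x => //; apply: HN => z Ez; apply: nx; exists z.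
  exists (B (z.1, m' 1 z.2)); last by rewrite H1.
  apply: Bn => /=; apply: le_lt_trans (m'_le 1 z.2) _.
  rewrite ltNge; apply/negP => z0.
  by apply: (intK_sbd surfX nyk Kx (i := i)); rewrite -Ez; apply/(bicollar_P bB).
- move=> x Qx Px; have [z z0 Ez] := Bs _ (QU _ (conj Qx Px)).
  exists (B (z.1, m' 1 z.2)); last by rewrite H1.
  have zs : z.2 < s by apply: Hs; rewrite -Ez.
  apply: Bn => /=; rewrite ltNge; apply/negP => v0.
  have : m 1 0 <= m 1 (m' 1 z.2).
    by move: v0; rewrite le_eqVlt => /orP[/eqP <-//|/(m_lt 1)/ltW].
  have [_ ->] := Hm' 1.
  by rewrite /m /c clamp011 mul0r tent0 !mul1r mulr1 add0r leNgt zs.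
- move=> k x ki Pk; apply: HN => z Ez.
  by apply: (bicollar_other bB (z := z) ki); rewrite Ez.
Qed.

Lemma push_all (Q : set X) : compact Q -> exists T : X -> X,
  isotopic R id T /\ forall x, Q x -> exists2 y, interior K y & T y = x.
Proof.
move=> cQ.
have step (l : seq 'I_n) : exists T : X -> X,
  [/\ isotopic R id T, forall x, interior K x -> exists2 y, interior K y & T y = x &
      forall i x, i \in l -> Q x -> P i x -> exists2 y, interior K y & T y = x].
  elim: l => [|i l [T' [iT' KT' QT']]].
    by exists id; split=> //; [exact: (isotopic_refl R (@homeo_id X))|move=> x Kx; exists x].
  have [T [iT KT QT fT]] := push_one i cQ.
  exists (T \o T'); split.
  - exact: (isotopic_comp iT iT').
  - move=> x /KT[y /KT'[y' Ky' <-] <-]; by exists y'.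
  - move=> k x; rewrite inE; have [-> _ Qx Px|ki /= kl Qx Px] := eqVneq k i.
      by have [y /KT'[y' Ky' <-] <-] := QT x Qx Px; exists y'.
    have [y Ky Ey] := QT' k x kl Qx Px; exists y => //=.
    by rewrite Ey; exact: (fT k).
have [T [iT KT QT]] := step (enum 'I_n).
exists T; split=> // x Qx.
have [Kx|[i ix]] := trichotomy surfX nyk x; first exact: KT.
apply: (QT i) => //; first by rewrite mem_enum.
by case: ix => [/(sbdP_P nyk)|/interior_subset].
Qed.

Lemma preservesP h : homeo h -> preserves K P h <->
  (forall x, K x <-> K (h x)) /\ forall i x, P i x <-> P i (h x).
Proof.
move=> hh; have hi := homeo_inj hh; have [g [_ _ _ K2]] := hh.
have im (A : set X) : h @` A = A <-> forall x, A x <-> A (h x).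
  split=> [E x|H].
    split=> [Ax|]; first by rewrite -E; exists x.
    by rewrite -{1}E => -[y Ay /hi <-].
  apply/seteqP; split=> [_ [x Ax <-]|x Ax]; first by apply: (H x).1.
  by exists (g x); [apply: (H (g x)).2; rewrite K2|].
split=> [[/im HK HP]|[HK HP]]; split=> //.
- by move=> i; apply/im.
- by apply/im.
- by move=> i; apply/im; exact: HP.
Qed.

Lemma preserves_sbd h i x : homeo h -> preserves K P h -> sbd (P i) x ->
  sbd (P i) (h x).
Proof.
move=> hh /(preservesP hh)[HK HP]; rewrite -!(KP nyk) => -[Kx Px].
by split; [apply: (HK x).1|apply: (HP i x).1].
Qed.

Lemma preserves_intK h x : homeo h -> preserves K P h -> interior K x ->
  interior K (h x).
Proof.
move=> hh hp; have [HK HP] := (preservesP hh).1 hp.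
move=> iK; case: (trichotomy surfX nyk (h x)) => // -[i Hi]; exfalso.
apply: (intK_sbd surfX nyk iK (i := i)); apply: (HP i x).2.
by case: Hi => [/(sbdP_P nyk)|/interior_subset].
Qed.

Lemma preserves_intP h i x : homeo h -> preserves K P h -> interior (P i) x ->
  interior (P i) (h x).
Proof.
move=> hh hp; have [HK HP] := (preservesP hh).1 hp => iP.
have /(notK surfX nyk)[k ik] : ~ K (h x) by move=> /(HK x).2; exact: (intP_K surfX nyk iP).
suff -> : i = k by [].
apply: (disjP nyk (x := h x)); last exact: interior_subset.
by apply: (HP i x).1; exact: interior_subset.
Qed.

Lemma preserves_comp h h' : preserves K P h -> preserves K P h' ->
  preserves K P (h \o h').
Proof.
by move=> [E F] [E1 F1]; split=> [|i]; rewrite -image_comp ?E1 ?F1.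
Qed.

End Band.

(** * Lifts of injective maps of the circle *)

Section CircleMaps.
Variable R : realType.
Variables (L : R -> R) (m : int).
Hypothesis cL : continuous L.
Hypothesis Lper : forall t, L (t + 2 * pi) = L t + 2 * pi * m%:~R.
Hypothesis Lmod : forall s t (k : int), L s = L t + 2 * pi * k%:~R ->
  exists k' : int, s = t + 2 * pi * k'%:~R.

Lemma period_int (k : int) : 0 <= (2 * pi * k%:~R : R) <= 2 * pi -> k = 0 \/ k = 1.
Proof.
have p0 := @two_pi_gt0 R; rewrite pmulr_rge0// ler0z ger_pMr// lerz1 => /andP[h1 h2]; lia.
Qed.

Lemma IVT_val (a b v : R) : a <= b -> (L a <= v <= L b \/ L b <= v <= L a) ->
  exists2 c, a <= c <= b & L c = v.
Proof.
move=> ab H; have [|c] := @IVT R L a b v ab (continuous_subspaceT cL).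
  by rewrite ge_min le_max; case: H => /andP[-> ->]; rewrite ?orbT.
by rewrite in_itv /= => cab <-; exists c.
Qed.

(** In degree [0] the mean of [L 0] and [L pi] would be attained on both halves of a period,
    contradicting injectivity on the circle. *)
Lemma circle_map_neq0 : m != 0.
Proof.
have p0 := @two_pi_gt0 R; have pp := @pi_gt0 R.
apply/eqP => m0; have E : L (2 * pi) = L 0.
  by have := Lper 0; rewrite add0r m0 mulr0 addr0.
have nE : L pi <> L 0.
  move=> E1; have [|k Ek] := @Lmod pi 0 0; first by rewrite E1 mulr0 addr0.
  have [] := @period_int k; first by apply/andP; split; lra.
    by move=> k0; move: Ek; rewrite k0 mulr0; lra.
  by move=> k1; move: Ek; rewrite k1 mulr1; lra.
pose v := (L 0 + L pi) / 2.
have [c1 /andP[c10 c1p] Ec1] : exists2 c, 0 <= c <= pi & L c = v.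
  apply: IVT_val; first exact: ltW.
  by rewrite /v; case: (leP (L 0) (L pi)) => h; [left|right]; apply/andP; split; lra.
have [c2 /andP[c20 c2p] Ec2] : exists2 c, pi <= c <= 2 * pi & L c = v.
  apply: IVT_val; first by lra.
  by rewrite /v E; case: (leP (L 0) (L pi)) => h; [right|left]; apply/andP; split; lra.
have [|k Ek] := @Lmod c2 c1 0; first by rewrite Ec1 Ec2 mulr0 addr0.
have [|k0|k1] := @period_int k; first by apply/andP; split; lra.
  have Epi : c1 = pi by move: Ek; rewrite k0 mulr0; lra.
  by apply: nE; move: Ec1; rewrite Epi /v; lra.
have Ez : c1 = 0 by move: Ek; rewrite k1 mulr1; lra.
by apply: nE; move: Ec1; rewrite Ez /v; lra.
Qed.

Lemma circle_map_perz t (k : int) :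
  L (t + 2 * pi * k%:~R) = L t + 2 * pi * (m * k)%:~R.
Proof.
have En s (n : nat) : L (s + 2 * pi * n%:R) = L s + 2 * pi * m%:~R * n%:R.
  elim: n => [|n IH]; first by rewrite !mulr0 !addr0.
  rewrite -[n.+1%:R]natr1 mulrDr mulr1 addrA Lper IH; ring.
rewrite intrM mulrA; case: k => n; first exact: En.
rewrite NegzE mulrNz; have := En (t + 2 * pi * - n.+1%:R) n.+1.
by rewrite -addrA -mulrDr addNr mulr0 addr0 => ->; ring.
Qed.

Lemma circle_map_inj : injective L.
Proof.
move=> s t E; have [|k Ek] := @Lmod s t 0; first by rewrite mulr0 addr0.
move: E; rewrite Ek circle_map_perz => E.
have : 2 * pi * (m * k)%:~R = 0 :> R by lra.
move/eqP; rewrite mulf_eq0 gt_eqF ?two_pi_gt0//= intr_eq0 mulf_eq0.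
by rewrite (negbTE circle_map_neq0) /= => /eqP ->; rewrite mulr0 addr0.
Qed.

(** One of the values [L 0 + 2 * pi] and [L 0 - 2 * pi] is attained within the period. Injectivity
    on the circle allows this only at its right end. *)
Lemma circle_map_degree : m = 1 \/ m = -1.
Proof.
have p0 := @two_pi_gt0 R.
have Ep : L (2 * pi) = L 0 + 2 * pi * m%:~R by have := Lper 0; rewrite add0r.
have hit (k : int) : k = 1 \/ k = -1 ->
    (L 0 <= L 0 + 2 * pi * k%:~R <= L (2 * pi) \/ L (2 * pi) <= L 0 + 2 * pi * k%:~R <= L 0) ->
    m = 1 \/ m = -1.
  move=> k1 /(IVT_val (ltW p0))[c c01 Ec].
  have [k' Ek'] := Lmod Ec; rewrite add0r in Ek'.
  have [||k0] := @period_int k'; first by rewrite -Ek'.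
    move=> k0; exfalso; move: Ec; rewrite Ek' k0 mulr0 => Ec.
    have : 2 * pi * k%:~R = 0 :> R by lra.
    by move/eqP; rewrite mulf_eq0 gt_eqF//= intr_eq0; case: k1 => ->.
  move: Ec; rewrite Ek' k0 mulr1 Ep => /addrI /twopi_inj ->; exact: k1.
have m0 := circle_map_neq0.
have [mp|mn] : (1 <= m)%R \/ (m <= -1)%R by lia.
  apply: (hit 1); first by left.
  left; rewrite Ep; have : 1 <= m%:~R :> R by rewrite ler1z.
  move=> h; have : 2 * pi * 1 <= 2 * pi * m%:~R :> R by rewrite ler_pM2l.
  by move=> h2; apply/andP; split; lra.
apply: (hit (-1)); first by right.
right; rewrite Ep; have : m%:~R <= -1 :> R by rewrite -[-1]/((-1)%:~R) ler_int.
move=> h; have : 2 * pi * m%:~R <= 2 * pi * -1 :> R by rewrite ler_pM2l.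
by move=> h2; rewrite mulrNz; apply/andP; split; lra.
Qed.

Lemma circle_map_incr : m = 1 -> forall s t, s < t -> L s < L t.
Proof.
move=> m1 s t st; have p0 := @two_pi_gt0 R.
have mono : {in `]-oo, +oo[ &, {mono L : x y / x <= y}}.
  apply: itv_continuous_inj_le; last first.
  - by move=> x y _ _; exact: circle_map_inj.
  - exact: continuous_subspaceT.
  exists 0, (2 * pi); split=> //; rewrite ?in_itv//.
  by have := Lper 0; rewrite add0r m1 mulr1 => ->; lra.
by rewrite lt_neqAle mono ?in_itv// (ltW st) andbT; apply/eqP => /circle_map_inj E; rewrite E ltxx in st.
Qed.

Lemma circle_map_decr : m = -1 -> forall s t, s < t -> L t < L s.
Proof.
move=> m1 s t st; have p0 := @two_pi_gt0 R.
have mono : {in `]-oo, +oo[ &, {mono L : x y /~ x <= y}}.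
  apply: itv_continuous_inj_ge; last first.
  - by move=> x y _ _; exact: circle_map_inj.
  - exact: continuous_subspaceT.
  exists 0, (2 * pi); split=> //; rewrite ?in_itv//.
  by have := Lper 0; rewrite add0r m1 mulrN1 => ->; lra.
by rewrite lt_neqAle mono ?in_itv// (ltW st) andbT; apply/eqP => /circle_map_inj E; rewrite E ltxx in st.
Qed.

(** Over one period the displacement [L t - t] drops by [4 * pi], so it passes through a multiple of
    [2 * pi]. *)
Lemma circle_map_fixed : m = -1 -> exists c (k : int), L c = c + 2 * pi * k%:~R.
Proof.
move=> m1; have p0 := @two_pi_gt0 R.
have [k /andP[h1 h2]] := period_reduce (L 0).
have cD : continuous (fun t => L t - t) by ct.
have E : L (2 * pi) = L 0 - 2 * pi by have := Lper 0; rewrite add0r m1 mulrN1.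
have [|c _ Ec] := @IVT R (fun t => L t - t) 0 (2 * pi) (- (2 * pi * k%:~R)) (ltW p0)
  (continuous_subspaceT cD).
  by rewrite E subr0 ge_min le_max; apply/andP; split; apply/orP; [right|left]; lra.
by exists c, (- k); rewrite mulrNz; lra.
Qed.

End CircleMaps.

(** * Orientation and untwisting on the bounding circles *)

Section Twist.
Variables (R : realType) (X : topologicalType) (O : set (chart R X))
  (K : set X) (n : nat) (P : 'I_n -> set X).
Hypothesis surfX : surface R X.
Hypothesis orO : is_orientation O.
Hypothesis nyk : nyikos_decomposition R K P.
Implicit Types (x y : X) (i j k : 'I_n) (z w : R * R).

Local Notation sbd := (sbd R).

Section OneCircle.
Variables (j : 'I_n) (f : X -> (R * R) * R) (g : (R * R) * R -> X) (Ua : set X)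
  (B : R * R -> X) (h : X -> X).
Hypothesis pe : pipe_end P j f g Ua.
Hypothesis bB : bicollar K P j g Ua B.
Hypothesis hh : homeo h.
Hypothesis hp : preserves K P h.

Lemma circle_lift : exists L : R -> R, continuous L /\
  forall t, h (B (t, 0)) = B (L t, 0).
Proof.
have [cB _ _ _ [B0 _ _]] := bB; have [fg oU sU] := pe.
have hs t : sbd (P j) (h (B (t, 0))).
  by apply: (preserves_sbd nyk hh hp); case: (B0 (t, 0) erefl).
pose F (z : R * R) := (f (h (B (z.1, 0)))).1.
have cF : continuous F.
  have ch := homeo_continuous hh.
  have c1 : continuous (fun z : R * R => h (B (z.1, 0))).
    by apply: (continuous_compose ch); apply: (continuous_compose cB); ct.
  have [cf _ _ _ _] := fg.
  have c2 : continuous (fun z : R * R => f (h (B (z.1, 0)))).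
    by apply: (within_comp_continuous cf c1) => z; exact: sU.
  exact: (continuous_compose (@continuous_fst1 _ _) c2).
have uF z : @unit_circle R (F z) by have [_ []] := end_height0 surfX nyk pe (hs z.1).
have F0 z : F z != 0.
  apply/eqP => E; have := uF z; rewrite E /unit_circle /= expr0n /= addr0 => /eqP.
  by rewrite eq_sym oner_eq0.
have [Th [cTh HTh]] := lift_exists cF F0.
exists (fun t => Th (t, 0)); split; first by apply: (continuous_compose cTh); ct.
move=> t; have [_ [_ <-]] := end_height0 surfX nyk pe (hs t).
have [_ ->] := B0 (Th (t, 0), 0) erefl.
rewrite /cyl /= maxxx; congr (g (_, _)).
have := ang_norm (HTh (t, 0)); rewrite -/(F (t, 0)).
have -> : dot (F (t, 0)) (F (t, 0)) = 1 by have := uF (t, 0); rewrite /dot -!expr2.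
by rewrite sqrtr1 !mul1r.
Qed.

Lemma circle_lift_degree (L : R -> R) : continuous L ->
  (forall t, h (B (t, 0)) = B (L t, 0)) ->
  exists2 m : int, forall t, L (t + 2 * pi) = L t + 2 * pi * m%:~R &
  forall s t (k : int), L s = L t + 2 * pi * k%:~R ->
    exists k' : int, s = t + 2 * pi * k'%:~R.
Proof.
move=> cL EL; have [_ _ Beq _ _] := bB.
have cD : continuous (fun t => L (t + 2 * pi) - L t).
  by apply: continuous_add; [apply: (continuous_compose cL)|]; ct.
have kD t : exists k : int, L (t + 2 * pi) - L t = 2 * pi * k%:~R.
  have [_ [k /= Ek]] : (0 : R) = 0 /\ exists k : int, L (t + 2 * pi) = L t + 2 * pi * k%:~R.
    apply: (Beq (L (t + 2 * pi), 0) (L t, 0)).1; rewrite -!EL; congr (h _).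
    by apply/Beq; split=> //; exists 1; rewrite mulr1.
  by exists k; rewrite Ek addrAC subrr add0r.
have [m Em] := kD 0; exists m.
  by move=> t; rewrite -Em; have /= := twopi_const cD kD t 0; lra.
move=> s t k Ek.
have [_ //] : (0 : R) = 0 /\ exists k' : int, s = t + 2 * pi * k'%:~R.
apply: (Beq (s, 0) (t, 0)).1; apply: (homeo_inj hh); rewrite !EL.
by apply/Beq; split=> //; exists k.
Qed.

(* At a fixed point of an orientation reversing circle map, [h] would have local
   degree [-1] in bicollar coordinates, hence in every chart, since the degree
   of the coordinate change is odd and so can be cancelled. *)
Lemma circle_lift_orient (L : R -> R) (m : int) : MF_rep O h -> continuous L ->
  (forall t, h (B (t, 0)) = B (L t, 0)) ->
  (forall t, L (t + 2 * pi) = L t + 2 * pi * m%:~R) ->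
  (forall s t (k : int), L s = L t + 2 * pi * k%:~R ->
    exists k' : int, s = t + 2 * pi * k'%:~R) -> m = 1.
Proof.
move=> mh cL EL Lper Lmod.
have [//|m1] := circle_map_degree cL Lper Lmod; exfalso.
have [c [k Ec]] := circle_map_fixed cL Lper m1.
have decr := circle_map_decr cL Lper Lmod m1.
have [cB oB Beq Bn [B0 Bp _]] := bB.
have p2 := @pi_ge2 R; have pp0 := @two_pi_gt0 R.
(* Another lift of the same circle map, fixing [c] itself and not only its class modulo the
   period. *)
pose L' t := L t - 2 * pi * k%:~R.
have L'c : L' c = c by rewrite /L' Ec; ring.
have cL' : continuous L' by rewrite /L'; ct.
have EL' t : h (B (t, 0)) = B (L' t, 0).
  rewrite EL; apply/Beq; split=> //; exists k; rewrite /L' /=; ring.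
pose q : R * R := (c, 0); set x0 := B q.
have hx0 : h x0 = x0 by rewrite /x0 EL' L'c.
have d1 z r : 0 <= r -> closed_disk q r z -> `|z.1 - c| <= r.
  by move=> r0 /(disk_coord r0)[].
have inj1 a b : `|a.1 - c| <= 1 -> `|b.1 - c| <= 1 -> B a = B b -> a = b.
  rewrite !ler_norml => /andP[a1 a2] /andP[b1 b2] /Beq[E2 [l E1]].
  rewrite (pairE a) (pairE b) E2 (period_close E1)//.
  by rewrite ler_norml; apply/andP; split; lra.
have ch := homeo_continuous hh.
have chB : continuous (fun z => h (B z)) by exact: (continuous_compose ch cB).
have half0 : 0 < 1 / 2 :> R by lra.
have NB : nbhs (h (B q)) (B @` closed_disk q (1 / 2)).
  by rewrite -/x0 hx0; apply: oB; exact: disk_nbhs.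
have NL : nbhs q [set z | `|L' z.1 - c| < 1].
  have cl : continuous (fun z : R * R => `|L' z.1 - c|) by ct.
  have lt0 : `|L' q.1 - c| < 1 by rewrite /= L'c subrr normr0.
  exact: (cl q _ (lt_nbhsl lt0 : nbhs _ [set t | t < 1])).
have NhB : nbhs q [set z | (B @` closed_disk q (1 / 2)) (h (B z))] by exact: (chB q _ NB).
have [r r0 rD] := nbhs_disk (filterI (filterI NhB NL) (disk_nbhs q half0)).
(* [F] is [h] read in bicollar coordinates, on the branch near [q]; its values outside the disk are
   arbitrary. *)
have /choice[F HF] : forall z, exists w, closed_disk q r z ->
    closed_disk q (1 / 2) w /\ B w = h (B z).
  move=> z; have [/rD[[[w Dw Ew] _] _]|nD] := pselect (closed_disk q r z).
    by exists w.
  by exists z.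
have F1 z : closed_disk q r z -> `|(F z).1 - c| <= 1.
  by move=> /HF[Df _]; apply: le_trans (d1 _ _ (ltW half0) Df) _; lra.
have EF z : closed_disk q r z -> B (F z) = h (B z) by move=> /HF[].
have emF : emb F q r.
  split=> //.
    apply/subspace_continuousP => z Dz N NF.
    have [DF BF] := HF _ Dz.
    have ltr1 : (F z).1 - c < 1 /\ -1 < (F z).1 - c.
      by have := d1 _ _ (ltW half0) DF; rewrite ler_norml => /andP[? ?]; split; lra.
    have N1 : nbhs (F z) (N `&` [set w | `|w.1 - c| < 1]).
      apply: filterI => //.
      have cl : continuous (fun w : R * R => `|w.1 - c|) by ct.
      have lt0 : `|(F z).1 - c| < 1 by rewrite ltr_norml; apply/andP; split; lra.
      exact: (cl (F z) _ (lt_nbhsl lt0 : nbhs _ [set t | t < 1])).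
    have N2 : nbhs (h (B z)) (B @` (N `&` [set w | `|w.1 - c| < 1])).
      by rewrite -BF; exact: oB.
    have := chB z _ N2; rewrite /within /=; apply: (@filterS _ (nbhs z)) => y [w [Nw w1] Ew] Dy.
    have Fy : F y = w by apply: inj1; [exact: F1|exact: ltW|rewrite EF].
    by have : N (F y) by rewrite Fy.
  move=> a b Da Db E.
  have Eh : B a = B b by apply: (homeo_inj hh); rewrite -!EF// E.
  have [_ D1] := rD _ Da; have [_ D2] := rD _ Db.
  apply: inj1 => //; first by apply: le_trans (d1 _ _ (ltW half0) D1) _; lra.
  by apply: le_trans (d1 _ _ (ltW half0) D2) _; lra.
have Dq := disk_center q r.
have Fq : F q = q.
  apply: inj1; [exact: F1|by rewrite subrr normr0|].
  by rewrite EF//; exact: hx0.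
have degF : deg F q (-1).
  apply: (deg_reflection emF) => z Dz; rewrite Fq.
  have [[_ zL] D1] := rD _ Dz.
  have Faxis : z.2 = 0 -> (F z).2 = 0 /\ (F z).1 = L' z.1.
    move=> z20; have : B (F z) = B (L' z.1, 0) by rewrite EF// (pairE z) z20 EL'.
    move=> E; have [E2 _] := (Beq _ _).1 E; split; first exact: E2.
    have := inj1 _ (L' z.1, 0) (F1 _ Dz) (ltW zL) E.
    by move=> ->.
  split=> /=.
  - move=> z2; rewrite ltNge; apply/negP => f2.
    have : K (B (F z)) by apply/(bicollar_K surfX nyk bB).
    rewrite EF//; apply: (intP_K surfX nyk (i := j)).
    by apply: (preserves_intP surfX nyk hh hp); exact: Bp.
  - move=> z2; rewrite ltNge; apply/negP => f2.
    have : P j (B (F z)) by apply/(bicollar_P surfX nyk bB).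
    rewrite EF//; apply: (intK_sbd surfX nyk).
    by apply: (preserves_intK surfX nyk hh hp); exact: Bn.
  - move=> z20 cz; have [_ ->] := Faxis z20.
    by rewrite -[X in _ < X]L'c /L' ltrD2r; exact: decr.
  - move=> z20 cz; have [_ ->] := Faxis z20.
    by rewrite -[X in X < _]L'c /L' ltrD2r; exact: decr.
have [_ oh] := (MF_repP orO h).1 mh.
have [e [Oe ex]] := O_cover orO x0.
have ehx : cdom e (h x0) by rewrite hx0.
have D1 := odeg_chart orO (oh x0) Oe Oe ex ehx.
have ce := O_chart orO Oe.
have [_ Ne] := chart_continuous ce ex.
have [s s0 sD] := nbhs_disk (filterI (cB q _ Ne : nbhs q (B @^-1` cdom e)) (disk_nbhs q half0)).
have emG : emb (cmap e \o B) q s.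
  split=> //.
    apply/subspace_continuousP => z Dz N NG; have [ez _] := sD _ Dz.
    have [cez _] := chart_continuous ce ez.
    have := cB z _ (cez _ NG); rewrite /within /=.
    by apply: (@filterS _ (nbhs z)) => w Hw _.
  move=> a b Da Db /= E; have [ea D2] := sD _ Da; have [eb D3] := sD _ Db.
  apply: inj1; first by apply: le_trans (d1 _ _ (ltW half0) D2) _; lra.
    by apply: le_trans (d1 _ _ (ltW half0) D3) _; lra.
  by rewrite -(cmapK ce ea) E cmapK.
have [eps degG] := deg_exists emG.
have [l El] := deg_odd degG.
have C1 : deg (cmap e \o h \o cinv e \o (cmap e \o B)) q (1 * eps).
  exact: (deg_comp degG).
have C2 : deg (cmap e \o B \o F) q (eps * -1).
  by apply: (deg_comp degF); rewrite Fq.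
have C3 : deg (cmap e \o B \o F) q (1 * eps).
  apply: (deg_eq_near C1).
  have N1 : nbhs q (closed_disk q r `&` (B @^-1` cdom e)).
    by apply: filterI; [exact: disk_nbhs|exact: cB].
  apply: (@filterS _ (nbhs q) _ _ _ _ N1) => z [Dz ez] /=.
  by rewrite (cmapK ce ez) EF.
by have := deg_unique C2 C3; rewrite El; lia.
Qed.

(** In degree [1] the lift [L] is increasing and commutes with the period, so the averages of the
    identity and [L] weighted by [tent] are again such maps. They extend [L] to a homeomorphism
    equal to the identity away from the circle, whose inverse is composed with [h]. *)
Lemma twist_one : MF_rep O h -> exists h2,
  [/\ isotopic R h h2, preserves K P h2, forall x, sbd (P j) x -> h2 x = x &
      forall k x, k != j -> P k x -> h2 x = h x].
Proof.
move=> mh; have [L [cL EL]] := circle_lift.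
have [m Lper Lmod] := circle_lift_degree cL EL.
have m1 := circle_lift_orient mh cL EL Lper Lmod.
have incr := circle_map_incr cL Lper Lmod m1.
have [cB oB Beq Bn [B0 Bp _]] := bB.
have p0 := @two_pi_gt0 R.
have Lperz t (k : int) : L (t + 2 * pi * k%:~R) = L t + 2 * pi * k%:~R.
  by rewrite (circle_map_perz Lper) m1 mul1r.
have [C HC] : exists C : R, forall t, `|L t - t| <= C.
  have cD : continuous (fun t => `|L t - t|) by ct.
  have [c _ Hc] := EVT_max (ltW p0) (continuous_subspaceT cD).
  exists `|L c - c| => t.
  have [k /andP[h1 h2]] := period_reduce t.
  have -> : L t - t = L (t + 2 * pi * k%:~R) - (t + 2 * pi * k%:~R).
    by rewrite Lperz; ring.
  by apply: Hc; rewrite in_itv /= h1 ltW.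
pose wt (t u : R) := clamp01 t * tent u.
have wt01 t u : 0 <= wt t u <= 1.
  have /andP[t0 t1] := clamp01_itv t.
  rewrite /wt mulr_ge0 ?tent_ge0//= -[leRHS]mulr1.
  by apply: ler_pM => //; [exact: tent_ge0|exact: tent_le1].
pose phi (t u x : R) := x + wt t u * (L x - x).
have cphi t u : continuous (phi t u) by rewrite /phi; ct.
have phi_lt (t u x y : R) : x < y -> phi t u x < phi t u y.
  move=> xy; have Lxy := incr _ _ xy.
  have := wt01 t u; rewrite /phi; move: (wt t u) => w /andP[w0 w1].
  have -> : x + w * (L x - x) = (1 - w) * x + w * L x by ring.
  have -> : y + w * (L y - y) = (1 - w) * y + w * L y by ring.
  have [->|wN] := eqVneq w 0; first by rewrite subr0 !mul1r !mul0r !addr0.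
  have h1 : w * L x < w * L y by rewrite ltr_pM2l// lt_def wN.
  have h2 : (1 - w) * x <= (1 - w) * y by rewrite ler_wpM2l ?subr_ge0// ltW.
  by lra.
have phi_near (t u x : R) : `|phi t u x - x| <= C.
  rewrite /phi addrAC subrr add0r normrM; have /andP[w0 w1] := wt01 t u.
  apply: le_trans (HC x); rewrite (ger0_norm w0) -[leRHS]mul1r.
  by apply: ler_wpM2r.
have /choice[psi Hpsi] : forall tu : R * R, exists m' : R -> R,
    (forall v, m' (phi tu.1 tu.2 v) = v) /\ (forall v, phi tu.1 tu.2 (m' v) = v).
  by move=> tu; exact: (near_id_bij (cphi tu.1 tu.2) (@phi_lt tu.1 tu.2) (@phi_near tu.1 tu.2)).
have phiz (t u x : R) (k : int) : phi t u (x + 2 * pi * k%:~R) = phi t u x + 2 * pi * k%:~R.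
  by rewrite /phi Lperz; ring.
have [||||||H [iH HE HN]] := @band_isotopy R X K n P surfX j g Ua B bB
  (fun t z => (phi t z.2 z.1, z.2)) (fun t z => (psi (t, z.2) z.1, z.2)) 1.
- by move=> t z k /=; rewrite phiz.
- move=> t z k /=; congr (_, _); have [E1 E2] := Hpsi (t, z.2); move: E1 E2 => /= E1 E2.
  by rewrite -[RHS]E1 phiz E2.
- have := @tent_continuous R => ?; have := @clamp01_continuous R => ?.
  by rewrite /phi /wt; ct.
- by move=> t z /=; have [_ /= ->] := Hpsi (t, z.2); rewrite -pairE.
- by move=> t z /=; have [/= -> _] := Hpsi (t, z.2); rewrite -pairE.
- by move=> t z z1; rewrite /phi /wt tent_out// mulr0 mul0r addr0 -pairE.
have H0 : H 0 = id.
  apply/funext => x; have [[z <-]|nx] := pselect (exists z, B z = x).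
    by rewrite HE /phi /wt clamp010 !mul0r addr0 -pairE.
  by apply: HN => z Ez; apply: nx; exists z.
have hH1 : homeo (H 1) by case: iH.
have [G [hG GK KG]] := homeo_invE hH1.
have H1fix k x : k != j -> P k x -> H 1 x = x.
  move=> kj Pk; apply: HN => z Ez.
  by apply: (bicollar_other surfX nyk bB (z := z) kj); rewrite Ez.
have pH1 : preserves K P (H 1).
  apply/(preservesP K P hH1); split=> [x|i x].
    have [[z <-]|nx] := pselect (exists z, B z = x).
      rewrite HE; split=> /(bicollar_K surfX nyk bB) z0;
        exact/(bicollar_K surfX nyk bB).
    by rewrite HN// => z Ez; apply: nx; exists z.
  have [[z <-]|nx] := pselect (exists z, B z = x); last first.
    by rewrite HN// => z Ez; apply: nx; exists z.
  rewrite HE; have [->|ij] := eqVneq i j.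
    by split=> /(bicollar_P surfX nyk bB) z0; exact/(bicollar_P surfX nyk bB).
  by split=> /(bicollar_other surfX nyk bB ij).
have pG : preserves K P G.
  have [HK HP] := (preservesP K P hH1).1 pH1.
  by apply/(preservesP K P hG); split=> [x|i x];
    [have := HK (G x)|have := HP i (G x)]; rewrite KG => -[? ?]; split.
exists (G \o h); split.
- have i1 : isotopic R id (H 1) by apply/isotopyP; exists H.
  have := isotopic_comp (isotopic_sym i1) (isotopic_refl R (homeo_comp hG hh)).
  by congr (isotopic _ _ _); apply/funext => x /=; rewrite KG.
- exact: preserves_comp.
- move=> x jx; have [t Ex] := bicollar_sbd surfX nyk pe bB jx.
  rewrite /= Ex EL -[RHS]GK HE /phi /wt /= clamp011 tent0 !mul1r.
  by rewrite addrC subrK.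
- move=> k x kj Pk /=; have [HK HP] := (preservesP K P hh).1 hp.
  have Pkh : P k (h x) by apply: (HP k x).1.
  by rewrite -{1}(H1fix k _ kj Pkh) GK.
Qed.

End OneCircle.

Lemma twist_all h : MF_rep O h -> preserves K P h -> exists h2,
  [/\ isotopic R h h2, preserves K P h2 & forall i x, sbd (P i) x -> h2 x = x].
Proof.
move=> mh hp.
have step (l : seq 'I_n) : exists h2,
  [/\ isotopic R h h2, preserves K P h2 &
      forall i x, i \in l -> sbd (P i) x -> h2 x = x].
  elim: l => [|j l [h1 [i1 p1 f1]]].
    by exists h; split=> //; apply: isotopic_refl; case/(MF_repP orO): mh.
  have m1 := MF_rep_isotopic orO mh i1; have [hh1 _] := (MF_repP orO h1).1 m1.
  have [f [g [Ua pe]]] := pipe_end0 nyk j.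
  have [B bB] := bicollar_exists surfX nyk pe.
  have [h2 [i2 p2 f2 o2]] := twist_one pe bB hh1 p1 m1.
  exists h2; split=> //; first exact: isotopic_trans i1 i2.
  move=> i x; rewrite inE; have [-> _|ij /= il ix] := eqVneq i j; first exact: f2.
  by rewrite (o2 i x ij (sbdP_P nyk ix)); exact: f1 ix.
have [h2 [i2 p2 f2]] := step (enum 'I_n).
by exists h2; split=> // i x; apply: f2; rewrite mem_enum.
Qed.

End Twist.

(** * Gluing along the circles *)

Section Gluing.
Variables (R : realType) (X : topologicalType) (O : set (chart R X))
  (K : set X) (n : nat) (P : 'I_n -> set X).
Hypothesis surfX : surface R X.
Hypothesis orO : is_orientation O.
Hypothesis nyk : nyikos_decomposition R K P.
Implicit Types (x y : X) (i j k : 'I_n).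

Local Notation sbd := (sbd R).

Lemma closed_cover_continuous (T U : topologicalType) (A : set T) (B : 'I_n -> set T)
    (f : T -> U) : closed A -> (forall i, closed (B i)) ->
  (forall t, A t \/ exists i, B i t) -> {within A, continuous f} ->
  (forall i, {within B i, continuous f}) -> continuous f.
Proof.
move=> clA clB cov cA cB x N Nx.
have near1 (C : set T) : closed C -> {within C, continuous f} ->
    \forall y \near x, C y -> N (f y).
  move=> clC /subspace_continuousP cC; have [Cx|nC] := pselect (C x).
    exact: (cC x Cx N Nx).
  have : nbhs x (~` C) by apply: open_nbhs_nbhs; split=> //; exact: closed_openC.
  by apply: (@filterS _ (nbhs x)).
have HB : \forall y \near x, forall i, B i y -> N (f y).
  by apply: filter_forall => i; exact: near1.
apply: filterS (filterI (near1 A clA cA) HB) => y [HA HB'] /=.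
by case: (cov y) => [/HA|[i /HB']].
Qed.

Lemma glued_exists (h0 : X -> X) (hs : 'I_n -> X -> X) :
  (forall i x, sbd (P i) x -> h0 x = hs i x) -> exists h, glued K P h0 hs h.
Proof.
move=> E; have /choice[h Hh] : forall x, exists y,
    (K x -> y = h0 x) /\ (forall i, P i x -> y = hs i x).
  move=> x; have [Kx|nK] := pselect (K x).
    by exists (h0 x); split=> // i Px; apply: E; rewrite -(KP nyk).
  have [i Px] : exists i, P i x by case: (coverX nyk x).
  by exists (hs i x); split=> // k Pk; rewrite (disjP nyk Px Pk).
by exists h; split=> [x|i x]; have [] := Hh x => // _; apply.
Qed.

Lemma within_eq (T U : topologicalType) (A : set T) (f g : T -> U) :
  {within A, continuous f} -> (forall t, A t -> g t = f t) -> {within A, continuous g}.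
Proof.
move=> /subspace_continuousP cf E; apply/subspace_continuousP => x Ax N Ng.
have Nf : nbhs (f x) N by rewrite -E.
have := cf x Ax N Nf; rewrite /within /=; apply: (@filterS _ (nbhs x)) => y Hy Ay.
by have : N (f y) := Hy Ay; rewrite -E.
Qed.

Lemma glued_continuous (h0 : X -> X) (hs : 'I_n -> X -> X) h :
  {within K, continuous h0} -> (forall i, {within P i, continuous (hs i)}) ->
  glued K P h0 hs h -> continuous h.
Proof.
move=> c0 cs [E0 Es]; apply: (closed_cover_continuous (closedK surfX nyk)
  (closedP surfX nyk) (coverX nyk)).
- exact: within_eq c0 E0.
- by move=> i; exact: within_eq (cs i) (Es i).
Qed.

Definition piecewise_homeo (h0 : X -> X) (hs : 'I_n -> X -> X) :=
  [/\ self_homeo K h0, forall i, self_homeo (P i) (hs i),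
      forall x, sbd K x -> h0 x = x & forall i x, sbd (P i) x -> hs i x = x].

Lemma glued_homeo (h0 : X -> X) (hs : 'I_n -> X -> X) h : piecewise_homeo h0 hs ->
  glued K P h0 hs h -> homeo h /\ preserves K P h.
Proof.
move=> [s0 ss f0 fs] gl; have [g0 [c0 cg0 hK gK [K1 K2]]] := s0.
have /choice[gs Hgs] := ss.
have fixK i x : sbd (P i) x -> h0 x = x.
  by move=> ix; apply: f0; apply/(sbdKP nyk); exists i.
have [|g glg] := @glued_exists g0 gs.
  move=> i x ix; have [_ _ _ _ [L1 L2]] := Hgs i.
  rewrite -{1}(fixK i x ix) K1; last exact: (sbdP_K nyk ix).
  by rewrite -{2}(fs i x ix) L1//; exact: (sbdP_P nyk ix).
have [E0 Es] := gl; have [F0 Fs] := glg.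
have gh x : g (h x) = x.
  have [Kx|[i Px]] := coverX nyk x.
    rewrite E0// F0 ?K1//; by apply: hK; exists x.
  have [_ _ hP _ [L1 L2]] := Hgs i.
  by rewrite (Es i)// (Fs i) ?L1//; apply: hP; exists x.
have hg x : h (g x) = x.
  have [Kx|[i Px]] := coverX nyk x.
    rewrite F0// E0 ?K2//; by apply: gK; exists x.
  have [_ _ _ gP [L1 L2]] := Hgs i.
  by rewrite (Fs i)// (Es i) ?L2//; apply: gP; exists x.
have ch : continuous h.
  by apply: glued_continuous gl => // i; have [] := Hgs i.
have hh : homeo h by exact: (bij_homeo surfX ch gh hg).
split=> //; apply/(preservesP K P hh); split=> [x|i x].
  split=> [Kx|Kx]; first by rewrite E0//; apply: hK; exists x.
  by rewrite -(gh x) F0//; apply: gK; exists (h x).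
have [_ _ hP gP _] := Hgs i.
split=> [Px|Px]; first by rewrite (Es i)//; apply: hP; exists x.
by rewrite -(gh x) (Fs i)//; apply: gP; exists (h x).
Qed.

Lemma sbdP_near_int i x (N : set X) : sbd (P i) x -> nbhs x N ->
  exists2 y, N y & interior (P i) y.
Proof.
move=> ix Nx; have [f [g [Ua pe]]] := pipe_end0 nyk i.
have [_ [/cis_surj[t Et] Ex]] := end_height0 surfX nyk pe ix.
have [fg oU sU] := pe.
have Ez : cyl g (t, 0) = x by rewrite /cyl /= maxxx -Et Ex.
have Nz : nbhs (cyl g (t, 0)) N by rewrite Ez.
have /nbhs_disk[r r0 rD] : nbhs (t, 0) (cyl g @^-1` N) by exact: (cyl_continuous fg Nz).
exists (cyl g (t, r)); first by apply: rD; rewrite /closed_disk /= subrr subr0 expr0n /= add0r.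
exact: (cyl_interior surfX fg oU).
Qed.

Lemma MS_rep_odeg (S : set X) h x : bsurface R S -> MS_rep O S h -> interior S x ->
  odeg O h x 1.
Proof.
move=> bS [[g [ch _ _ _ _]] _ oh] iS.
have E := setD_sbd surfX bS.
rewrite E in oh.
apply: (orient_pres_onP orO _ _).1 iS => //; first exact: open_interior.
by apply: continuous_subspaceW ch; exact: interior_subset.
Qed.

Lemma MS_rep_piecewise h0 hs : MS_rep O K h0 -> (forall i, MS_rep O (P i) (hs i)) ->
  piecewise_homeo h0 hs.
Proof.
by move=> [s0 f0 _] Hs; split=> // i; have [] := Hs i.
Qed.

(** Nothing is assumed about orientation at the circles themselves; there the degree is read off at
    a nearby interior point of the pipe, being locally constant. *)
Lemma glued_MF_rep h0 hs h : MS_rep O K h0 -> (forall i, MS_rep O (P i) (hs i)) ->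
  glued K P h0 hs h -> MF_rep O h /\ preserves K P h.
Proof.
move=> m0 ms gl; have [hh hp] := glued_homeo (MS_rep_piecewise m0 ms) gl.
split=> //; apply/(MF_repP orO); split=> //.
have [E0 Es] := gl.
have dP i y : interior (P i) y -> odeg O h y 1.
  move=> iy; apply: (odeg_eq_near orO (MS_rep_odeg (bsurfP nyk i) (ms i) iy)).
  by apply: (@filterS _ (nbhs y) _ _ _ _ iy) => w Pw; rewrite (Es i).
move=> x; have [iK|[i [ix|iP]]] := trichotomy surfX nyk x.
- apply: (odeg_eq_near orO (MS_rep_odeg (bsurfK nyk) m0 iK)).
  by apply: (@filterS _ (nbhs x) _ _ _ _ iK) => w Kw; rewrite E0.
- have cT : {within setT, continuous h} by apply: continuous_subspaceT; exact: homeo_continuous.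
  have iT a b : setT a -> setT b -> h a = h b -> a = b by move=> _ _; exact: homeo_inj.
  have [m hm] : exists m, odeg O h x m.
    by apply: (odeg_exists orO _ cT iT); exact: filterT.
  have nm := odeg_near orO openT I cT iT hm.
  have [y ym iy] := sbdP_near_int ix nm.
  by rewrite -(odeg_unique orO ym (dP i y iy)).
- exact: dP iP.
Qed.

(** The isotopies fix the circles at every time, so they glue; joint continuity follows from the
    finite closed cover of the product of time and surface. *)
Lemma glued_isotopic h0 hs h0' hs' h h' :
  MS_rep O K h0 -> (forall i, MS_rep O (P i) (hs i)) ->
  isotopic_rel R K (sbd K) h0 h0' ->
  (forall i, isotopic_rel R (P i) (sbd (P i)) (hs i) (hs' i)) ->
  glued K P h0 hs h -> glued K P h0' hs' h' -> isotopic R h h'.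
Proof.
move=> m0 ms [H0 [c0 s0 f0 E00 E01]] /choice[Hs HHs] gl gl'.
have pw t : piecewise_homeo (H0 (clamp01 t)) (fun i => Hs i (clamp01 t)).
  have t01 := clamp01_itv t; split.
  - exact: s0.
  - by move=> i; have [_ ss _ _ _] := HHs i; exact: ss.
  - by move=> x; exact: f0.
  - by move=> i x; have [_ _ fs _ _] := HHs i; exact: fs.
have /choice[G HG] : forall t, exists g, glued K P (H0 (clamp01 t)) (fun i => Hs i (clamp01 t)) g.
  move=> t; apply: glued_exists => i x ix; have [_ _ f1 f2] := pw t.
  by rewrite f1 ?f2//; apply/(sbdKP nyk); exists i.
apply/isotopyP; exists G.
have c01 := @clamp01_continuous R.
have cmap (S : set X) (H : R -> X -> X) :
    {within [set p : R * X | 0 <= p.1 <= 1 /\ S p.2], continuous (fun p : R * X => H p.1 p.2)} ->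
    {within [set p : R * X | S p.2], continuous (fun p : R * X => H (clamp01 p.1) p.2)}.
  move=> /subspace_continuousP cH; apply/subspace_continuousP => -[t x] /= Sx N Nx.
  have := cH (clamp01 t, x) (conj (clamp01_itv t) Sx) N Nx; rewrite /within /=.
  have cc : continuous (fun p : R * X => (clamp01 p.1, p.2)) by ct.
  move=> /(cc (t, x)); apply: (@filterS _ (nbhs (t, x))) => p Hp Sp.
  by apply: Hp; split=> //; exact: clamp01_itv.
have csnd : continuous (fun p : R * X => p.2) by ct.
have closed2 (S : set X) : closed S -> closed [set p : R * X | S p.2].
  by move=> clS; apply: (@closed_comp _ _ (fun p : R * X => p.2) S) => // p _; exact: csnd.
split; [split| |].
- apply: (@closed_cover_continuous (R * X)%type X [set p | K p.2] (fun i => [set p | P i p.2])).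
  + exact: (closed2 _ (closedK surfX nyk)).
  + by move=> i; apply: (closed2 (P i)); exact: (closedP surfX nyk (i := i)).
  + by move=> p; exact: coverX nyk p.2.
  + by apply: within_eq (cmap _ _ c0) _ => p Kp; have [-> //] := HG p.1.
  + move=> i; have [ci _ _ _ _] := HHs i.
    by apply: within_eq (cmap _ _ ci) _ => p Pp; have [_ Hi] := HG p.1; rewrite (Hi i).
- by move=> t; have [] := glued_homeo (pw t) (HG t).
- have [F0 Fs] := HG 0; have [D0 Ds] := gl.
  apply/funext => x; have [Kx|[i Px]] := coverX nyk x.
    by rewrite F0// D0// clamp010 E00.
  by rewrite (Fs i)// (Ds i)// clamp010; have [_ _ _ -> ] := HHs i.
- have [F0 Fs] := HG 1; have [D0 Ds] := gl'.
  apply/funext => x; have [Kx|[i Px]] := coverX nyk x.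
    by rewrite F0// D0// clamp011 E01.
  by rewrite (Fs i)// (Ds i)// clamp011; have [_ _ _ _ -> ] := HHs i.
Qed.

(* A homeomorphism fixing a neighbourhood of every [sbd (P j)] permutes the
   components of the complement, and fixes points of each of them. *)
Lemma id_near_preserves h (W : set X) : homeo h -> open W ->
  (forall i, sbd (P i) `<=` W) -> (forall x, W x -> h x = x) -> preserves K P h.
Proof.
move=> hh oW sW idW.
have half (f : X -> X) : homeo f -> (forall x, W x -> f x = x) ->
    forall j x, interior (P j) x -> interior (P j) (f x).
  move=> hf idf j.
  have avoid i x : interior (P j) x -> ~ sbd (P i) (f x).
    move=> jx ifx; have E : f x = x.
      by apply: (homeo_inj hf); apply: idf; exact: (sW i).
    rewrite E in ifx.
    by apply: (intP_K surfX nyk jx); exact: (sbdP_K nyk ifx).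
  have [x0 jx0] : exists x, sbd (P j) x.
    have [f1 [g1 [U1 pe]]] := pipe_end0 nyk j.
    exists (g1 ((1, 0), 0)); apply: (end_sbd surfX nyk pe).
    exact: unit_circle1.
  have [y0 Wy0 jy0] := sbdP_near_int jx0 (open_nbhs_nbhs (conj oW (sW j x0 jx0))).
  have conn : connected (f @` interior (P j)).
    apply: connected_continuous_connected; first exact: (connected_intP surfX nyk).
    by apply: continuous_subspaceT; exact: homeo_continuous.
  have E : f @` interior (P j) `&` interior (P j) = f @` interior (P j).
    apply: conn.
    - by exists y0; split=> //; exists y0 => //; exact: idf.
    - by exists (interior (P j)) => //; exact: open_interior.
    - exists (P j); first exact: (closedP surfX nyk).
      apply/seteqP; split=> y [Fy Py]; split=> //; first exact: interior_subset.
      apply: contrapT => nint; have [x jx Exy] := Fy.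
      by apply: (avoid j x jx); rewrite Exy (sbdE surfX (bsurfP nyk j)).
  move=> x jx; have : (f @` interior (P j)) (f x) by exists x.
  by rewrite -E => -[].
have [g [hg gK Kg]] := homeo_invE hh.
have idg x : W x -> g x = x by move=> Wx; rewrite -{1}(idW x Wx) gK.
have iffP i x : interior (P i) x <-> interior (P i) (h x).
  split; first exact: half.
  by move=> /(half g hg idg); rewrite gK.
apply/(preservesP K P hh); split=> [x|i x].
  split=> Kx; apply: contrapT => /(notK surfX nyk)[i ix].
    exact: (intP_K surfX nyk ((iffP i x).2 ix) Kx).
  exact: (intP_K surfX nyk ((iffP i x).1 ix) Kx).
have sb : sbd (P i) x <-> sbd (P i) (h x).
  split=> [ix|ix]; first by rewrite idW//; exact: (sW i).
  by rewrite -(gK x) idg//; exact: (sW i).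
have split_ y : P i y <-> sbd (P i) y \/ interior (P i) y.
  split=> [Py|[/(sbdP_P nyk)//|]]; last exact: interior_subset.
  have [iy|niy] := pselect (interior (P i) y); first by right.
  by left; rewrite (sbdE surfX (bsurfP nyk i)).
split=> /split_ H; apply/split_.
  by case: H => [/sb.1|/(iffP i x).1] H; [left|right].
by case: H => [/sb.2|/(iffP i x).2] H; [left|right].
Qed.

Lemma in_N_sub h : in_N O K P h -> exists h',
  [/\ MF_rep O h', preserves K P h', isotopic R h h' &
      forall i x, sbd (P i) x -> h' x = x].
Proof.
move=> [h1 [m1 p1 i1]]; have [h2 [i2 p2 f2]] := twist_all surfX orO nyk m1 p1.
exists h2; split=> //; last exact: isotopic_trans i1 i2.
exact: (MF_rep_isotopic orO m1).
Qed.

(** Separates the action on [K] from that on the pipes, so that the latter can be conjugated alone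
    in [in_N_conj]. *)
Lemma split_homeo h : homeo h -> preserves K P h ->
  (forall i x, sbd (P i) x -> h x = x) -> exists hK hP,
  [/\ homeo hK, homeo hP, h = hK \o hP, forall x, ~ interior K x -> hK x = x &
      forall x, K x -> hP x = x].
Proof.
move=> hh hp fx.
have shK : self_homeo K h.
  have [HK _] := (preservesP K P hh).1 hp; have [g [hg gK Kg]] := homeo_invE hh.
  exists g; split=> //; try by apply: continuous_subspaceT; exact: homeo_continuous.
  - by move=> _ [x Kx <-]; apply: (HK x).1.
  - by move=> _ [x Kx <-]; apply: (HK _).2; rewrite Kg.
have shP i : self_homeo (P i) h.
  have [_ HP] := (preservesP K P hh).1 hp; have [g [hg gK Kg]] := homeo_invE hh.
  exists g; split=> //; try by apply: continuous_subspaceT; exact: homeo_continuous.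
  - by move=> _ [x Px <-]; apply: (HP i x).1.
  - by move=> _ [x Px <-]; apply: (HP i _).2; rewrite Kg.
have fK x : sbd K x -> h x = x by move=> /(sbdKP nyk)[i]; exact: fx.
have sid (S : set X) : self_homeo S id.
  exists id; split=> //; try by apply: continuous_subspaceT => ?; exact: cvg_id.
  - by move=> _ [x Sx <-].
  - by move=> _ [x Sx <-].
have [|hK glK] := @glued_exists h (fun=> id); first exact: fx.
have [|hP glP] := @glued_exists id (fun=> h).
  by move=> i x ix; rewrite (fx i).
have [hhK _] := glued_homeo (And4 shK (fun=> sid _) fK (fun _ _ _ => erefl)) glK.
have [hhP _] := glued_homeo (And4 (sid K) shP (fun _ _ => erefl) fx) glP.
have [K0 Ks] := glK; have [P0 Ps] := glP.
have [_ HP] := (preservesP K P hh).1 hp.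
exists hK, hP; split=> //.
- apply/funext => x /=; have [Kx|[i Px]] := coverX nyk x.
    by rewrite P0// K0.
  by rewrite (Ps i)// (Ks i)//; apply: (HP i x).1.
- move=> x nK; have [//|[i [ix|ix]]] := trichotomy surfX nyk x.
    by apply: (Ks i); exact: (sbdP_P nyk ix).
  by apply: (Ks i); exact: interior_subset.
Qed.

Lemma compact_bigU (S : 'I_n -> set X) : (forall i, compact (S i)) ->
  compact (\bigcup_i S i).
Proof.
move=> cS.
have -> : \bigcup_i S i = \big[setU/set0]_(i <- enum 'I_n) S i.
  rewrite -bigcup_seq; apply/seteqP; split=> x [i _ Sx]; exists i => //=.
  by rewrite mem_enum.
by apply: big_ind => //; [exact: compact0|exact: compactU].
Qed.

(* [f = g h g^-1] need not preserve the decomposition, so it is corrected in two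
   steps: [T'] pushes the circles off [g K], into the images of the pipes, and
   [h] is made the identity on the part of the pipes that they then meet. *)
Lemma in_N_conj g ginv h : MF_rep O g -> MF_rep O h -> in_N O K P h ->
  (forall x, ginv (g x) = x) -> (forall x, g (ginv x) = x) ->
  in_N O K P (g \o h \o ginv).
Proof.
move=> mg mh /in_N_sub[h1 [m1 p1 i1 f1]] gK Kg.
have mgi := MF_rep_inv orO mg gK Kg.
have [hg _] := (MF_repP orO g).1 mg; have [hgi _] := (MF_repP orO ginv).1 mgi.
have [hh1 _] := (MF_repP orO h1).1 m1.
have [hK [hP [hhK hhP Eh fK fP]]] := split_homeo hh1 p1 f1.
have cg := homeo_continuous hg; have cgi := homeo_continuous hgi.
have [|T' [iT' QT']] := @push_all R X K n P surfX nyk (g @` K).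
  apply: continuous_compact; last exact: (compactK nyk).
  exact: continuous_subspaceT.
have [_ hT'] := isotopic_homeo iT'.
have [|T [iT QT]] := @push_all R X K n P surfX nyk (\bigcup_i (ginv @` (T' @` sbd (P i)))).
  apply: compact_bigU => i; apply: continuous_compact; first exact: continuous_subspaceT.
  apply: continuous_compact; last exact: (compact_sbdP nyk).
  by apply: continuous_subspaceT; exact: homeo_continuous.
have [_ hT] := isotopic_homeo iT.
have [S [hS SK KS]] := homeo_invE hT; have [S' [hS' SK' KS']] := homeo_invE hT'.
(* Conjugation by [T] changes [hP] only by an isotopy, but enlarges its known fixed region from [K]
   to the image of [K] under [T]. *)
pose h2 := hK \o (T \o hP \o S).
have i2 : isotopic R h1 h2.
  rewrite Eh; apply: isotopic_comp; first exact: isotopic_refl.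
  have iS : isotopic R id S by exact: (isotopic_inv surfX iT).
  exact: (isotopic_comp (isotopic_comp iT (isotopic_refl R hhP)) iS).
pose f2 := S' \o (g \o h2 \o ginv) \o T'.
have i3 : isotopic R (g \o h \o ginv) f2.
  have iS' : isotopic R id S' by exact: (isotopic_inv surfX iT').
  have i4 : isotopic R (g \o h \o ginv) (g \o h2 \o ginv).
    apply: isotopic_comp; last exact: isotopic_refl.
    apply: isotopic_comp; first exact: isotopic_refl.
    exact: isotopic_trans i1 i2.
  exact: (isotopic_comp (isotopic_comp iS' i4) iT').
have mf : MF_rep O (g \o h \o ginv) by do 2 apply: (MF_rep_comp orO) => //.
have mf2 := MF_rep_isotopic orO mf i3.
exists f2; split=> //.
have [hf2 _] := (MF_repP orO f2).1 mf2.
(* On [V] both factors of [h2] are the identity: [S] lands in [K], where [hP] does nothing, and [hK]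
   does nothing off [K]. *)
pose V := (S @^-1` interior K) `&` ~` K.
have oV : open V.
  apply: openI; last by apply: closed_openC; exact: (closedK surfX nyk).
  apply: open_comp; last exact: open_interior.
  by move=> ? _; exact: homeo_continuous.
have idV x : V x -> h2 x = x.
  move=> [Sx nK]; rewrite /h2 /= fP; last exact: interior_subset.
  by rewrite KS fK// => /interior_subset.
have cT' := homeo_continuous hT'.
apply: (@id_near_preserves f2 ((ginv \o T') @^-1` V)) => //.
- apply: open_comp => // x _.
  by apply: continuous_comp; [exact: cT'|exact: cgi].
- move=> i x ix; split.
    have [|y iy Ey] := QT (ginv (T' x)).
      by exists i => //; exists (T' x) => //; exists x.
    by rewrite /= -Ey SK.
  (* If [ginv (T' x)] were in [K], then [T' x] would lie in the image of [K] under [g], hence be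
     [T' y] with [y] interior to [K]; injectivity gives [x = y], yet [x] is on a circle. *)
  move=> /= Kx; have [|y iy Ey] := QT' (T' x).
    by exists (ginv (T' x)).
  have E := homeo_inj hT' Ey; rewrite E in iy.
  exact: (intK_sbd surfX nyk iy (sbdP_P nyk ix)).
- move=> x Vx; rewrite /f2 /= idV//.
  by rewrite Kg SK'.
Qed.

End Gluing.

Theorem theorem4p3 (R : realType) (X : topologicalType)
  (O : set (chart R X)) (K : set X) (n : nat) (P : 'I_n -> set X) :
  surface R X -> omega_bounded X -> is_orientation O ->
  nyikos_decomposition R K P ->
  (* (1) N(F) is a normal subgroup of M(F) *)
  [/\ in_N O K P id,
      (forall h h', MF_rep O h -> MF_rep O h' -> in_N O K P h -> in_N O K P h' ->
         in_N O K P (h \o h')),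
      (forall h hinv, MF_rep O h -> in_N O K P h ->
         (forall x, hinv (h x) = x) -> (forall x, h (hinv x) = x) ->
         in_N O K P hinv) &
      (forall g ginv h, MF_rep O g -> MF_rep O h -> in_N O K P h ->
         (forall x, ginv (g x) = x) -> (forall x, g (ginv x) = x) ->
         in_N O K P (g \o h \o ginv))] /\
  (* (2) theta is a well-defined group epimorphism *)
  [/\ (* gluing representatives gives a representative of an element of N(F) *)
      (forall h0 hs, MS_rep O K h0 -> (forall i, MS_rep O (P i) (hs i)) ->
         (exists h, glued K P h0 hs h) /\
         (forall h, glued K P h0 hs h -> MF_rep O h /\ preserves K P h)),
      (* independence of the chosen representatives *)
      (forall h0 hs h0' hs' h h',
         MS_rep O K h0 -> (forall i, MS_rep O (P i) (hs i)) ->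
         MS_rep O K h0' -> (forall i, MS_rep O (P i) (hs' i)) ->
         isotopic_rel R K (sbd R K) h0 h0' ->
         (forall i, isotopic_rel R (P i) (sbd R (P i)) (hs i) (hs' i)) ->
         glued K P h0 hs h -> glued K P h0' hs' h' -> isotopic R h h'),
      (* homomorphism *)
      (forall h0 hs h0' hs' h h' g,
         MS_rep O K h0 -> (forall i, MS_rep O (P i) (hs i)) ->
         MS_rep O K h0' -> (forall i, MS_rep O (P i) (hs' i)) ->
         glued K P h0 hs h -> glued K P h0' hs' h' ->
         glued K P (h0 \o h0') (fun i => hs i \o hs' i) g ->
         isotopic R g (h \o h')) &
      (* surjectivity onto N(F) *)
      (forall h, MF_rep O h -> in_N O K P h ->
         exists h0 hs g, [/\ MS_rep O K h0, (forall i, MS_rep O (P i) (hs i)),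
                            glued K P h0 hs g & isotopic R g h])].
Proof.
move=> surfX _ orO nyk.
have MF_in_N h : MF_rep O h -> preserves K P h -> in_N O K P h.
  by move=> mh hp; exists h; split=> //; apply: isotopic_refl; case/(MF_repP orO): mh.
have id_N : in_N O K P id.
  apply: MF_in_N; first exact: (MF_rep_id orO).
  by split=> [|i]; rewrite image_id.
split; split.
- exact: id_N.
- move=> h h' _ _ [h1 [m1 p1 i1]] [h2 [m2 p2 i2]]; exists (h1 \o h2); split.
  + exact: (MF_rep_comp orO).
  + exact: preserves_comp.
  + exact: isotopic_comp.
- move=> h hinv _ [h1 [m1 p1 i1]] K1 K2.
  have [hh1 _] := (MF_repP orO h1).1 m1.
  have [g [hg gK Kg]] := homeo_invE hh1.
  exists g; split.
  + exact: (MF_rep_inv orO m1).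
  + have [HK HP] := (preservesP K P hh1).1 p1.
    by apply/(preservesP K P hg); split=> [x|i x];
      [have := HK (g x)|have := HP i (g x)]; rewrite Kg => -[? ?]; split.
  + exact: (isotopic_inv surfX i1).
- by move=> g ginv h mg mh hN K1 K2; exact: (in_N_conj surfX orO nyk).
- move=> h0 hs m0 ms; split; last by move=> h; exact: (glued_MF_rep surfX orO nyk).
  apply: (glued_exists nyk) => i x ix.
  have [_ f0 _] := m0; have [_ fs _] := ms i.
  by rewrite f0 ?fs//; apply/(sbdKP nyk); exists i.
- move=> h0 hs h0' hs' h h' m0 ms _ _; exact: (glued_isotopic surfX nyk m0 ms).
- move=> h0 hs h0' hs' h h' g m0 ms m0' ms' gl gl' [G0 Gs].
  have [mh _] := glued_MF_rep surfX orO nyk m0 ms gl.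
  have [mh' _] := glued_MF_rep surfX orO nyk m0' ms' gl'.
  have [E0 Es] := gl; have [E0' Es'] := gl'.
  (* Here the composites agree pointwise, because [h0'] and each [hs' i] keep their own piece
     invariant. *)
  have -> : g = h \o h'.
    apply/funext => x /=; have [Kx|[i Px]] := coverX nyk x.
      rewrite G0// E0'// E0//; have [[? [_ _ im _ _]] _ _] := m0'.
      by apply: im; exists x.
    rewrite (Gs i)// (Es' i)// (Es i)//; have [[? [_ _ im _ _]] _ _] := ms' i.
    by apply: im; exists x.
  by apply: isotopic_refl; case/(MF_repP orO): (MF_rep_comp orO mh mh').
- move=> h _ /(in_N_sub surfX orO nyk)[h' [m' p' i' f']].
  have [hh' oh'] := (MF_repP orO h').1 m'.
  have [HK HP] := (preservesP K P hh').1 p'.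
  have [g [hg gK Kg]] := homeo_invE hh'.
  have sh (S : set X) : (forall x, S x <-> S (h' x)) -> self_homeo S h'.
    move=> HS; exists g; split=> //; try by apply: continuous_subspaceT; exact: homeo_continuous.
      by move=> _ [x /HS Sx <-].
    by move=> _ [x Sx <-]; apply/HS; rewrite Kg.
  have or (S : set X) : bsurface R S -> orient_pres_on O (S `\` sbd R S) h'.
    move=> bS; rewrite (setD_sbd surfX bS).
    apply: (orient_pres_onP orO _ _).2 => //; first exact: open_interior.
    by apply: continuous_subspaceT; exact: homeo_continuous.
  (* Once the circles are fixed pointwise, the single map [h'] represents its restrictions to all
     the pieces. *)
  exists h', (fun=> h'), h'; split=> //.
  + split; [exact: sh| |exact: or (bsurfK nyk)].
    by move=> x /(sbdKP nyk)[i]; exact: f'.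
  + by move=> i; split; [exact: sh|exact: f'|exact: or (bsurfP nyk i)].
  + exact: isotopic_sym.
Qed.
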